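(* Let $T$ be Chacon's automorphism, let $\hat T$ be its Koopman operator, let $\Theta$ be the ortho-projector to constants, and let $$\mathscr L=\Bigl\{\lim_{j\to\infty}\hat T^{-k_j}\ \text{(weak limit)}\ :\ (k_j)\text{ a sequence of integers for which this weak limit exists}\Bigr\}.$$ Then $$\mathscr L=\{\Theta\}\cup\bigl\{P_{m_1}(\hat T)\cdots P_{m_r}(\hat T)\,\hat T^n\ :\ r\ge 0,\ 1\le m_1\le\cdots\le m_r \text{ integers},\ n\in\mathbb Z\bigr\}$$ (the empty product, for $r=0$, being the identity). Moreover, limits of the form $\hat T^n$ for some $n\in\mathbb Z$ can only be obtained as limits of $\hat T^{-k_j}$ for bounded sequences: if $(k_j)$ is a sequence of integers such that $\hat T^{-k_j}\to\hat T^n$ weakly for some $n\in\mathbb Z$, then $(k_j)$ is bounded.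
   Context: Chacon's (classical) automorphism $T$ of a probability space $(X,\mathscr A,\mu)$ is the rank-one transformation built by cutting and stacking. Tower $0$ is a single interval (height $h_0=1$) of measure $2/3$. For $n\ge1$, Tower $n-1$ (of height $h_{n-1}$) is cut into 3 sub-columns of equal width, one spacer (a new interval of the same width) is inserted above the middle sub-column, and the three parts are stacked from left to right to give Tower $n$, of height $h_n=3h_{n-1}+1$. $X$ is the union of all the towers (total measure $1$), and $T$ maps each level of each tower, other than its top level, by translation onto the level above it. Thus, if $E_{n,0},\dots,E_{n,h_n-1}$ are the levels of Tower $n$ from bottom to top, then $E_{n,i}=T^iE_{n,0}$ and $E_{n,i}=E_{n+1,i}\sqcup E_{n+1,h_n+i}\sqcup E_{n+1,2h_n+i+1}$. $T$ is an invertible measure-preserving transformation (defined a.e.). Koopman operator: $\hat T f=f\circ T$ on $L^2(X,\mu)$. $\Theta f=\int f\,d\mu$ is the orthogonal projection onto constants. Weak convergence is convergence in the weak operator topology on $L^2(X,\mu)$. Polynomials $P_m$: let $\Gamma=\mathbb Z_3=\{x=(x_0,x_1,\dots):x_k\in\{0,1,2\}\}$ be the compact group of 3-adic integers, $\lambda$ its Haar probability measure, and $Sx=x+1$. Let $\phi(x)\in\{0,1\}$ be the first coordinate of $x$ different from $2$ (defined for $x\neq(2,2,\dots)$). Set $\phi^{(0)}=0$ and $\phi^{(m)}(x)=\phi(x)+\phi(Sx)+\cdots+\phi(S^{m-1}x)$ for $m\ge1$ (defined $\lambda$-a.e.). Let $\pi_m(j)=\lambda(\phi^{(m)}=j)$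 and $P_m(X)=\sum_{j=0}^m\pi_m(j)X^j$. *)

(* Defs.v *)
From HB Require Import structures.
From mathcomp Require Import all_boot all_order all_algebra.
From mathcomp Require Import all_classical all_reals all_analysis.
From mathcomp Require Import measurable_realfun ess_sup_inf.
From mathcomp Require Import zify lra ring.
Set Implicit Arguments.
Unset Strict Implicit.
Unset Printing Implicit Defensive.
Import Order.TTheory GRing.Theory Num.Theory.
Import numFieldNormedType.Exports.
Local Open Scope classical_set_scope.
Local Open Scope ring_scope.

Section Lspace_lmodType.
Context d (T : measurableType d) (R : realType).
Context (mu : {measure set T -> \bar R}) (p : \bar R) (p1 : (1 <= p)%E).

Lemma Lfun_ae_eq (f g : T -> R) : measurable_fun setT g ->
  f = g %[ae mu] -> f \in Lfun mu p -> g \in Lfun mu p.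
Proof.
move=> mg fg /andP[/set_mem/= mf /set_mem/= ff].
apply/andP; split; rewrite inE//=; move: ff; rewrite /finite_norm => ff.
have h : 'N[mu]_p[EFin \o (f \- g)%R]%E = 0%E.
  have mfg : measurable_fun setT (f \- g) by exact: measurable_funB.
  move: (lt_le_trans lte01 p1).
  case: p p1 ff => [r r1 _ r0|_ _ _|//]; last first.
    rewrite unlock; case: ifPn => // mu0; apply: ess_sup_ae_cst => //.
    by move: fg; apply: filterS => x/= /(_ I) ->; rewrite subrr normr0.
  rewrite unlock/= (_ : (\int[mu]_x _ = 0)%E) ?poweR0r//.
    by rewrite invr_neq0// gt_eqF.
  rewrite -[RHS](@integral0 _ _ _ mu setT); apply: ge0_ae_eq_integral => //.
  - apply/measurable_EFinP.
    apply: (@measurableT_comp _ _ _ _ _ _ (@powR R ^~ r)) => //.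
    exact: measurableT_comp.
  - move: fg; apply: filterS => x/= + _ => /(_ I) ->.
    by rewrite subrr normr0 powR0// gt_eqF.
have -> : EFin \o g = EFin \o (f \+ (\- (f \- g)))%R.
  by apply/funext => x /=; rewrite opprB addrCA subrr addr0.
apply: le_lt_trans (eminkowski _ _ _ p1) _ => //.
  by apply: measurableT_comp => //; exact: measurable_funB.
rewrite lte_add_pinfty//.
rewrite (_ : _ \o _ = \- (EFin \o (f \- g)%R))%E//.
by rewrite oppe_Lnorm h.
Qed.

Lemma aeEqMfun_measurable (q : {mfun_ mu, T >-> measurableTypeR R}) :
  measurable_fun [set: T] (q : T -> R).
Proof. have := @measurable_funPT _ _ _ _ (repr q); exact. Qed.

Lemma Lspace_Lfun (f : LspaceType mu p1) : (f : T -> R) \in Lfun mu p.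
Proof.
apply/andP; split; rewrite inE/=; last by case: f => f [[]].
exact: aeEqMfun_measurable.
Qed.

Lemma Lspace_ext (f g : LspaceType mu p1) : f = g %[ae mu] -> f = g.
Proof.
case: f g => [f [[Hf]]] [g [[Hg]]] /= fg.
have E : f = g.
  by rewrite -[f]reprK -[g]reprK; apply/eqquotP/asboolP.
by case: _ / E in Hg fg *; congr LebesgueSpace.Pack; congr LebesgueSpace.Class;
  congr isFinLebesgue.Axioms_; exact: Prop_irrelevance.
Qed.

Section Lclass_of.
Variables (g : T -> R) (gP : g \in Lfun mu p).

Let gm : T -> measurableTypeR R := g.
Let mg : measurable_fun setT gm.
Proof. by have /andP[/set_mem] := gP. Qed.

HB.instance Definition _ := isMeasurableFun.Build _ _ T (measurableTypeR R) gm mg.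

Let q : {mfun_ mu, T >-> measurableTypeR R} := \pi%qT (gm : {mfun T >-> measurableTypeR R}).

Lemma repr_pi_ae : (q : T -> R) = g %[ae mu].
Proof.
have /eqquotP/asboolP := reprK q; exact.
Qed.

Let q_fin : finite_norm mu p (q : T -> R).
Proof.
have /Lfun_ae_eq : g = (q : T -> R) %[ae mu] by exact/ae_eq_sym/repr_pi_ae.
by move=> /(_ (aeEqMfun_measurable q) gP) /andP[_ /set_mem].
Qed.

HB.instance Definition _ := isFinLebesgue.Build _ _ _ mu p p1 q q_fin.

Definition Lclass_of : LspaceType mu p1 := q.

End Lclass_of.

(* The class of g in L^p; the junk value 0 is used when g is not in L^p. *)
Definition Lclass (g : T -> R) : LspaceType mu p1 :=
  match boolP (g \in Lfun mu p) with
  | AltTrue gP => Lclass_of gP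
  | AltFalse _ => Lclass_of (LfunP (0 : LfunType mu p1))
  end.

Lemma LclassE (g : T -> R) : g \in Lfun mu p -> Lclass g = g %[ae mu].
Proof.
rewrite /Lclass; case: {-}_ / boolP => [gP _|/negP//].
exact: repr_pi_ae.
Qed.

Lemma eq_Lclass (f g : T -> R) : f \in Lfun mu p -> g \in Lfun mu p ->
  f = g %[ae mu] -> Lclass f = Lclass g.
Proof.
move=> fP gP fg; apply: Lspace_ext.
apply: ae_eq_trans (LclassE fP) _; apply: ae_eq_trans fg _.
exact/ae_eq_sym/LclassE.
Qed.

Lemma LclassK (f : LspaceType mu p1) : Lclass f = f.
Proof. by apply/Lspace_ext/LclassE/Lspace_Lfun. Qed.

Lemma LfunD (u v : T -> R) : u \in Lfun mu p -> v \in Lfun mu p ->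
  u \+ v \in Lfun mu p.
Proof. exact: (Lfun_addr_closed mu p1).2. Qed.

Lemma LfunN (u : T -> R) : u \in Lfun mu p -> \- u \in Lfun mu p.
Proof. exact: Lfun_oppr_closed. Qed.

Lemma LfunZ (a : R) (u : T -> R) : u \in Lfun mu p ->
  (fun x => a * u x) \in Lfun mu p.
Proof.
move=> uP; have [L0 L] := Lfun_submod_closed mu p1.
by have := L a u 0 uP L0; rewrite addr0.
Qed.

Implicit Types f g h : LspaceType mu p1.

Let zero : LspaceType mu p1 := Lclass (cst 0).
Let add f g : LspaceType mu p1 := Lclass (f \+ g).
Let opp f : LspaceType mu p1 := Lclass (\- f).
Let scale (a : R) f : LspaceType mu p1 := Lclass (fun x => a * f x).

Let Lfun0 : cst 0 \in Lfun mu p.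
Proof. exact: (LfunP (0 : LfunType mu p1)). Qed.

Let zeroE : zero = cst 0 %[ae mu].
Proof. exact: LclassE. Qed.

Let addE f g : add f g = (f \+ g) %[ae mu].
Proof. by apply/LclassE/LfunD; exact: Lspace_Lfun. Qed.

Let oppE f : opp f = (\- f) %[ae mu].
Proof. by apply/LclassE/LfunN; exact: Lspace_Lfun. Qed.

Let scaleE a f : scale a f = (fun x => a * f x) %[ae mu].
Proof. by apply/LclassE/LfunZ; exact: Lspace_Lfun. Qed.

Let addA : associative add.
Proof.
move=> f g h; apply: Lspace_ext.
apply: filterS2 (filterI (addE f (add g h)) (addE g h))
  (filterI (addE f g) (addE (add f g) h)) => x [+ +] [+ +] _.
move=> /(_ I)/= -> /(_ I)/= -> /(_ I)/= fg /(_ I)/= ->.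
by rewrite fg addrA.
Qed.

Let addC : commutative add.
Proof.
move=> f g; apply: Lspace_ext; have := addE f g; have := addE g f.
by apply: filterS2 => x + + _ => /(_ I)/= -> /(_ I)/= ->; rewrite addrC.
Qed.

Let add0 : left_id zero add.
Proof.
move=> f; apply: Lspace_ext; have := addE zero f; have := zeroE.
by apply: filterS2 => x + + _ => /(_ I)/= + /(_ I)/= -> => ->; rewrite add0r.
Qed.

Let addN : left_inverse zero opp add.
Proof.
move=> f; apply: Lspace_ext; have := addE (opp f) f; have := zeroE.
have := oppE f.
by apply: filterS3 => x + + + _ => /(_ I)/= + /(_ I)/= -> /(_ I)/= -> => ->;
  rewrite addNr.
Qed.

HB.instance Definition _ := gen_eqMixin (LspaceType mu p1).
HB.instance Definition _ := gen_choiceMixin (LspaceType mu p1).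
HB.instance Definition _ := GRing.isZmodule.Build (LspaceType mu p1)
  addA addC add0 addN.

Let scaleA a b f : scale a (scale b f) = scale (a * b) f.
Proof.
apply: Lspace_ext; have := scaleE a (scale b f); have := scaleE b f.
have := scaleE (a * b) f.
by apply: filterS3 => x + + + _ => /(_ I)/= -> /(_ I)/= + /(_ I)/= -> => ->;
  rewrite mulrA.
Qed.

Let scale1 : left_id 1 scale.
Proof.
move=> f; apply: Lspace_ext; have := scaleE 1 f.
by apply: filterS => x + _ => /(_ I)/= ->; rewrite mul1r.
Qed.

Let scaleDr : right_distributive scale +%R.
Proof.
move=> a f g; apply: Lspace_ext; rewrite /GRing.add/=.
apply: filterS3 (filterI (scaleE a (add f g)) (addE f g))
  (filterI (scaleE a f) (scaleE a g)) (addE (scale a f) (scale a g)) => x [+ +] [+ +] + _.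
move=> /(_ I)/= -> /(_ I)/= -> /(_ I)/= sf /(_ I)/= sg /(_ I)/= ->.
by rewrite sf sg mulrDr.
Qed.

Let scaleDl f : {morph scale^~ f : a b / a + b}.
Proof.
move=> a b; apply: Lspace_ext; rewrite /GRing.add/=.
apply: filterS2 (filterI (scaleE (a + b) f) (addE (scale a f) (scale b f)))
  (filterI (scaleE a f) (scaleE b f)) => x [+ +] [+ +] _.
move=> /(_ I)/= -> /(_ I)/= -> /(_ I)/= sa /(_ I)/= sb.
by rewrite sa sb mulrDl.
Qed.

HB.instance Definition _ := GRing.Zmodule_isLmodule.Build R (LspaceType mu p1)
  scaleA scale1 scaleDr scaleDl.

Lemma Lspace0E : (0 : LspaceType mu p1) = cst 0 %[ae mu].
Proof. exact: zeroE. Qed.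

Lemma LspaceDE f g : f + g = (f \+ g) %[ae mu].
Proof. exact: addE. Qed.

Lemma LspaceNE f : - f = (\- f) %[ae mu].
Proof. exact: oppE. Qed.

Lemma LspaceZE (a : R) f : a *: f = (fun x => a * f x) %[ae mu].
Proof. exact: scaleE. Qed.

End Lspace_lmodType.

Section Chacon_map.
Context {R : realType}.

Fixpoint height n : nat := if n is m.+1 then (3 * height m).+1 else 1.

Definition width n : R := 2 / 3 ^+ n.+1.

(* Left endpoint of the i-th level of Tower n.  The spacers are taken, in order,
   from the right of the interval [0, height m * width m[ filled by Tower m. *)
Fixpoint base n i : R :=
  if n is m.+1 then
    if (i < height m)%N then base m i
    else if (i < 2 * height m)%N then base m (i - height m)%N + width n
    else if i == (2 * height m)%N then (height m)%:R * width m
    else base m (i - (2 * height m).+1)%N + 2 * width n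
  else 0.

Definition level n i : set R := `[base n i, base n i + width n[.

Definition chacon_step (x y : R) : Prop := exists n i,
  [/\ (i.+1 < height n)%N, level n i x & y = x - base n i + base n i.+1].

(* Both maps are the identity where there is no image, i.e. outside [0, 1[ and,
   for the inverse, at 0. *)
Definition chacon (x : R) : R := xget x [set y | chacon_step x y].
Definition chacon_inv (y : R) : R := xget y [set x | chacon_step x y].

Lemma levelE n i x : level n i x = (base n i <= x < base n i + width n) :> Prop.
Proof. by rewrite /level/= in_itv. Qed.

Lemma height_gt0 n : (0 < height n)%N. Proof. by case: n. Qed.

Lemma width_gt0 n : 0 < width n.
Proof. by rewrite divr_gt0// exprn_gt0. Qed.

Lemma widthS n : width n = 3 * width n.+1.
Proof.
rewrite /width (exprS _ n.+1); field.
by rewrite expf_neq0.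
Qed.

Lemma height_widthS n :
  (height n.+1)%:R * width n.+1 = (height n)%:R * width n + width n.+1.
Proof. by rewrite (widthS n) /= -natr1 natrM; ring. Qed.

Lemma height_width n : (height n)%:R * width n = 1 - (3 ^+ n.+1)^-1.
Proof.
elim: n => [|n IH]; first by rewrite /= /width expr1; field.
rewrite height_widthS IH /width (exprS _ n.+1); field.
by rewrite expf_neq0.
Qed.

Lemma baseP n i : (i < height n.+1)%N ->
  (i = 2 * height n)%N /\ base n.+1 i = (height n)%:R * width n \/
  exists (c : 'I_3) j, [/\ (j < height n)%N, i = (c * height n + (c == 2 :> nat) + j)%N &
    base n.+1 i = base n j + c%:R * width n.+1].
Proof.
move=> /= ih; case: ltnP => h1.
  by right; exists ord0, i; split => //; rewrite mul0r addr0.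
case: ltnP => h2.
  right; exists (inord 1), (i - height n)%N; rewrite inordK//.
  by split; [lia|lia|rewrite mul1r].
case: eqP => h3; first by left.
right; exists (inord 2), (i - (2 * height n).+1)%N; rewrite inordK//.
by split; [lia|rewrite eqxx; lia|].
Qed.

Lemma base_copy n (c : 'I_3) j : (j < height n)%N ->
  base n.+1 (c * height n + (c == 2 :> nat) + j)%N = base n j + c%:R * width n.+1.
Proof.
move=> jh; case: c => -[|[|[|//]]] /= ?.
- by rewrite mul0n !add0n jh mul0r addr0.
- rewrite mul1n addn0 ifF; last by apply/negbTE; lia.
  by rewrite ifT ?mul1r; [congr (base _ _ + _); lia|lia].
- rewrite ifF; last by apply/negbTE; lia.
  rewrite ifF; last by apply/negbTE; lia.
  rewrite ifF; last by apply/negbTE; lia.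
  by congr (base _ _ + _); lia.
Qed.

Lemma base_spacer n : base n.+1 (2 * height n) = (height n)%:R * width n.
Proof.
have := height_gt0 n; move=> h /=; rewrite ifF; last by apply/negbTE; lia.
by rewrite ifF ?eqxx//; apply/negbTE; lia.
Qed.

Lemma level_sub n i x : (i < height n)%N -> level n i x ->
  0 <= x < (height n)%:R * width n.
Proof.
rewrite levelE; elim: n i x => [|n IH] i x ih.
  by rewrite /= mul1r add0r.
have w0 := width_gt0 n.+1; have wS := widthS n.
have hS := height_widthS n; case: (baseP ih) => [[_ ->]|[c [j [jh _ ->]]]].
  have : 0 <= (height n)%:R * width n by rewrite mulr_ge0// ltW// width_gt0.
  by rewrite hS => h0 /andP[x1 x2]; apply/andP; split; lra.
have c2 : 0 <= c%:R :> R /\ c%:R <= 2 :> R.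
  by rewrite ler0n (ler_nat _ c 2) -ltnS.
have c0 : 0 <= c%:R * width n.+1 by rewrite mulr_ge0// ltW.
have c3 : c%:R * width n.+1 <= 2 * width n.+1 by apply: ler_wpM2r; [exact: ltW|case: c2].
move=> /andP[x1 x2]; have /IH : base n j <= x < base n j + width n.
  by apply/andP; split; lra.
by move=> /(_ jh)/andP[x3 x4]; rewrite hS; apply/andP; split; lra.
Qed.

Lemma level_inj n i j x : (i < height n)%N -> (j < height n)%N ->
  level n i x -> level n j x -> i = j.
Proof.
elim: n i j x => [|n IH] i j x ih jh.
  by move: ih jh; rewrite /= !ltnS !leqn0 => /eqP-> /eqP->.
have w0 := width_gt0 n.+1; have wS := widthS n.
have key (c : 'I_3) k : (k < height n)%N ->
    base n k + c%:R * width n.+1 <= x < base n k + c%:R * width n.+1 + width n.+1 ->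
    level n k x.
  move=> kh; rewrite levelE => /andP[x1 x2]; apply/andP.
  have c2 : 0 <= c%:R :> R /\ c%:R <= 2 :> R.
    by rewrite ler0n (ler_nat _ c 2) -ltnS.
  have c0 : 0 <= c%:R * width n.+1 by rewrite mulr_ge0// ltW.
  have c3 : c%:R * width n.+1 <= 2 * width n.+1 by apply: ler_wpM2r; [exact: ltW|case: c2].
  lra.
rewrite !levelE.
case: (baseP ih) => [[-> ->]|[c [i' [ih' -> ->]]]];
  case: (baseP jh) => [[-> ->]|[d [j' [jh' -> ->]]]] // xi xj.
- by have /level_sub := key _ _ jh' xj => /(_ jh')/andP[_ x1]; move: xi => /andP[x2 _]; move: (le_lt_trans x2 x1); rewrite ltxx.
- by have /level_sub := key _ _ ih' xi => /(_ ih')/andP[_ x1]; move: xj => /andP[x2 _]; move: (le_lt_trans x2 x1); rewrite ltxx.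
- have E := IH _ _ _ ih' jh' (key _ _ ih' xi) (key _ _ jh' xj); subst j'.
  suff -> : c = d by [].
  apply/val_inj/eqP; rewrite /= eqn_leq.
  have cd (a b : nat) : a%:R < b%:R + 1 :> R -> (a <= b)%N.
    by rewrite natr1 ltr_nat ltnS.
  move: xi xj => /andP[x1 x2] /andP[x3 x4].
  apply/andP; split; apply: cd; rewrite -(ltr_pM2r w0) mulrDl mul1r; lra.
Qed.

Lemma level_cover n x : 0 <= x < (height n)%:R * width n ->
  exists2 i, (i < height n)%N & level n i x.
Proof.
elim: n x => [|n IH] x.
  by rewrite mul1r => x01; exists 0%N => //; rewrite levelE add0r.
rewrite height_widthS => /andP[x0 x1].
have w0 := width_gt0 n.+1; have wS := widthS n.
have h0 := height_gt0 n.
have [xh|xh] := ltP x ((height n)%:R * width n); last first.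
  exists (2 * height n)%N; first by rewrite /=; lia.
  by rewrite levelE base_spacer xh.
have [|i ih] := IH x; first by rewrite x0.
rewrite levelE => /andP[ix xi].
have mk (c : 'I_3) : base n i + c%:R * width n.+1 <= x < base n i + c%:R * width n.+1 + width n.+1 ->
  exists2 i, (i < height n.+1)%N & level n.+1 i x.
  move=> xc; exists (c * height n + (c == 2 :> nat) + i)%N.
    by case: c xc => -[|[|[|//]]] /= ? _; lia.
  by rewrite levelE base_copy.
have [x2|x2] := ltP x (base n i + width n.+1).
  by apply: (mk ord0); rewrite mul0r addr0 ix.
have [x3|x3] := ltP x (base n i + 2 * width n.+1).
  by apply: (mk (inord 1)); rewrite inordK// mul1r x2/=; lra.
by apply: (mk (inord 2)); rewrite inordK// x3/=; lra.
Qed.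

Lemma level_split n i x : (i < height n)%N -> level n i x ->
  exists c : 'I_3, level n.+1 (c * height n + (c == 2 :> nat) + i) x.
Proof.
move=> ih; rewrite levelE => /andP[ix xi].
have w0 := width_gt0 n.+1; have wS := widthS n.
have [x2|x2] := ltP x (base n i + width n.+1).
  by exists ord0; rewrite levelE base_copy// mul0r addr0 ix.
have [x3|x3] := ltP x (base n i + 2 * width n.+1).
  exists (inord 1); rewrite levelE base_copy// inordK// mul1r x2/=; lra.
exists (inord 2); rewrite levelE base_copy// inordK// x3/=; lra.
Qed.

End Chacon_map.

Section Chacon_map2.
Context {R : realType}.
Implicit Types x y z : R.
Local Notation width := (@width R).
Local Notation base := (@base R).

Lemma level_lift n k i x y : (i.+1 < height n)%N -> level n i x ->
  y = x - base n i + base n i.+1 ->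
  exists j, [/\ (j.+1 < height (n + k))%N, level (n + k) j x &
    y = x - base (n + k) j + base (n + k) j.+1].
Proof.
elim: k => [|k IH] ih ix yE; first by rewrite addn0; exists i.
have [j [jh jx {}yE]] := IH ih ix yE.
have [c cx] := level_split (ltnW jh) jx.
rewrite addnS; exists (c * height (n + k) + (c == 2 :> nat) + j)%N; split => //.
  by case: c {cx} => -[|[|[|//]]] /= ? ; lia.
rewrite (base_copy c (ltnW jh)); have := base_copy c jh; rewrite addnS => ->.
by rewrite yE; ring.
Qed.

Lemma chacon_stepP x y x' y' : chacon_step x y -> chacon_step x' y' ->
  exists n i j, [/\ (i.+1 < height n)%N, (j.+1 < height n)%N, level n i x & level n j x']
    /\ (y = x - base n i + base n i.+1 /\ y' = x' - base n j + base n j.+1).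
Proof.
move=> [n [i [ih ix yE]]] [m [j [jh jx yE']]].
have [i' [i'h i'x i'E]] := level_lift m ih ix yE.
have [j' [j'h j'x j'E]] := level_lift n jh jx yE'.
by exists (n + m)%N, i', j'; rewrite (addnC m) in j'h j'x j'E *.
Qed.

Lemma level_next n i x : level n i x ->
  level n i.+1 (x - base n i + base n i.+1).
Proof. by rewrite !levelE => /andP[x1 x2]; apply/andP; split; lra. Qed.

Lemma chacon_step_fun x y z : chacon_step x y -> chacon_step x z -> y = z.
Proof.
move=> xy xz; have [n [i [j [[ih jh ix jx] [-> ->]]]]] := chacon_stepP xy xz.
by rewrite (level_inj (ltnW ih) (ltnW jh) ix jx).
Qed.

Lemma chacon_step_inj x y z : chacon_step x z -> chacon_step y z -> x = y.
Proof.
move=> xy xz; have [n [i [j [[ih jh ix jx] [zE zE']]]]] := chacon_stepP xy xz.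
have ix' := level_next ix; have jx' := level_next jx.
rewrite -zE in ix'; rewrite -zE' in jx'.
have [E] := level_inj ih jh ix' jx'; rewrite E in zE.
by move: zE; rewrite zE' => ?; lra.
Qed.

Lemma base_bottom n : base n 0 = 0.
Proof. by elim: n => //= n IH; rewrite height_gt0. Qed.

Lemma base_top n : base n (height n).-1 = 2 / 3 - width n.
Proof.
elim: n => [|n IH]; first by rewrite /= /width expr1 subrr.
have h0 := height_gt0 n.
rewrite (_ : _.-1 = ((inord 2 : 'I_3) * height n + ((inord 2 : 'I_3) == 2 :> nat) + (height n).-1)%N).
  by rewrite base_copy ?prednK// IH inordK// (widthS n); ring.
by rewrite inordK//= ; lia.
Qed.

Lemma width_small (e : R) : 0 < e -> exists n, width n < e.
Proof.
move=> e0.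
have /cvgr0_norm_lt/(_ _ e0)[n _ /(_ n)/=] : geometric (2 / 3) (1 / 3) n @[n --> \oo] --> (0 : R).
  by apply: cvg_geometric; rewrite ger0_norm; lra.
rewrite leqnn => /(_ isT) nx; exists n; apply: le_lt_trans nx.
rewrite (_ : width n = 2 / 3 * (1 / 3) ^+ n) ?ler_norm//.
by rewrite /width exprMn expr1n mul1r exprVn exprS invfM mulrA.
Qed.

Lemma chacon_step_ex x : 0 <= x < 1 -> exists y, chacon_step x y.
Proof.
move=> /andP[x0 x1].
have mk n : x < (height n)%:R * width n -> ~~ (2 / 3 - width n <= x < 2 / 3) ->
    exists y, chacon_step x y.
  move=> xh xt; have [|i ih ix] := @level_cover R n x; first by rewrite x0.
  exists (x - base n i + base n i.+1), n, i; split => //.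
  rewrite ltn_neqAle ih andbT; apply/eqP => iE.
  move: ix xt; rewrite levelE (_ : i = (height n).-1) ?base_top ?subrK; last by rewrite -iE.
  by move=> ->.
have [x23|x23] := ltP x (2 / 3).
  have [|n nx] := @width_small (2 / 3 - x); first lra.
  apply: (mk n); last by rewrite negb_and -ltNge; apply/orP; left; lra.
  rewrite height_width; apply: lt_le_trans x23 _.
  rewrite (_ : 2 / 3 = 1 - 3^-1 :> R); last by field.
  rewrite lerD2l lerN2 lef_pV2 ?posrE ?exprn_gt0//.
  by rewrite -[leLHS]expr1 ler_weXn2l// ler1n.
have [|n nx] := @width_small (1 - x); first lra.
apply: (mk n); last by rewrite negb_and -!ltNge -leNgt x23 orbT.
rewrite height_width.
suff : (3 ^+ n.+1)^-1 <= width n by lra.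
by rewrite /width ler_peMl ?invr_ge0 ?exprn_ge0//; lra.
Qed.

Lemma chacon_step_in x y : chacon_step x y -> 0 <= x < 1 /\ 0 < y < 1.
Proof.
move=> [n [i [ih ix ->]]]; have ix' := level_next ix.
have /andP[x0 x1] := level_sub (ltnW ih) ix; have /andP[y0 y1] := level_sub ih ix'.
have h1 : (height n)%:R * width n < 1.
  by rewrite height_width ltrBlDr ltrDl invr_gt0 exprn_gt0.
split; first by rewrite x0 (lt_trans x1).
rewrite (lt_trans y1)// andbT lt_neqAle y0 andbT; apply/eqP => yE.
have b0 : level n 0 (x - base n i + base n i.+1).
  by rewrite -yE levelE base_bottom add0r width_gt0 lexx.
by have := level_inj ih (height_gt0 n) ix' b0.
Qed.

Lemma chacon_step_surj y : 0 < y < 1 -> exists x, chacon_step x y.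
Proof.
move=> /andP[y0 y1].
have [|n] := @width_small (Num.min y (1 - y)).
  by rewrite lt_min y0 subr_gt0.
rewrite lt_min => /andP[ny ny'].
have [|i ih iy] := @level_cover R n y.
  rewrite ltW//= height_width.
  suff : (3 ^+ n.+1)^-1 <= width n by lra.
  by rewrite /width ler_peMl ?invr_ge0 ?exprn_ge0//; lra.
case: i => [|i] in ih iy *.
  by move: iy; rewrite levelE base_bottom add0r => /andP[_]; lra.
exists (y - base n i.+1 + base n i), n, i; split => //; last by ring.
by move: iy; rewrite !levelE => /andP[x1 x2]; apply/andP; split; lra.
Qed.

Lemma chaconE x y : chacon_step x y -> chacon x = y.
Proof.
move=> xy; rewrite /chacon; case: xgetP => [z _ /= xz|/(_ y)//].
exact: chacon_step_fun xz xy.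
Qed.

Lemma chacon_invE x y : chacon_step x y -> chacon_inv y = x.
Proof.
move=> xy; rewrite /chacon_inv; case: xgetP => [z _ /= xz|/(_ x)//].
exact: chacon_step_inj xz xy.
Qed.

Lemma chaconK x : 0 <= x < 1 -> chacon_inv (chacon x) = x.
Proof. by move=> /chacon_step_ex[y xy]; rewrite (chaconE xy) (chacon_invE xy). Qed.

Lemma chacon_invK y : 0 < y < 1 -> chacon (chacon_inv y) = y.
Proof. by move=> /chacon_step_surj[x xy]; rewrite (chacon_invE xy) (chaconE xy). Qed.

Lemma chacon_id x : ~~ (0 <= x < 1) -> chacon x = x.
Proof.
move=> x01; rewrite /chacon; case: xgetP => // y _ /= /chacon_step_in[].
by rewrite (negbTE x01).
Qed.

Lemma chacon_inv_id y : ~~ (0 < y < 1) -> chacon_inv y = y.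
Proof.
move=> x01; rewrite /chacon_inv; case: xgetP => // x _ /= /chacon_step_in[_].
by rewrite (negbTE x01).
Qed.

End Chacon_map2.

Section measure_preserving.
Context d (T : measurableType d) (R : realType) (mu : {measure set T -> \bar R}).

Definition measure_preserving (phi : T -> T) : Prop :=
  measurable_fun [set: T] phi /\
  forall A, measurable A -> mu (phi @^-1` A) = mu A.

Lemma measure_preserving_ae (phi : T -> T) (P : T -> Prop) :
  measure_preserving phi ->
  (\forall x \ae mu, P x) -> \forall x \ae mu, P (phi x).
Proof.
move=> [mphi pphi] [A [mA A0 PA]]; exists (phi @^-1` A); split.
- by rewrite -[X in measurable X]setTI; exact: mphi.
- by rewrite pphi.
- by move=> x /= Px; exact: PA.
Qed.

Lemma measure_preserving_Lfun (phi : T -> T) (r : R) (f : T -> R) :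
  measure_preserving phi -> f \in Lfun mu r%:E -> f \o phi \in Lfun mu r%:E.
Proof.
move=> [mphi pphi] /andP[/set_mem mf /set_mem ff]; apply/andP; split.
  by rewrite inE; exact: measurableT_comp.
rewrite inE /=; move: ff => /=; rewrite /finite_norm unlock /= => ff.
apply: le_lt_trans ff; rewrite le_eqVlt; apply/orP; left; apply/eqP.
congr (_ `^ _)%E.
have mg : measurable_fun [set: T] (fun x => (`|f x| `^ r)%:E).
  apply/measurable_EFinP.
  apply: (@measurableT_comp _ _ _ _ _ _ (@powR R ^~ r)) => //.
  exact: measurableT_comp.
have := @ge0_integral_pushforward _ _ T T R phi mphi mu setT _ measurableT mg.
rewrite preimage_setT => <-; last by move=> x _; rewrite lee_fin powR_ge0.
by apply: eq_measure_integral => A mA _; rewrite -pphi.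
Qed.

End measure_preserving.

Section Chacon_measure.
Context {R : realType}.
Implicit Types x y z : R.
Local Notation X := (measurableTypeR R).
Local Notation leb := (@lebesgue_measure R).

Definition chacon_measure : set X -> \bar R :=
  mrestr (@lebesgue_measure R) (measurable_itv `[0, 1[).

HB.instance Definition _ := Measure.on chacon_measure.

Let chacon_measureT : chacon_measure setT = 1%E.
Proof.
by rewrite /chacon_measure /mrestr setTI lebesgue_measure_itv/= lte01 oppr0 adde0.
Qed.

HB.instance Definition _ := Measure_isProbability.Build _ _ _ chacon_measure
  chacon_measureT.

Let shift_measurable (c : R) : measurable_fun [set: X] ((fun x => x + c) : X -> X).
Proof. have := @measurable_funD _ R R setT id (cst c); apply => //. Qed.

Lemma lebesgue_measure_shift (c : R) (A : set X) : measurable A ->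
  leb ((fun x => x + c) @^-1` A) = leb A.
Proof.
move=> mA.
have mc : measurable_fun [set: X] ((fun x => x + c) : X -> X).
  exact: shift_measurable.
pose f : X -> X := fun x => x + c.
pose mf := isMeasurableFun.Build _ _ _ _ f mc.
pose ff : {mfun X >-> X} := HB.pack f mf.
rewrite -[LHS]/(pushforward leb ff A).
apply/esym/lebesgue_measure_unique => //= _ [[a b]] _ <-.
rewrite /pushforward /=.
rewrite (_ : _ @^-1` _ = `]a - c, b - c]%classic).
  rewrite !lebesgue_measure_itv/= !lte_fin ltrD2r.
  by rewrite -!EFinB opprB addrA subrK.
by apply/seteqP; split => x /=; rewrite /f !in_itv/= ltrBlDr lerBrDr.
Qed.

Lemma measurable_translations (I : set X) (g : X -> X)
    (L : nat -> nat -> set X) (c : nat -> nat -> R) :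
  (forall n i, measurable (L n i)) -> I = \bigcup_n \bigcup_i L n i ->
  (forall x, ~ I x -> g x = x) ->
  (forall n i x, L n i x -> g x = x + c n i) ->
  measurable_fun [set: X] g.
Proof.
move=> mL IE gI gL _ A mA; rewrite setTI.
have mI : measurable I.
  by rewrite IE; apply: bigcup_measurable => n _; exact: bigcup_measurable.
rewrite (_ : g @^-1` A = (A `&` ~` I) `|`
    \bigcup_n \bigcup_i (L n i `&` (fun x : X => (x + c n i : X)) @^-1` A)).
  apply: measurableU; first by apply: measurableI => //; exact: measurableC.
  apply: bigcup_measurable => n _; apply: bigcup_measurable => i _.
  by apply: measurableI => //; rewrite -[X in measurable X]setTI; exact: shift_measurable.
apply/seteqP; split => x /=.
  move=> Ax; have [Ix|nIx] := pselect (I x); last first.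
    by left; split => //; move: Ax; rewrite gI.
  right; move: Ix; rewrite {1}IE => -[n _ [i _ Lx]].
  by exists n => //; exists i => //; split => //=; rewrite -(gL n i x Lx).
move=> [[Ax nIx]|[n _ [i _ [Lx /= Ax]]]]; first by rewrite gI.
by rewrite (gL n i).
Qed.

Let dom n i : set X := if (i.+1 < height n)%N then @level R n i else set0.
Let cod n i : set X := if (i.+1 < height n)%N then @level R n i.+1 else set0.

Let measurable_dom n i : measurable (dom n i).
Proof. by rewrite /dom; case: ifP => // _; exact: measurable_itv. Qed.

Let measurable_cod n i : measurable (cod n i).
Proof. by rewrite /cod; case: ifP => // _; exact: measurable_itv. Qed.

Let domP n i x : dom n i x <-> (i.+1 < height n)%N /\ level n i x.
Proof. by rewrite /dom; case: ifP => _; split => // -[]. Qed.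

Let codP n i x : cod n i x <-> (i.+1 < height n)%N /\ level n i.+1 x.
Proof. by rewrite /cod; case: ifP => _; split => // -[]. Qed.

Let dom_chacon n i x : dom n i x -> chacon x = x + (base n i.+1 - base n i).
Proof.
move=> /domP[ih ix]; apply: chaconE; exists n, i; split => //.
by rewrite addrA addrAC.
Qed.

Let cod_chacon_inv n i x : cod n i x -> chacon_inv x = x + (base n i - base n i.+1).
Proof.
move=> /codP[ih]; rewrite levelE => /andP[x1 x2].
apply: chacon_invE; exists n, i; split => //; last by ring.
by rewrite levelE; apply/andP; split; lra.
Qed.

Let bigcup_dom : `[0, 1[%classic = \bigcup_n \bigcup_i dom n i.
Proof.
apply/seteqP; split => x /=; rewrite in_itv/=.
  by move=> /chacon_step_ex[y [n [i [ih ix _]]]]; exists n => //; exists i => //; apply/domP.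
move=> [n _ [i _ /domP[ih ix]]].
by have [] : 0 <= x < 1 /\ 0 < x - base n i + base n i.+1 < 1;
  [apply: chacon_step_in; exists n, i|].
Qed.

Let bigcup_cod : `]0, 1[%classic = \bigcup_n \bigcup_i cod n i.
Proof.
apply/seteqP; split => x /=; rewrite in_itv/=.
  move=> /chacon_step_surj[y [n [i [ih /level_next iy ->]]]].
  by exists n => //; exists i => //; apply/codP.
move=> [n _ [i _ /codP[ih]]]; rewrite levelE => /andP[x1 x2].
have [] // : 0 <= x + (base n i - base n i.+1) < 1 /\ 0 < x < 1.
apply: chacon_step_in; exists n, i; split => //; last by ring.
by rewrite levelE; apply/andP; split; lra.
Qed.

Lemma measurable_chacon : measurable_fun [set: X] (chacon : X -> X).
Proof.
apply: (measurable_translations measurable_dom bigcup_dom) => [x /negP|].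
  by rewrite in_itv; exact: chacon_id.
exact: dom_chacon.
Qed.

Lemma measurable_chacon_inv : measurable_fun [set: X] (chacon_inv : X -> X).
Proof.
apply: (measurable_translations measurable_cod bigcup_cod) => [x /negP|].
  by rewrite in_itv; exact: chacon_inv_id.
exact: cod_chacon_inv.
Qed.

Let Dom n := \bigcup_i dom n i.
Let Cod n := \bigcup_i cod n i.

Let DomS n : Dom n `<=` Dom n.+1.
Proof.
move=> x [i _ /domP[ih ix]].
have [j [jh jx _]] := level_lift 1 ih ix erefl; rewrite addn1 in jh jx.
by exists j => //; exact/domP.
Qed.

Let CodS n : Cod n `<=` Cod n.+1.
Proof.
move=> x [i _ /codP[ih]]; rewrite levelE => /andP[x1 x2].
have ix : level n i (x + (base n i - base n i.+1)).
  by rewrite levelE; apply/andP; split; lra.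
have xE : x = x + (base n i - base n i.+1) - base n i + base n i.+1 by ring.
have [j [jh jx {}xE]] := level_lift 1 ih ix xE; rewrite addn1 in jh jx xE.
exists j => //; apply/codP; split => //.
by rewrite xE; exact: level_next.
Qed.

Let mu_dom n i (A : set X) : measurable A ->
  chacon_measure (chacon @^-1` A `&` dom n i) = chacon_measure (A `&` cod n i).
Proof.
move=> mA; rewrite /chacon_measure/= /mrestr -!setIA.
rewrite (setIidl (_ : dom n i `<=` _)); last first.
  by rewrite bigcup_dom => x ix; exists n => //; exists i.
rewrite (setIidl (_ : cod n i `<=` _)); last first.
  apply: (@subset_trans _ `]0, 1[%classic).
    by rewrite bigcup_cod => x ix; exists n => //; exists i.
  by move=> x /=; rewrite !in_itv/= => /andP[/ltW-> ->].
rewrite -(lebesgue_measure_shift (base n i.+1 - base n i) (measurableI _ _ mA (measurable_cod n i))).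
congr (leb _); apply/seteqP; split => x /=.
  move=> [Ax ix]; split; first by rewrite -(dom_chacon ix).
  move/domP : ix => [ih /level_next ix]; apply/codP; split => //.
  by rewrite addrA addrAC.
move=> [Ax ix]; have ix' : dom n i x.
  move/codP : ix => [ih]; rewrite levelE => /andP[x1 x2]; apply/domP; split => //.
  by rewrite levelE; apply/andP; split; lra.
by split => //; rewrite (dom_chacon ix').
Qed.

Let triv_dom n : trivIset setT (dom n).
Proof.
move=> i j _ _ [x [/domP[ih ix] /domP[jh jx]]].
exact: level_inj (ltnW ih) (ltnW jh) ix jx.
Qed.

Let triv_cod n : trivIset setT (cod n).
Proof.
move=> i j _ _ [x [/codP[ih ix] /codP[jh jx]]].
by have [] := level_inj ih jh ix jx.
Qed.

Let mu_Dom n (A : set X) : measurable A ->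
  chacon_measure (chacon @^-1` A `&` Dom n) = chacon_measure (A `&` Cod n).
Proof.
move=> mA; rewrite !setI_bigcupr !measure_bigcup//=.
- by apply: eq_eseriesr => i _; exact: mu_dom.
- by move=> i _; exact: measurableI.
- exact: trivIset_setIl.
- move=> i _; apply: measurableI => //.
  by rewrite -[X in measurable X]setTI; exact: measurable_chacon.
- exact: trivIset_setIl.
Qed.

Let chacon_measure_cvg (F : nat -> set X) (A I : set X) : measurable A ->
  (forall n, measurable (F n)) -> (forall n, F n `<=` F n.+1) ->
  I = \bigcup_n F n -> chacon_measure (~` I) = 0%E ->
  chacon_measure (A `&` F n) @[n --> \oo] --> chacon_measure A.
Proof.
move=> mA mF FS IE I0.
have mI : measurable I by rewrite IE; exact: bigcup_measurable.
rewrite (_ : chacon_measure A = chacon_measure (\bigcup_n (A `&` F n))).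
  apply: nondecreasing_cvg_mu.
  - by move=> n; exact: measurableI.
  - by apply: bigcup_measurable => n _; exact: measurableI.
  - by apply/nondecreasing_seqP => n; rewrite subsetEset; exact: setIS.
rewrite -setI_bigcupr -IE -[in LHS](setIT A) -(setUv I) setIUr measureU.
- rewrite -[RHS]adde0; congr (_ + _)%E.
  apply: (@subset_measure0 _ _ _ chacon_measure _ (~` I)) => //.
    by apply: measurableI => //; exact: measurableC.
  exact: measurableC.
- exact: measurableI.
- by apply: measurableI => //; exact: measurableC.
- by rewrite setIACA setICr setI0.
Qed.

Let chacon_measure_notin : chacon_measure (~` `]0, 1[) = 0%E.
Proof.
  rewrite /chacon_measure /= /mrestr.
  apply: (@subset_measure0 _ _ _ leb _ [set 0]) => //; last exact: lebesgue_measure_set1.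
    by apply: measurableI => //; exact: measurableC.
  move=> x [/= /negP]; rewrite !in_itv/= negb_and -!leNgt => h /andP[x0 x1].
  by apply/eqP; rewrite eq_le x0 andbT; case/orP: h => // h; move: (le_lt_trans h x1); rewrite ltxx.
Qed.

Lemma chacon_measure_preserving : measure_preserving chacon_measure chacon.
Proof.
split; first exact: measurable_chacon.
move=> A mA.
have mA' : measurable (chacon @^-1` A : set X).
  by rewrite -[X in measurable X]setTI; exact: measurable_chacon.
have := chacon_measure_cvg mA' (fun n => bigcupT_measurable _ (measurable_dom n)) DomS bigcup_dom.
have := chacon_measure_cvg mA (fun n => bigcupT_measurable _ (measurable_cod n)) CodS bigcup_cod.
have n01 : chacon_measure (~` `[0, 1[) = 0%E.
  by rewrite /chacon_measure /= /mrestr setICl measure0.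
have n01' := chacon_measure_notin.
move=> /(_ n01') c1 /(_ n01) c2.
have E : (fun n => chacon_measure (A `&` Cod n)) =
    (fun n => chacon_measure (chacon @^-1` A `&` Dom n)).
  by apply/funext => n; apply/esym/mu_Dom.
have c1' : (fun n => chacon_measure (chacon @^-1` A `&` Dom n)) @ \oo -->
    chacon_measure A by rewrite -E; exact: c1.
exact: cvg_unique c2 c1'.
Qed.

Lemma ae_chacon_measure (P : R -> Prop) : (forall x, 0 < x < 1 -> P x) ->
  \forall x \ae chacon_measure, P x.
Proof.
move=> h; exists (~` `]0, 1[%classic); split.
- exact: measurableC.
- exact: chacon_measure_notin.
- by move=> x /=; rewrite in_itv/= => + /h.
Qed.

Lemma chacon_inv_measure_preserving : measure_preserving chacon_measure chacon_inv.
Proof.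
have [mT pT] := chacon_measure_preserving.
split; first exact: measurable_chacon_inv.
move=> A mA; have mA' : measurable (chacon_inv @^-1` A : set X).
  by rewrite -[X in measurable X]setTI; exact: measurable_chacon_inv.
rewrite -pT// /chacon_measure /mrestr; congr (leb _).
apply/seteqP; split => x /= [Ax x01]; split => //; move: Ax; rewrite chaconK//;
  by move: x01; rewrite in_itv.
Qed.

End Chacon_measure.

Section Koopman.
Context {R : realType}.
Local Notation mu := (@chacon_measure R).

Definition L2 : Type := LspaceType2 mu.
HB.instance Definition _ := GRing.Lmodule.on L2.
Implicit Types f g : L2.

Definition koopman (phi : R -> R) f : L2 :=
  Lclass mu (lee1n 2) ((f : R -> R) \o phi).

Lemma koopmanE (phi : R -> R) f : measure_preserving mu phi ->
  koopman phi f = (f : R -> R) \o phi %[ae mu].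
Proof.
by move=> mphi; apply/LclassE/measure_preserving_Lfun => //; exact: Lspace_Lfun.
Qed.

Definition koopmanZ (n : int) f : L2 :=
  match n with
  | Posz k => iter k (koopman chacon) f
  | Negz k => iter k.+1 (koopman chacon_inv) f
  end.

Let koopman_can (phi psi : R -> R) :
  measure_preserving mu phi -> measure_preserving mu psi ->
  (forall x, 0 < x < 1 -> phi (psi x) = x) ->
  cancel (koopman phi) (koopman psi).
Proof.
move=> mphi mpsi phipsi f; apply: Lspace_ext.
have := ae_chacon_measure phipsi.
have := measure_preserving_ae mpsi (koopmanE f mphi).
have := koopmanE (koopman phi f) mpsi.
by apply: filterS3 => x + + + _ => /(_ I)/= -> /(_ I)/= -> ->.
Qed.

Lemma koopmanK : cancel (koopman chacon) (koopman chacon_inv).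
Proof.
apply: koopman_can chacon_measure_preserving chacon_inv_measure_preserving _.
exact: chacon_invK.
Qed.

Lemma koopman_invK : cancel (koopman chacon_inv) (koopman chacon).
Proof.
apply: koopman_can chacon_inv_measure_preserving chacon_measure_preserving _.
by move=> x /andP[x0 x1]; rewrite chaconK// ltW.
Qed.

Definition theta f : L2 := Lclass mu (lee1n 2) (cst (\int[mu]_x f x)).

Definition inner f g : R := \int[mu]_x (f x * g x).

Definition bounded_operator (A : L2 -> L2) : Prop :=
  linear A /\ exists C : R, forall f,
    ('N[mu]_2[EFin \o A f] <= C%:E * 'N[mu]_2[EFin \o f])%E.

Definition weak_cvg (A_ : nat -> L2 -> L2) (A : L2 -> L2) : Prop :=
  forall f g, inner (A_ j f) g @[j --> \oo] --> inner (A f) g.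

Definition weak_limits : set (L2 -> L2) :=
  [set A | bounded_operator A /\
    exists k : nat -> int, weak_cvg (fun j => koopmanZ (- k j)) A].

Definition poly_op (p : {poly R}) (A : L2 -> L2) f : L2 :=
  \sum_(i < size p) p`_i *: iter i A f.

End Koopman.
Arguments L2 : clear implicits.

HB.instance Definition _ n := isPointed.Build 'I_n.+1 ord0.

(* The 3-adic integers, as digit sequences with the product (that is, Borel)
   sigma-algebra. *)
Definition Gamma : Type := g_sigma_algebraType
  [set A : set (nat -> 'I_3) | exists k d, A = [set x | x k = d]].
HB.instance Definition _ := Measurable.on Gamma.

(* Digit k of a sum is determined by the sum of the truncations mod 3 ^ k.+1. *)
Definition Gamma_add (x y : Gamma) : Gamma := fun k =>
  inord ((\sum_(i < k.+1) (x i + y i) * 3 ^ i) %/ 3 ^ k %% 3)%N.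

Definition Gamma_one : Gamma := fun k => inord (k == 0)%N.

Definition odometer (x : Gamma) : Gamma := Gamma_add x Gamma_one.

Definition haar {R : realType} (lambda : probability Gamma R) : Prop :=
  forall (a : Gamma) (A : set Gamma), measurable A ->
    lambda (Gamma_add a @^-1` A) = lambda A.

(* The value at (2, 2, ...) is irrelevant. *)
Definition phi (x : Gamma) : nat :=
  if pselect (exists k, x k != 2 :> nat) is left h then x (ex_minn h) else 0%N.

Definition phi_sum (m : nat) (x : Gamma) : nat :=
  (\sum_(i < m) phi (iter i odometer x))%N.

Section Polynomials.
Context {R : realType} (lambda : probability Gamma R).

Definition pi_coef (m j : nat) : R := fine (lambda [set x | phi_sum m x = j]).

Definition chacon_poly (m : nat) : {poly R} := \poly_(j < m.+1) pi_coef m j.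

Definition chacon_poly_prod (ms : seq nat) : L2 R -> L2 R :=
  foldr (fun m A => poly_op (chacon_poly m) (koopman chacon) \o A) id ms.

End Polynomials.

(* Main.v *)
Require Import Defs.
From mathcomp Require Import all_boot all_order all_algebra.
From mathcomp Require Import all_classical all_reals all_analysis.
From mathcomp Require Import measurable_realfun.
From mathcomp Require Import zify ring lra.
Set Implicit Arguments.
Unset Strict Implicit.
Unset Printing Implicit Defensive.
Import Order.TTheory GRing.Theory Num.Theory.
Import numFieldNormedType.Exports.
Import HBSimple HBNNSimple.
Local Open Scope classical_set_scope.
Local Open Scope ring_scope.

(** Let [h_N] be the height of Tower [N]; since [2 h_N + 1 = 3 ^ N.+1], a time [k]
is best read through the balanced ternary digits of [2 k]: a digit [e] at rank
[N.+1] is a term [e h_N] of [k], up to a bounded correction.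

A tower of high order is a stack of copies of Tower [N], separated by 0 or 1
spacer according to the first ternary digit other than 2 of the number of the
copy. These numbers are equidistributed in the 3-adic integers, so [m] consecutive
returns to the base of Tower [N] take [m h_N] steps plus a number of spacers
distributed along [P_m]; this gives an exact formula for the correlations of levels
([corr_lev]). Everything else is deduced from it, and from the recursion that
expresses [P_(3 m)], [P_(3 m + 1)], [P_(3 m + 2)] by [P_m] and [P_(m + 1)] ([mean3],
[mean3_1], [mean3_2]).

Peeling. If [rho] is small with respect to [h_N], then in [m h_N + rho] steps a
point makes [m] returns and then moves by [rho] minus the number of spacers
([corr_peel]). Hence, if the powers along [- rho_j] converge to [Q], those along
[- (m h_N + rho_j)] converge to [Q P_m(T)] ([weak_cvg_peel]). Negative multiples are
handled by taking adjoints and by the symmetry of [P_m] ([mean_rev]), which costs a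
power of [T]. All products of the [P_m(T)] with a power of [T] are reached by
repeated peeling ([product_limit]).

Many digits. Each nonzero balanced digit of [m] averages [P_m] with its shift by
one, with a probability that is bounded below, and [n] such averages make the
variation between neighbours of order [1 / sqrt n] ([iter_avg_diff_le],
[mean_diff_small]). So if the number of nonzero digits of [2 k_j] tends to
infinity, the correlations of the levels become insensitive to shifts of the time
and converge to the product of the measures: the limit is the projection onto the
constants ([weak_cvg_theta]).

Few digits. Otherwise the number of nonzero digits is constant along a
subsequence. Following the gaps between consecutive digits, which along a further
subsequence are constant or tend to infinity, one cuts the digits into blocks; the
blocks are the [m_i] and each wide gap is a peeling. So some subsequence converges to
a product, which has no factor [P_m] only if the subsequence is constant
([sublimit_sparse]). Since the limit of a convergent sequence is that of any of its
subsequences, this proves the description of the limits.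

Boundedness. If a power of [T] were the limit along an unbounded sequence, it would
equal the projection onto the constants, or a product containing some [P_m(T)] with
[m > 0]; neither is an isometry ([theta_not_isometric], [Pop_not_isometric]). *)

(** * Ternary digits and positions in the towers *)

Section Digits.
Local Open Scope nat_scope.

(** The first ternary digit of [y] other than 2 is one less than the last
nonzero digit of [y.+1], hence than the residue mod 3 of the 3'-part of
[y.+1]. *)
Definition first_non2 (y : nat) : nat := ((y.+1)`_(3^') %% 3).-1.

Lemma first_non2_le1 y : first_non2 y <= 1.
Proof. by rewrite /first_non2; have := @ltn_pmod (y.+1)`_(3^') 3 isT; lia. Qed.

Lemma first_non2_id y c : c < 2 -> first_non2 (3 * y + c) = c.
Proof.
move=> c2; rewrite /first_non2 part_pnat_id; first lia.
by rewrite p'natE// /dvdn; apply/eqP; lia.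
Qed.

Lemma first_non2_2 y : first_non2 (3 * y + 2) = first_non2 y.
Proof.
rewrite /first_non2 (_ : (3 * y + 2).+1 = 3 * y.+1); last lia.
rewrite partnM// (_ : 3`_(3^') = 1) ?mul1n//.
by apply/eqP; rewrite partn_eq1// pnatNK pnat_id.
Qed.

(** The number of spacers met by [m] consecutive returns to the base of a tower,
starting from the return number [y]. *)
Definition spacers m y : nat := \sum_(i < m) first_non2 (y + i).

Lemma spacers0 y : spacers 0 y = 0.
Proof. by rewrite /spacers big_ord0. Qed.

Lemma spacersS m y : spacers m.+1 y = spacers m y + first_non2 (y + m).
Proof. by rewrite /spacers big_ord_recr. Qed.

Lemma spacersD m p y : spacers (m + p) y = spacers m y + spacers p (y + m).
Proof.
elim: p => [|p IH]; first by rewrite spacers0 !addn0.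
by rewrite addnS !spacersS IH !addnA.
Qed.

Lemma spacers_le m y : spacers m y <= m.
Proof.
elim: m => [|m IH]; first by rewrite spacers0.
by rewrite spacersS; have := first_non2_le1 (y + m); lia.
Qed.

Lemma spacers_mul3 m y c : c < 3 -> spacers (3 * m) (3 * y + c) = m + spacers m y.
Proof.
move=> c3; elim: m => [|m IH]; first by rewrite muln0 !spacers0.
rewrite (_ : 3 * m.+1 = (3 * m).+3) 1?mulnS//.
rewrite !spacersS IH; case: c c3 IH => [|[|[|//]]] _ IH.
- rewrite (_ : _ + 0 + 3 * m = 3 * (y + m) + 0) ?first_non2_id//; last lia.
  rewrite (_ : _ + _ + (3 * m).+1 = 3 * (y + m) + 1) ?first_non2_id//; last lia.
  rewrite (_ : _ + _ + (3 * m).+2 = 3 * (y + m) + 2) ?first_non2_2//; last lia.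
  lia.
- rewrite (_ : _ + _ + 3 * m = 3 * (y + m) + 1) ?first_non2_id//; last lia.
  rewrite (_ : _ + _ + (3 * m).+1 = 3 * (y + m) + 2) ?first_non2_2//; last lia.
  rewrite (_ : _ + _ + (3 * m).+2 = 3 * (y + m).+1 + 0) ?first_non2_id//; last lia.
  lia.
- rewrite (_ : _ + _ + 3 * m = 3 * (y + m) + 2) ?first_non2_2//; last lia.
  rewrite (_ : _ + _ + (3 * m).+1 = 3 * (y + m).+1 + 0) ?first_non2_id//; last lia.
  rewrite (_ : _ + _ + (3 * m).+2 = 3 * (y + m).+1 + 1) ?first_non2_id//; last lia.
  lia.
Qed.

Lemma spacers_mul3_1 m y c : c < 3 -> spacers (3 * m).+1 (3 * y + c) =
  if c < 2 then m + spacers m y + c else m + spacers m.+1 y.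
Proof.
move=> c3; rewrite spacersS spacers_mul3//; case: ifP => c2.
  rewrite (_ : _ + _ + 3 * m = 3 * (y + m) + c) ?first_non2_id//; lia.
rewrite (_ : _ + _ + 3 * m = 3 * (y + m) + 2) ?first_non2_2 ?spacersS; lia.
Qed.

Lemma spacers_mul3_2 m y c : c < 3 -> spacers (3 * m).+2 (3 * y + c) =
  if c == 0 then m.+1 + spacers m y
  else m + spacers m.+1 y + (c == 1).
Proof.
move=> c3; rewrite spacersS spacers_mul3_1//; case: c c3 => [|[|[|//]]] _ /=.
- rewrite (_ : _ + _ + (3 * m).+1 = 3 * (y + m) + 1) ?first_non2_id//; lia.
- rewrite (_ : _ + _ + (3 * m).+1 = 3 * (y + m) + 2) ?first_non2_2 ?spacersS; lia.
- rewrite (_ : _ + _ + (3 * m).+1 = 3 * (y + m).+1 + 0) ?first_non2_id//; lia.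
Qed.

Lemma spacers_base3 y c : c < 3 -> spacers (3 * y + c) 0 = y + spacers y 0 + (c == 2).
Proof.
move=> c3; rewrite -[LHS]/(spacers _ (3 * 0 + 0)).
case: c c3 => [|[|[|//]]] _.
- by rewrite addn0 spacers_mul3 ?addn0.
- by rewrite addn1 spacers_mul3_1.
- by rewrite addn2 spacers_mul3_2//= addSn addn1.
Qed.

(** Position, in a tower of high order, of the base of the copy number [y] of
Tower [n]. *)
Definition pos n y : nat := y * height n + spacers y 0.

Lemma pos3 n y c : c < 3 ->
  pos n (3 * y + c) = pos n.+1 y + (c * height n + (c == 2)).
Proof. by move=> c3; rewrite /pos spacers_base3//=; lia. Qed.

Lemma posD n y m : pos n (y + m) = pos n y + m * height n + spacers m y.
Proof. by rewrite /pos spacersD add0n mulnDl; lia. Qed.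

Lemma pos_gap n y y' : y < y' -> pos n y + height n <= pos n y'.
Proof.
move=> yy'; have -> : y' = y + (y' - y.+1).+1 by lia.
by rewrite posD mulSn -addnA leq_add2l -addnA leq_addr.
Qed.

Lemma pos_inj n y y' i i' : i < height n -> i' < height n ->
  pos n y + i = pos n y' + i' -> y = y' /\ i = i'.
Proof.
move=> ih ih' e; have [yy'|yy'|yy'] := ltngtP y y'.
- by have := pos_gap n yy'; lia.
- by have := pos_gap n yy'; lia.
- by split => //; move: e; rewrite yy'; lia.
Qed.

Lemma pos_exp3 n d : pos n (3 ^ d) = height (n + d) + first_non2 0.
Proof.
elim: d n => [|d IH] n; first by rewrite expn0 addn0 /pos mul1n /spacers big_ord1.
by rewrite expnS -[3 * _]addn0 pos3// mul0n !addn0 IH addSnnS.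
Qed.

Lemma pos_lt n d y i : y < 3 ^ d -> i < height n -> pos n y + i < height (n + d).
Proof.
move=> yd ih; have := pos_gap n yd; rewrite pos_exp3.
by rewrite (@first_non2_id 0 0)// addn0; lia.
Qed.

(** The number of nonzero digits of [n] in balanced ternary; the digit after
the last one of [n] is read in [n.+1 %/ 3], the integer nearest to [n / 3].  The
first argument is recursion fuel. *)
Fixpoint weight_rec f n : nat :=
  if f is f'.+1 then (n %% 3 != 0) + weight_rec f' (n.+1 %/ 3) else 0.
Definition weight n : nat := weight_rec n n.

Lemma weight_recE f n : n <= f -> weight_rec f n = weight n.
Proof.
rewrite /weight; elim/ltn_ind: n f => n IH [|f]; first by case: n IH.
case: n IH => [IH _|n IH nf].
  rewrite /=; elim: f => //= f ->//.
by rewrite [in RHS]/= [in LHS]/= !(IH (n.+2 %/ 3)); [|lia..].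
Qed.

Lemma weightE n : weight n = (n %% 3 != 0) + weight (n.+1 %/ 3).
Proof. by case: n => // n; rewrite {1}/weight/= weight_recE//; lia. Qed.

Lemma weight3 n : weight (3 * n) = weight n.
Proof. by rewrite weightE -[RHS]add0n; congr (_ + _); [lia|congr weight; lia]. Qed.

Lemma weight3_1 n : weight (3 * n).+1 = (weight n).+1.
Proof. by rewrite weightE -[RHS]add1n; congr (_ + _); [lia|congr weight; lia]. Qed.

Lemma weight3_2 n : weight (3 * n).+2 = (weight n.+1).+1.
Proof. by rewrite weightE -[RHS]add1n; congr (_ + _); [lia|congr weight; lia]. Qed.

Lemma ternary_ind (P : nat -> Prop) : P 0 ->
  (forall q, 0 < q -> P q -> P (3 * q)) ->
  (forall q, (forall p, p <= q -> P p) -> (0 < q -> P q.+1) -> P (3 * q).+1) ->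
  (forall q, P q -> P q.+1 -> P (3 * q).+2) -> forall n, P n.
Proof.
move=> P0 P3 P31 P32; elim/ltn_ind => n IH.
have := ltn_pmod n (isT : 0 < 3); case: (posnP n) => [->//|n0].
have -> : P n = P (3 * (n %/ 3) + n %% 3) by congr P; lia.
case: (n %% 3) (divn_eq n 3) => [|[|[|//]]] nE _; rewrite ?addn0 ?addn1 ?addn2.
- by apply: P3; [lia|apply: IH; lia].
- by apply: P31 => [p pq|q0]; apply: IH; lia.
- by apply: P32; apply: IH; lia.
Qed.

(** Adding one to a number carries only through digits 1, which become -1, so it
changes at most one digit between zero and nonzero. *)
Lemma weight_lip n : weight n.+1 <= (weight n).+1 /\ weight n <= (weight n.+1).+1.
Proof.
elim/ternary_ind: n => [|q _ _|q IH _|q _ _]; first by [].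
- by rewrite weight3_1 weight3; lia.
- by have := IH q (leqnn q); rewrite weight3_1 weight3_2; lia.
- by rewrite (_ : (3 * q).+3 = 3 * q.+1) ?weight3 ?weight3_2; lia.
Qed.

Lemma weight_add n p : weight (n + p) <= weight n + p /\ weight n <= weight (n + p) + p.
Proof.
elim: p => [|p IH]; first by rewrite !addn0.
by rewrite addnS; have := weight_lip (n + p); lia.
Qed.

(** Each nonzero balanced digit of [m] shifts the number of spacers away from its
mean value [m / 2] by at most 1/2. *)
Lemma spacers_spread m y :
  2 * spacers m y <= m + weight m /\ m <= 2 * spacers m y + weight m.
Proof.
elim/ternary_ind: m y => [|q _ IH|q IH IH1|q IH IH1] y; first by rewrite spacers0.
all: have {1 2}-> : y = 3 * (y %/ 3) + y %% 3 by lia.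
all: have c3 : y %% 3 < 3 by rewrite ltn_pmod.
all: move: (y %/ 3) (y %% 3) c3 => {}y c c3.
- by rewrite spacers_mul3// weight3; have := IH y; lia.
- rewrite spacers_mul3_1// weight3_1; case: (posnP q) => [->|q0].
    by rewrite spacersS !spacers0 !addn0; have := first_non2_le1 y; case: ifP; lia.
  have := IH q (leqnn q) y; have := IH1 q0 y; have := weight_lip q.
  by case: ifP; lia.
- rewrite spacers_mul3_2// weight3_2; have := IH y; have := IH1 y.
  by have := weight_lip q; case: ifP; case: (c == 1) => /=; lia.
Qed.

End Digits.

(** * Haar measure on the 3-adic integers *)

Section Truncation.
Local Open Scope nat_scope.
Implicit Types x : Gamma.

Definition truncation N x : nat := \sum_(i < N) x i * 3 ^ i.

Lemma truncation0 x : truncation 0 x = 0.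
Proof. by rewrite /truncation big_ord0. Qed.

Lemma truncationS N x : truncation N.+1 x = truncation N x + x N * 3 ^ N.
Proof. by rewrite /truncation big_ord_recr. Qed.

Lemma truncation_lt N x : truncation N x < 3 ^ N.
Proof.
elim: N => [|N IH]; first by rewrite truncation0.
rewrite truncationS expnS; have : x N * 3 ^ N <= 2 * 3 ^ N.
  by rewrite leq_mul2r -ltnS ltn_ord orbT.
by lia.
Qed.

Lemma truncation_shift N x :
  truncation N.+1 x = x 0 + 3 * truncation N (fun i => x i.+1).
Proof.
rewrite /truncation big_ord_recl/= muln1; congr (_ + _).
by rewrite big_distrr/=; apply: eq_bigr => i _; rewrite expnS mulnCA.
Qed.

Lemma truncation_add N (a : Gamma) x :
  truncation N (Gamma_add a x) = (truncation N a + truncation N x) %% 3 ^ N.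
Proof.
elim: N => [|N IH]; first by rewrite !truncation0 modn1.
rewrite truncationS {}IH /Gamma_add inordK ?ltn_pmod//.
have -> : \sum_(i < N.+1) (a i + x i) * 3 ^ i =
    truncation N.+1 a + truncation N.+1 x.
  by rewrite -big_split/=; apply: eq_bigr => i _; rewrite mulnDl.
rewrite !truncationS; set s := truncation N a; set t := truncation N x.
have -> : (s + t) %% 3 ^ N = (s + a N * 3 ^ N + (t + x N * 3 ^ N)) %% 3 ^ N.
  by rewrite addnACA -mulnDl [s + t + _]addnC modnMDl.
set u := s + _ + _; have n0 : 0 < 3 ^ N by rewrite expn_gt0.
rewrite [in RHS](divn_eq u (3 ^ N)) [in RHS](divn_eq (u %/ 3 ^ N) 3).
rewrite mulnDl -mulnA -expnS -addnA modnMDl [RHS]modn_small 1?addnC//.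
rewrite expnS; have := ltn_pmod u n0.
have : u %/ 3 ^ N %% 3 * 3 ^ N <= 2 * 3 ^ N.
  by rewrite leq_mul2r -ltnS ltn_pmod ?orbT.
move: (_ %% 3 * 3 ^ N) => v; by move: (u %% 3 ^ N) (3 ^ N); lia.
Qed.

Lemma truncation_one N : truncation N Gamma_one = 1 %% 3 ^ N.
Proof.
case: N => [|N]; first by rewrite truncation0.
rewrite truncation_shift /truncation big1 ?muln0 ?addn0; last first.
  by move=> i _; rewrite /Gamma_one inordK.
by rewrite /Gamma_one inordK// modn_small// expnS; have := expn_gt0 3 N; lia.
Qed.

Lemma truncation_odometer N x :
  truncation N (odometer x) = (truncation N x).+1 %% 3 ^ N.
Proof. by rewrite truncation_add truncation_one modnDmr addn1. Qed.

Lemma truncation_iter N i x : truncation N x + i < 3 ^ N ->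
  truncation N (iter i odometer x) = truncation N x + i.
Proof.
elim: i => [|i IH] h; first by rewrite addn0.
by rewrite iterS truncation_odometer IH ?modn_small; lia.
Qed.

Lemma phi_head x : x 0 != 2 :> nat -> phi x = x 0.
Proof.
move=> x0; rewrite /phi; case: pselect => [h|[]]; last by exists 0.
case: ex_minnP => k _ /(_ 0); rewrite x0 => /(_ isT).
by rewrite leqn0 => /eqP->.
Qed.

Lemma phi_shift x : x 0 = 2 :> nat -> phi x = phi (fun i => x i.+1).
Proof.
move=> x0; rewrite /phi; case: pselect => [h|nh]; case: pselect => [h'|nh'] //.
- case: ex_minnP => k xk kmin; case: ex_minnP => l xl lmin.
  case: k xk kmin => [|k] xk kmin; first by rewrite x0 in xk.
  suff -> : l = k by [].
  by apply/eqP; rewrite eqn_leq lmin//= -ltnS kmin.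
- by exfalso; case: h => -[|k] xk; [rewrite x0 in xk|case: nh'; exists k].
- by exfalso; case: h' => k xk; case: nh; exists k.+1.
Qed.

Lemma phi_truncation N x : (truncation N x).+1 < 3 ^ N ->
  phi x = first_non2 (truncation N x).
Proof.
elim: N x => [|N IH] x; first by rewrite truncation0.
rewrite truncation_shift expnS => h.
have [x0|x0] := eqVneq (x 0 : nat) 2; last first.
  rewrite phi_head// addnC first_non2_id//.
  by have := ltn_ord (x 0); move/eqP: x0; lia.
by rewrite phi_shift// x0 addnC first_non2_2 -IH//; lia.
Qed.

(** Under translation by one, a truncation that does not overflow just counts. *)
Lemma phi_sum_truncation N m x : truncation N x + m < 3 ^ N ->
  phi_sum m x = spacers m (truncation N x).
Proof.
move=> h; apply: eq_bigr => i _.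
have im := ltn_ord i.
by rewrite (@phi_truncation N) truncation_iter//; lia.
Qed.

End Truncation.

Section Haar.
Context {R : realType} (lambda : probability Gamma R).
Hypothesis lambda_haar : haar lambda.

Let measurable_digit k (d : 'I_3) : measurable [set x : Gamma | x k = d].
Proof. by apply: sub_sigma_algebra; exists k, d. Qed.

Lemma measurable_truncation N (P : nat -> Prop) :
  measurable [set x : Gamma | P (truncation N x)].
Proof.
elim: N P => [|N IH] P.
  have [P0|P0] := pselect (P 0%N).
    rewrite [X in measurable X](_ : _ = setT); first exact: measurableT.
    by apply/seteqP; split => x //= _; rewrite truncation0.
  rewrite [X in measurable X](_ : _ = set0); first exact: measurable0.
  by apply/seteqP; split => x //=; rewrite truncation0.
rewrite [X in measurable X](_ : _ = \big[setU/set0]_(d < 3)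
  ([set x : Gamma | P (truncation N x + d * 3 ^ N)%N] `&` [set x | x N = d])).
  apply: bigsetU_measurable => d _; apply: measurableI => //.
  exact: (IH (fun n => P (n + d * 3 ^ N)%N)).
apply/seteqP; split => x /=; rewrite truncationS.
  by move=> Px; rewrite -bigcup_seq; exists (x N) => //=; rewrite mem_index_enum.
by rewrite -bigcup_seq => -[d _ [/= Px ->]].
Qed.

Let measurable_iter i : measurable_fun [set: Gamma] (iter i odometer).
Proof.
elim: i => [|i IH]; first exact: measurable_id.
apply: (@measurableT_comp _ _ _ _ _ _ odometer) => //.
have mG : @measurable _ Gamma = <<s [set A | exists k (d : 'I_3), A = [set x | x k = d]] >> by [].
apply: (measurability _ mG) => _ [_ [k [d ->]] <-]; rewrite setTI.
have := @measurable_truncation k.+1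
  (fun n => inord ((n + truncation k.+1 Gamma_one) %/ 3 ^ k %% 3) = d :> 'I_3).
congr measurable; apply/seteqP; split => x /= <-; rewrite /odometer /Gamma_add;
  by congr (inord (_ %/ _ %% _)); rewrite -big_split/=; apply: eq_bigr => j _; rewrite mulnDl.
Qed.

Let measurable_phi v : measurable [set x | phi x = v].
Proof.
rewrite [X in measurable X](_ : _ =
  (\bigcup_N [set x | (truncation N x).+1 < 3 ^ N /\ first_non2 (truncation N x) = v]%N)
  `|` [set x | v = 0%N /\ forall N, ((truncation N x).+1 = 3 ^ N)%N]).
  apply: measurableU.
    apply: bigcup_measurable => N _.
    exact: (@measurable_truncation N (fun n => (n.+1 < 3 ^ N)%N /\ first_non2 n = v)).
  rewrite [X in measurable X](_ : _ =
    \bigcap_N [set x | v = 0%N /\ ((truncation N x).+1 = 3 ^ N)%N]).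
    apply: bigcap_measurable; first by exists 0%N.
    move=> N _.
    exact: (@measurable_truncation N (fun n => v = 0%N /\ (n.+1 = 3 ^ N)%N)).
  apply/seteqP; split => x /= h; first by move=> N _; split; [case: h|apply: h.2].
  by split => [|N]; [case: (h 0%N)|case: (h N)].
apply/seteqP; split => x /=.
  have [h|h] := pselect (exists N, ((truncation N x).+1 < 3 ^ N)%N).
    by case: h => N h <-; left; exists N => //; split => //; rewrite (@phi_truncation N).
  have h' N : ((truncation N x).+1 = 3 ^ N)%N.
    apply/eqP; rewrite eqn_leq (truncation_lt N x)/= leqNgt; apply/negP => xN.
    by apply: h; exists N.
  move=> <-; right; split => //; rewrite /phi; case: pselect => // -[k].
  have := h' k.+1; rewrite truncationS expnS; have := h' k.
  move=> e e'; case/eqP.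
  have n0 : (0 < 3 ^ k)%N by rewrite expn_gt0.
  by apply/eqP; rewrite -(eqn_pmul2r n0); apply/eqP; lia.
case=> [[N _ [h <-]]|[-> h]]; first exact: phi_truncation.
rewrite /phi; case: pselect => // -[k].
have := h k.+1; rewrite truncationS expnS; have := h k.
move=> e e'; case/eqP.
have n0 : (0 < 3 ^ k)%N by rewrite expn_gt0.
by apply/eqP; rewrite -(eqn_pmul2r n0); apply/eqP; lia.
Qed.

Lemma measurable_phi_sum m j : measurable [set x | phi_sum m x = j].
Proof.
elim: m j => [|m IH] j.
  rewrite [X in measurable X](_ : _ = [set x | (fun=> 0%N = j) (truncation 0 x)]).
    exact: (@measurable_truncation 0 (fun=> 0%N = j)).
  by apply/seteqP; split => x /=; rewrite /phi_sum big_ord0.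
rewrite [X in measurable X](_ : _ = \bigcup_a ([set x | phi_sum m x = a] `&`
    [set x | (phi (iter m odometer x) + a = j)%N])).
  apply: bigcup_measurable => a _; apply: measurableI => //.
  rewrite -[X in measurable X]setTI.
  apply: (@measurable_iter m measurableT [set x | (phi x + a = j)%N] _).
  have [aj|ja] := leqP a j.
    rewrite [X in measurable X](_ : _ = [set x | phi x = (j - a)%N]); first exact: measurable_phi.
    by apply/seteqP; split => x /=; lia.
  rewrite [X in measurable X](_ : _ = set0); first exact: measurable0.
  by apply/seteqP; split => x //=; lia.
apply/seteqP; split => x /=; rewrite /phi_sum big_ord_recr/=.
  by move=> <-; exists (phi_sum m x) => //; split => //=; rewrite addnC.
by move=> [a _ [/= <-]]; rewrite addnC.
Qed.

(** Translation by 1 permutes cyclically the cylinders of a given length, which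
therefore have the same measure. *)
Lemma haar_truncation N y : (y < 3 ^ N)%N ->
  lambda [set x | truncation N x = y] = ((3 ^+ N)^-1)%:E.
Proof.
move=> yN; pose F z : set Gamma := [set x | truncation N x = z].
have mF z : measurable (F z) by exact: (@measurable_truncation N (fun n => n = z)).
have c z : (z < 3 ^ N)%N -> lambda (F z) = lambda (F 0%N).
  elim: z => // z IH zN; rewrite -IH; last lia.
  rewrite -(lambda_haar Gamma_one (mF z.+1)); congr (lambda _).
  apply/seteqP; split => x; rewrite /F /= truncation_add truncation_one modnDml add1n.
    have := truncation_lt N x; rewrite leq_eqVlt => /predU1P[->|xN].
      by rewrite modnn.
    by rewrite modn_small// => -[].
  by move=> ->; rewrite modn_small.
have : lambda (\big[setU/set0]_(z < 3 ^ N) F z) = 1%E.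
  rewrite (_ : \big[_/_]_(_ < _) _ = setT) ?probability_setT//.
  apply/seteqP; split => x //= _; rewrite -bigcup_seq.
  by exists (Ordinal (truncation_lt N x)) => //=; rewrite mem_index_enum.
rewrite measure_bigsetU//; last by move=> i j _ _ [x [<- <-]].
rewrite (eq_bigr (fun=> lambda (F 0%N))); last by move=> i _; exact: c.
rewrite -(c y yN) -/(F y).
have /fineK <- : lambda (F y) \is a fin_num by exact: fin_num_measure.
rewrite sumEFin => -[]; rewrite sumr_const card_ord => e; congr EFin.
have n0 : 3 ^+ N != 0 :> R by rewrite expf_neq0.
by apply: (mulfI n0); rewrite mulfV// -[RHS]e -natrX mulr_natl.
Qed.

Lemma haar_truncation_set N (P : pred nat) :
  lambda [set x | P (truncation N x)] = ((\sum_(y < 3 ^ N | P y) 1)%:R / 3 ^+ N)%:E.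
Proof.
pose F y : set Gamma := if P y then [set x | truncation N x = y] else set0.
rewrite [X in lambda X](_ : _ = \big[setU/set0]_(y < 3 ^ N) F y).
  rewrite (measure_bigsetU lambda (F := F))//.
  - rewrite (eq_bigr (fun y : 'I_(3 ^ N) => ((P y)%:R / 3 ^+ N)%:E)).
      rewrite sumEFin -mulr_suml; congr ((_ / _)%:E).
      by rewrite natr_sum [RHS]big_mkcond/=; apply: eq_bigr => i _; case: ifP.
    move=> y _; rewrite /F; case: ifP => _; last by rewrite measure0 mul0r.
    by rewrite mul1r; exact: haar_truncation.
  - move=> y; rewrite /F; case: ifP => _ //.
    exact: (@measurable_truncation N (fun n => n = y)).
  - by move=> i j _ _; rewrite /F; case: ifP; case: ifP => // _ _ -[x []] // <- <-.
apply/seteqP; split => x /=; rewrite -bigcup_seq.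
  move=> Px; exists (Ordinal (truncation_lt N x)); first exact: mem_index_enum.
  by rewrite /F/= Px.
by move=> [y _] /=; rewrite /F; case: ifP => // Py ->.
Qed.

End Haar.

(** * The distributions of the number of spacers *)

Lemma count_near_end n m : (\sum_(y < n | n <= y + m) 1 <= m)%N.
Proof.
rewrite big_mkcond (reindex_inj rev_ord_inj)/=.
rewrite (eq_bigr (fun y : 'I_n => (y < m) : nat))%N; last first.
  by move=> y _; have := ltn_ord y; case: ifP; lia.
rewrite (_ : (\sum_(_ < _) _)%N = minn n m) ?geq_minr//.
elim: n => [|n IH]; first by rewrite big_ord0 min0n.
by rewrite big_ord_recr/= IH; lia.
Qed.

Lemma sum_base3 (V : nmodType) n (G : nat -> V) :
  \sum_(y < 3 * n) G y =
  \sum_(y < n) (G (3 * y)%N + G (3 * y).+1 + G (3 * y).+2).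
Proof.
elim: n => [|n IH]; first by rewrite muln0 !big_ord0.
by rewrite mulnS add3n !big_ord_recr/= IH !addrA.
Qed.

Lemma cvg_div_exp3 {R : realType} (c : R) : c / 3 ^+ n @[n --> \oo] --> (0 : R).
Proof.
have /(@cvg_geometric _ c) : `|1 / 3 : R| < 1 by rewrite ger0_norm; lra.
rewrite /geometric; apply: cvg_trans; apply: near_eq_cvg; near=> n.
by rewrite /= exprMn expr1n mul1r exprVn.
Unshelve. all: by end_near. Qed.

Lemma eq_limit {R : realType} (u v : nat -> R) (a b : R) :
  u @ \oo --> a -> v @ \oo --> b -> u =1 v -> a = b.
Proof. by move=> ua vb /funext uv; rewrite -uv in vb; exact: cvg_unique ua vb. Qed.

Section Mean.
Context {R : realType} (lambda : probability Gamma R).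
Hypothesis lambda_haar : haar lambda.
Implicit Types F G : nat -> R.

(** The number of spacers is read on the first [d] digits, unless these carry
during the [m] steps: this is the case of at most [m] cylinders. *)
Lemma pi_coef_approx m j d :
  `|pi_coef lambda m j - (\sum_(y < 3 ^ d | spacers m y == j) 1)%:R / 3 ^+ d|
    <= m%:R / 3 ^+ d.
Proof.
pose A := [set x | phi_sum m x = j].
pose B := [set x | spacers m (truncation d x) == j].
pose N := [set x | (3 ^ d <= truncation d x + m)%N].
have mA : measurable A by exact: measurable_phi_sum.
have mB : measurable B.
  exact: (@measurable_truncation _ (fun n => spacers m n == j)).
have mN : measurable N.
  exact: (@measurable_truncation _ (fun n => (3 ^ d <= n + m)%N)).
have lB := haar_truncation_set lambda_haar d (fun n => spacers m n == j).
have lN := haar_truncation_set lambda_haar d (fun n => 3 ^ d <= n + m)%N.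
have N_le : (lambda N <= (m%:R / 3 ^+ d)%:E)%E.
  rewrite lN lee_fin ler_wpM2r ?invr_ge0 ?exprn_ge0// ler_nat.
  exact: count_near_end.
have key x : ~ N x -> phi_sum m x = spacers m (truncation d x).
  by move=> /negP; rewrite -ltnNge => /phi_sum_truncation.
have AB : (lambda A <= lambda B + lambda N)%E.
  apply: le_trans (measureU2 _ mB mN); rewrite le_measure ?inE//; first exact: measurableU.
  move=> x; rewrite /A/= => Ax; have [Nx|Nx] := pselect (N x); first by right.
  by left; rewrite /B/= -key// Ax.
have BA : (lambda B <= lambda A + lambda N)%E.
  apply: le_trans (measureU2 _ mA mN); rewrite le_measure ?inE//; first exact: measurableU.
  move=> x; rewrite /B/= => /eqP Bx; have [Nx|Nx] := pselect (N x); first by right.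
  by left; rewrite /A/= key.
have fA : lambda A = (fine (lambda A))%:E by rewrite fineK// fin_num_measure.
have AB' : (lambda A <= lambda B + (m%:R / 3 ^+ d)%:E)%E.
  by apply: le_trans AB _; rewrite leeD2l.
have BA' : (lambda B <= lambda A + (m%:R / 3 ^+ d)%:E)%E.
  by apply: le_trans BA _; rewrite leeD2l.
move: AB' BA'; rewrite {1 2}/B lB fA -!EFinD !lee_fin => AB' BA'.
by rewrite /pi_coef -/A ler_distl lerBlDr BA'/=.
Qed.

(** The polynomial [P_m] enters the proof only through this linear form, for which
multiplication by [X] is a shift of [F]. *)
Definition mean m F : R := \sum_(j < m.+1) pi_coef lambda m j * F j.

Lemma mean_cvg m F :
  (\sum_(y < 3 ^ d) F (spacers m y)) / 3 ^+ d @[d --> \oo] --> mean m F.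
Proof.
apply/cvgrPdist_le => e e0.
pose C := \sum_(j < m.+1) `|F j|.
have /cvgrPdist_le/(_ e e0) := @cvg_div_exp3 R (m%:R * C).
apply: filterS => d; rewrite sub0r normrN => He.
apply: le_trans (le_trans (ler_norm _) He).
have -> : (\sum_(y < 3 ^ d) F (spacers m y)) / 3 ^+ d =
    \sum_(j < m.+1) (\sum_(y < 3 ^ d | spacers m y == j) 1)%:R / 3 ^+ d * F j.
  rewrite mulr_suml; under [RHS]eq_bigr do rewrite big_mkcond natr_sum !mulr_suml.
  rewrite exchange_big/=; apply: eq_bigr => y _.
  have ym : (spacers m y < m.+1)%N by rewrite ltnS spacers_le.
  rewrite (bigD1 (Ordinal ym))//= eqxx big1 ?addr0; first by rewrite mul1r mulrC.
  by move=> j /eqP jy; case: ifP; [move=> /eqP yj; case: jy; apply/val_inj|rewrite !mul0r].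
rewrite /mean -sumrB; apply: le_trans (ler_norm_sum _ _ _) _.
rewrite mulrAC mulr_sumr; apply: ler_sum => j _.
by rewrite -mulrBl normrM ler_wpM2r// pi_coef_approx.
Qed.

Lemma mean_cvg_base3 m F :
  (\sum_(y < 3 ^ d) (F (spacers m (3 * y)) + F (spacers m (3 * y).+1) +
    F (spacers m (3 * y).+2))) / 3 ^+ d / 3 @[d --> \oo] --> mean m F.
Proof.
have := @mean_cvg m F; rewrite -cvg_shiftS; apply: cvg_trans.
apply: near_eq_cvg; near=> d => /=.
by rewrite expnS (sum_base3 _ (fun y => F (spacers m y))) exprS invfM mulrA mulrAC.
Unshelve. all: by end_near. Qed.

Lemma eq_mean m F G : (forall j, (j <= m)%N -> F j = G j) -> mean m F = mean m G.
Proof. by move=> FG; apply: eq_bigr => j _; rewrite FG// -ltnS. Qed.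

Lemma mean0 F : mean 0 F = F 0%N.
Proof.
have := @mean_cvg 0 F; set u := (X in X @ _ --> _).
suff -> : u = fun=> F 0%N by move=> h; exact: cvg_unique h (cvg_cst _).
apply/funext => d; rewrite /u (eq_bigr (fun=> F 0%N)); last by move=> i _; rewrite spacers0.
by rewrite sumr_const card_ord -[X in X / _]mulr_natr natrX mulfK// expf_neq0.
Qed.

(** The recursion on [P_m]: [3 m + c] returns to the base of a tower make [m] or
[m + 1] returns to the base of the next one, according to the column in which they
start, and cross the spacers of those returns plus the inner ones. *)
Lemma mean3 m F : mean (3 * m) F = mean m (fun j => F (m + j)%N).
Proof.
have := @mean_cvg m (fun j => F (m + j)%N); have := @mean_cvg_base3 (3 * m) F.
set u := (X in X @ _ --> _); set v := (X in _ -> X @ _ --> _ -> _).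
suff -> : u = v by exact: cvg_unique.
apply/funext => d; rewrite /u /v mulrAC; congr (_ / _).
rewrite mulr_suml; apply: eq_bigr => y _.
have e c : (c < 3)%N -> spacers (3 * m) (3 * y + c) = (m + spacers m y)%N.
  exact: spacers_mul3.
have := e 0%N isT; have := e 1%N isT; have := e 2%N isT.
by rewrite addn0 addn1 addn2 => -> -> ->; lra.
Qed.

Lemma mean3_1 m F : mean (3 * m).+1 F =
  (mean m (fun j => F (m + j)%N) + mean m (fun j => F (m.+1 + j)%N)
   + mean m.+1 (fun j => F (m + j)%N)) / 3.
Proof.
apply: (eq_limit (@mean_cvg_base3 (3 * m).+1 F)).
  apply: cvgM; last exact: cvg_cst.
  by apply: cvgD; [apply: cvgD|]; exact: mean_cvg.
move=> d.
rewrite -[RHS]/((_ / 3 ^+ d + _ / 3 ^+ d + _ / 3 ^+ d) / 3) -!mulrDl -!big_split/=; congr (_ / _ / _).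
apply: eq_bigr => y _.
have e c : (c < 3)%N -> _ := @spacers_mul3_1 m y c.
have := e 0%N isT; have := e 1%N isT; have := e 2%N isT.
rewrite addn0 addn1 addn2/= => -> -> ->.
by congr (F _ + F _ + F _); lia.
Qed.

Lemma mean3_2 m F : mean (3 * m).+2 F =
  (mean m (fun j => F (m.+1 + j)%N) + mean m.+1 (fun j => F (m + j)%N)
   + mean m.+1 (fun j => F (m.+1 + j)%N)) / 3.
Proof.
apply: (eq_limit (@mean_cvg_base3 (3 * m).+2 F)).
  apply: cvgM; last exact: cvg_cst.
  by apply: cvgD; [apply: cvgD|]; exact: mean_cvg.
move=> d.
rewrite -[RHS]/((_ / 3 ^+ d + _ / 3 ^+ d + _ / 3 ^+ d) / 3) -!mulrDl -!big_split/=; congr (_ / _ / _).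
apply: eq_bigr => y _.
have e c : (c < 3)%N -> _ := @spacers_mul3_2 m y c.
have := e 0%N isT; have := e 1%N isT; have := e 2%N isT.
rewrite addn0 addn1 addn2/= => -> -> ->.
by rewrite addrAC; congr (F _ + F _ + F _); lia.
Qed.

Lemma mean1 F : mean 1 F = (F 0%N + F 1%N) / 2.
Proof. by have := mean3_1 0 F; rewrite !mean0 => e; rewrite -[LHS]/(mean (3 * 0).+1 F); lra. Qed.

(** [P_m] is palindromic: reversing the index permutes the terms of the recursion. *)
Lemma mean_rev m F : mean m F = mean m (fun j => F (m - j)%N).
Proof.
elim/ternary_ind: m F => [F|q _ IH F|q IH IH1 F|q IH IH1 F].
- by rewrite !mean0.
- by rewrite !mean3 IH; apply: eq_mean => j jq; congr F; lia.
- have [->|q0] := posnP q; first by rewrite !mean1 /= subnn addrC.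
  rewrite mean3_1 (IH q (leqnn _) (fun j => F (q + j)%N)).
  rewrite (IH q (leqnn _) (fun j => F (q.+1 + j)%N)) (IH1 q0 (fun j => F (q + j)%N)).
  rewrite mean3_1 (addrC (mean q _)).
  by congr ((_ + _ + _) / 3); apply: eq_mean => j jq; congr F; lia.
- rewrite mean3_2 (IH (fun j => F (q.+1 + j)%N)) (IH1 (fun j => F (q + j)%N)).
  rewrite (IH1 (fun j => F (q.+1 + j)%N)) mean3_2 addrAC.
  by congr ((_ + _ + _) / 3); apply: eq_mean => j jq; congr F; lia.
Qed.

Lemma mean_spread m F : (forall j, (2 * j <= m + weight m)%N ->
  (m <= 2 * j + weight m)%N -> F j = 0) -> mean m F = 0.
Proof.
move=> F0; have := @mean_cvg m F; set u := (X in X @ _ --> _).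
suff -> : u = fun=> 0 by move=> h; exact: cvg_unique h (cvg_cst _).
apply/funext => d; rewrite /u big1 ?mul0r// => y _.
by have [] := spacers_spread m y; exact: F0.
Qed.

Lemma pi_coef_ge0 m j : 0 <= pi_coef lambda m j.
Proof. by rewrite fine_ge0. Qed.

Lemma mean_le m F G : (forall j, (j <= m)%N -> F j <= G j) -> mean m F <= mean m G.
Proof.
by move=> FG; apply: ler_sum => j _; rewrite ler_wpM2l ?pi_coef_ge0// FG// -ltnS.
Qed.

Lemma meanD m F G : mean m (fun j => F j + G j) = mean m F + mean m G.
Proof. by rewrite /mean -big_split/=; apply: eq_bigr => j _; rewrite mulrDr. Qed.

Lemma meanZ m c F : mean m (fun j => c * F j) = c * mean m F.
Proof. by rewrite /mean mulr_sumr; apply: eq_bigr => j _; rewrite mulrCA. Qed.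

Lemma meanB m F G : mean m (fun j => F j - G j) = mean m F - mean m G.
Proof. by rewrite /mean -sumrB; apply: eq_bigr => j _; rewrite mulrBr. Qed.

Lemma mean_sum m (I : Type) (r : seq I) (P : pred I) (F : I -> nat -> R) :
  mean m (fun j => \sum_(i <- r | P i) F i j) = \sum_(i <- r | P i) mean m (F i).
Proof. by rewrite /mean exchange_big/=; apply: eq_bigr => j _; rewrite mulr_sumr. Qed.

Lemma mean_cst m c : mean m (fun=> c) = c.
Proof.
have := @mean_cvg m (fun=> c); set u := (X in X @ _ --> _).
suff -> : u = fun=> c by move=> h; exact: cvg_unique h (cvg_cst _).
apply/funext => d; rewrite /u.
by rewrite sumr_const card_ord -[X in X / _]mulr_natr natrX mulfK// expf_neq0.
Qed.

Lemma mean_norm m F : `|mean m F| <= mean m (fun j => `|F j|).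
Proof.
apply: le_trans (ler_norm_sum _ _ _) _; apply: ler_sum => j _.
by rewrite normrM ger0_norm ?pi_coef_ge0.
Qed.

End Mean.

(** * Smoothness of the polynomials with many nonzero digits *)

Section Smoothing.
Context {R : realType}.
Implicit Types (F G : nat -> R).

Definition avg F : nat -> R := fun x => (F x + F x.+1) / 2.
Definition fwd_diff F : nat -> R := fun x => F x.+1 - F x.

Lemma iter_avgS n F x :
  iter n.+1 avg F x = (iter n avg F x + iter n avg F x.+1) / 2.
Proof. by []. Qed.

Lemma iter_avg_lin n c F G x :
  iter n avg (fun x => c * F x + G x) x = c * iter n avg F x + iter n avg G x.
Proof. by elim: n x => [//|n IH] x; rewrite !iter_avgS !IH; lra. Qed.

Lemma iter_avg_diff n F x :
  iter n avg (fwd_diff F) x = iter n avg F x.+1 - iter n avg F x.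
Proof. by elim: n x => [//|n IH] x; rewrite !iter_avgS !IH; lra. Qed.

Lemma iter_avg_shift n a F x :
  iter n avg (fun x => F (a + x)%N) x = iter n avg F (a + x)%N.
Proof. by elim: n x => [//|n IH] x; rewrite !iter_avgS !IH addnS. Qed.

Lemma iter_avg_le n F G x : (forall x, F x <= G x) ->
  iter n avg F x <= iter n avg G x.
Proof.
by move=> FG; elim: n x => [//|n IH] x; rewrite !iter_avgS; have := IH x;
  have := IH x.+1; lra.
Qed.

Lemma iter_avg_norm n F x : `|iter n avg F x| <= iter n avg (fun y => `|F y|) x.
Proof.
elim: n x => [//|n IH] x; rewrite !iter_avgS.
have := ler_normD (iter n avg F x) (iter n avg F x.+1).
have := IH x; have := IH x.+1; rewrite normrM (ger0_norm (_ : 0 <= 2^-1)); lra.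
Qed.

(** Under [n] averaging steps the index performs a random walk: this is the
second moment of its position. *)
Lemma iter_avg_variance n c x :
  iter n avg (fun y => (c - 2 * y%:R) ^+ 2) x = n%:R + (c - 2 * x%:R - n%:R) ^+ 2.
Proof.
elim: n x => [|n IH] x; first by rewrite subr0 add0r.
by rewrite iter_avgS !IH -!natr1; field.
Qed.

(** Summation by parts: the difference of consecutive values is the covariance
with the centred walk. *)
Lemma iter_avg_parts n F x :
  iter n avg (fun y => (n%:R - 2 * (y%:R - x%:R)) * F y) x =
  - (n%:R / 2) * iter n.-1 avg (fwd_diff F) x.
Proof.
elim: n x => [|n IH] x.
  by rewrite /= subrr mulr0 subr0 !mul0r oppr0 mul0r.
have e1 : iter n avg (fun y => (n.+1%:R - 2 * (y%:R - x%:R)) * F y) x =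
    - (n%:R / 2) * iter n.-1 avg (fwd_diff F) x + iter n avg F x.
  rewrite -IH -[X in X + _]mul1r -iter_avg_lin; congr (iter _ _ _ _); apply/funext => y.
  by rewrite -natr1; ring.
have e2 : iter n avg (fun y => (n.+1%:R - 2 * (y%:R - x%:R)) * F y) x.+1 =
    - (n%:R / 2) * iter n.-1 avg (fwd_diff F) x.+1 - iter n avg F x.+1.
  rewrite -IH addrC -[- iter _ _ _ _]mulN1r -iter_avg_lin; congr (iter _ _ _ _); apply/funext => y.
  by rewrite -!natr1; ring.
rewrite iter_avgS e1 e2 /= iter_avg_diff.
case: n {IH e1 e2} => [|n]; first by rewrite /= /fwd_diff; field.
rewrite -[n.+1.-1]/n; rewrite !iter_avg_diff !iter_avgS -!natr1.
set a := iter n avg F x; set b := iter n avg F x.+1; set c := iter n avg F x.+2.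
by field.
Qed.

(** Averaging [n] times a bounded sequence leaves differences of order
[1 / sqrt n]. *)
Lemma iter_avg_diff_le n (e : R) F x : 0 < e -> 1 <= n.+1%:R * e ^+ 2 ->
  (forall y, `|F y| <= 1) -> `|iter n avg (fwd_diff F) x| <= 2 * e.
Proof.
move=> e0 ne F1; have n0 : 0 < n.+1%:R :> R by rewrite ltr0n.
have := iter_avg_parts n.+1 F x; rewrite -[n.+1.-1]/n => /(congr1 Num.norm).
rewrite mulNr normrN (normrM (n.+1%:R / 2)) (ger0_norm (_ : 0 <= n.+1%:R / 2)) ?divr_ge0// => eqn.
have : n.+1%:R / 2 * `|iter n avg (fwd_diff F) x| <=
   iter n.+1 avg (fun y => e / 2 * ((n.+1%:R + 2 * x%:R) - 2 * y%:R) ^+ 2 + (e^-1 / 2)) x.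
  rewrite -eqn; apply: le_trans (iter_avg_norm _ _ _) _; apply: iter_avg_le => y.
  rewrite normrM; apply: le_trans (ler_wpM2l _ (F1 y)) _ => //; rewrite mulr1.
  set t := (X in `|X|).
  rewrite (_ : (n.+1%:R + 2 * x%:R - 2 * y%:R) = t); last by rewrite /t; ring.
  have : 0 <= (e * `|t| - 1) ^+ 2 by rewrite sqr_ge0.
  rewrite sqrrB1 exprMn real_normK ?num_real// => h.
  rewrite -(ler_pM2l e0) mulrDr !mulrA divff ?gt_eqF//.
  by move: h; rewrite -mulrnAr -mulr_natl; nra.
rewrite iter_avg_lin iter_avg_variance.
rewrite (_ : _ - _ - _ = 0 :> R); last by ring.
have -> k (c : R) : iter k avg (fun=> c) x = c.
  by elim: k x {n0 eqn ne} => [//|k IH] x; rewrite iter_avgS !IH; field.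
rewrite expr0n addr0 => h.
have ei : e^-1 <= n.+1%:R * e.
  by rewrite -[leLHS]mul1r ler_pdivrMr// -mulrA -expr2.
rewrite -(ler_pM2l n0); lra.
Qed.

End Smoothing.

Section Mean_smooth.
Context {R : realType} (lambda : probability Gamma R).
Hypothesis lambda_haar : haar lambda.
Implicit Types F G : nat -> R.
Local Notation mean := (mean lambda).

Let mean_iter_shift m n a F :
  mean m (fun j => iter n avg (fwd_diff F) (a + j)%N) =
  mean m (iter n avg (fwd_diff (fun j => F (a + j)%N))).
Proof.
apply: eq_mean => j _; rewrite -iter_avg_shift; congr (iter _ _ _ _).
by apply/funext => y; rewrite /fwd_diff addnS.
Qed.

Let mean_two m a F : mean m (fun j => F (a + j)%N) + mean m (fun j => F (a.+1 + j)%N) =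
  2 * mean m (fun j => avg F (a + j)%N).
Proof. by rewrite -meanD -meanZ; apply: eq_mean => j _; rewrite /avg; field. Qed.

Let weight_step (w w' : nat) (e C a b : R) i : 0 <= C -> (w <= w'.+1)%N ->
  `|b| <= e + C * (4 / 5) ^+ w' / 2 ^+ i ->
  `|a| <= e + C * (4 / 5) ^+ w / 2 ^+ i.+1 ->
  `|(2 * a + b) / 3| <= e + C * (4 / 5) ^+ w.+1 / 2 ^+ i.
Proof.
move=> C0 ww'.
have rq : (4 / 5) ^+ w' <= 5 / 4 * (4 / 5) ^+ w :> R.
  rewrite -(ler_pM2l (_ : 0 < 4 / 5 :> R))// -exprS mulrA.
  rewrite (_ : 4 / 5 * (5 / 4) = 1 :> R) ?mul1r; last by field.
  by apply: ler_wiXn2l => //; lra.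
have r0 : 0 <= (4 / 5) ^+ w :> R by rewrite exprn_ge0.
rewrite !exprS invfM => hb ha.
have i0 : 0 <= (2 ^+ i)^-1 :> R by rewrite invr_ge0 exprn_ge0.
have K0 : 0 <= C / 2 ^+ i by rewrite mulr_ge0.
have E (k : R) : C * k / 2 ^+ i = C / 2 ^+ i * k by rewrite mulrAC.
have h1 := ler_wpM2l K0 rq; have h2 := mulr_ge0 K0 r0.
rewrite E in hb; rewrite [2^-1 * _]mulrC mulrA E in ha; rewrite E.
rewrite normrM (ger0_norm (_ : 0 <= 3^-1))//.
have := ler_normD (2 * a) b; rewrite normrM (ger0_norm (_ : 0 <= 2))//.
lra.
Qed.

(** Each nonzero balanced digit of [m] contributes, two times out of three, one
averaging step; [4 / 5] bounds the rate since [1 / 3 + 1 / (3 * (4 / 5)) <= 4 / 5]. *)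
Lemma mean_iter_avg_diff (e C : R) : 0 <= e -> 0 <= C ->
  (forall i F x, (forall y, `|F y| <= 1) ->
    `|iter i avg (fwd_diff F) x| <= e + C / 2 ^+ i) ->
  forall m i F, (forall y, `|F y| <= 1) ->
    `|mean m (iter i avg (fwd_diff F))| <= e + C * (4 / 5) ^+ weight m / 2 ^+ i.
Proof.
move=> e0 C0 H m; elim/ternary_ind: m => [|q _ IH|q IH IH1|q IH IH1] i F F1.
- by rewrite mean0 // (_ : weight 0 = 0%N)// expr0 mulr1; exact: H.
- by rewrite mean3// mean_iter_shift weight3; apply: IH => y.
- rewrite weight3_1; have [->|q0] := posnP q.
    rewrite mean1//; have := H i.+1 F 0%N F1.
    rewrite iter_avgS expr1 exprS invfM.
    have : 0 <= C / 2 ^+ i by rewrite divr_ge0 ?exprn_ge0.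
    by rewrite !mulrA [C * _ / _]mulrAC -[C / 2 / _]mulrAC; lra.
  rewrite mean3_1//.
  rewrite (mean_two q q) (mean_iter_shift q i.+1) mean_iter_shift.
  have := IH q (leqnn q) i.+1 (fun j => F (q + j)%N) (fun y => F1 _).
  have := IH1 q0 i (fun j => F (q + j)%N) (fun y => F1 _).
  have [_ wq] := weight_lip q.
  exact: weight_step.
- rewrite weight3_2 mean3_2// -addrA.
  rewrite (mean_two q.+1 q) (mean_iter_shift q.+1 i.+1) mean_iter_shift addrC.
  have := IH1 i.+1 (fun j => F (q + j)%N) (fun y => F1 _).
  have := IH i (fun j => F (q.+1 + j)%N) (fun y => F1 _).
  have [wq _] := weight_lip q.
  exact: weight_step.
Qed.

(** The shifts of [P_m] by one become close to [P_m] as the number of nonzero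
balanced digits of [m] grows. *)
Lemma mean_diff_small (e : R) : 0 < e -> exists w, forall m F,
  (w <= weight m)%N -> (forall y, `|F y| <= 1) -> `|mean m (fwd_diff F)| <= e.
Proof.
move=> e0; have e40 : 0 < e / 4 by rewrite divr_gt0.
pose J := Num.truncn ((e / 4) ^- 2).
have Je : 1 <= J.+1%:R * (e / 4) ^+ 2.
  rewrite -ler_pdivrMr ?exprn_gt0// mul1r ltW//.
  by rewrite truncnS_gt ?invr_ge0 ?exprn_ge0 ?ltW.
have H i F x : (forall y, `|F y| <= 1) ->
    `|iter i avg (fwd_diff F) x| <= e / 2 + 2 * 2 ^+ J / 2 ^+ i.
  move=> F1; have [iJ|Ji] := leqP J i.
    apply: (@le_trans _ _ (2 * (e / 4))).
      apply: iter_avg_diff_le => //; apply: le_trans Je _.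
      by apply: ler_wpM2r; rewrite ?ler_nat// sqr_ge0.
    rewrite (_ : 2 * (e / 4) = e / 2); last by field.
    by rewrite lerDl !mulr_ge0 ?invr_ge0 ?exprn_ge0.
  apply: (@le_trans _ _ 2).
    rewrite iter_avg_diff; apply: le_trans (ler_normB _ _) _.
    have h y : `|iter i avg F y| <= 1.
      apply: le_trans (iter_avg_norm _ _ _) _.
      elim: (i) y => [|k IH] y; first exact: F1.
      by rewrite iter_avgS; have := IH y; have := IH y.+1; lra.
    by have := h x; have := h x.+1; lra.
  apply: (@le_trans _ _ (2 * 2 ^+ J / 2 ^+ i)); last by rewrite lerDr ltW// divr_gt0.
  rewrite ler_pdivlMr ?exprn_gt0//.
  by rewrite ler_pM2l// ler_weXn2l ?ler1n// ltnW.
have C0 : 0 <= 2 * 2 ^+ J :> R by rewrite mulr_ge0 ?exprn_ge0.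
have : geometric (2 * 2 ^+ J) (4 / 5) n @[n --> \oo] --> (0 : R).
  by apply: cvg_geometric; rewrite ger0_norm; lra.
have e20 : 0 < e / 2 by rewrite divr_gt0.
move=> /cvgrPdist_le/(_ _ e20)[w _ /(_ w)/=]; rewrite leqnn => /(_ isT).
rewrite sub0r normrN => wE; exists w => m F wm F1.
have := mean_iter_avg_diff (ltW e20) C0 H m 0%N F1; rewrite expr0 divr1 => h.
apply: le_trans h _; rewrite [leRHS](splitr e) lerD2l.
apply: le_trans (le_trans (ler_norm _) wE); rewrite ler_wpM2l//.
by apply: ler_wiXn2l => //; lra.
Qed.

End Mean_smooth.

(** * The real Hilbert space L2 *)

Section Hilbert.
Context {R : realType}.
Local Notation mu := (@chacon_measure R).
Local Notation L2 := (L2 R).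
Local Notation X := (measurableTypeR R).
Implicit Types f g h : L2.

Lemma L2_Lfun f : (f : R -> R) \in Lfun mu 2%:E.
Proof. exact: Lspace_Lfun. Qed.

Lemma measurable_L2 f : measurable_fun [set: X] (f : X -> R).
Proof. by have /andP[/set_mem] := L2_Lfun f. Qed.

Lemma inner_integrable f g : mu.-integrable setT (EFin \o (fun x => f x * g x)).
Proof. by apply/Lfun1_integrable/Lfun2_mul_Lfun1; exact: L2_Lfun. Qed.

Lemma Rintegral_ae_eq (u v : X -> R) :
  measurable_fun setT u -> measurable_fun setT v -> u = v %[ae mu] ->
  \int[mu]_x u x = \int[mu]_x v x.
Proof.
move=> mu' mv uv; congr fine; apply: ae_eq_integral => //.
- exact/measurable_EFinP.
- exact/measurable_EFinP.
- by move: uv; apply: filterS => x + _ => /(_ I) ->.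
Qed.

Lemma innerE f g (u v : X -> R) : measurable_fun setT u -> measurable_fun setT v ->
  f = u %[ae mu] -> g = v %[ae mu] -> inner f g = \int[mu]_x (u x * v x).
Proof.
move=> mu' mv fu gv; apply: Rintegral_ae_eq.
- by apply: measurable_funM; exact: measurable_L2.
- exact: measurable_funM.
- by move: fu gv; apply: filterS2 => x + + _ => /(_ I) -> /(_ I) ->.
Qed.

Lemma innerC f g : inner f g = inner g f.
Proof. by rewrite /inner; under eq_Rintegral do rewrite mulrC. Qed.

Lemma innerDl f g h : inner (f + g) h = inner f h + inner g h.
Proof.
rewrite (innerE (measurable_funD (measurable_L2 f) (measurable_L2 g))
  (measurable_L2 h) (LspaceDE f g) (ae_eq_refl _ _ _)).
rewrite -RintegralD//; try exact: inner_integrable.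
by under eq_Rintegral do rewrite mulrDl.
Qed.

Lemma innerZl a f g : inner (a *: f) g = a * inner f g.
Proof.
rewrite (innerE (measurable_funM (measurable_cst a) (measurable_L2 f))
  (measurable_L2 g) (LspaceZE a f) (ae_eq_refl _ _ _)).
rewrite -RintegralZl//; last exact: inner_integrable.
by under eq_Rintegral do rewrite -mulrA.
Qed.

Lemma innerDr f g h : inner f (g + h) = inner f g + inner f h.
Proof. by rewrite innerC innerDl !(innerC f). Qed.

Lemma innerZr a f g : inner f (a *: g) = a * inner f g.
Proof. by rewrite innerC innerZl innerC. Qed.

Lemma inner0l f : inner 0 f = 0.
Proof. by rewrite -(scale0r 0) innerZl mul0r. Qed.

Lemma innerNl f g : inner (- f) g = - inner f g.
Proof. by rewrite -scaleN1r innerZl mulN1r. Qed.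

Lemma innerBl f g h : inner (f - g) h = inner f h - inner g h.
Proof. by rewrite innerDl innerNl. Qed.

Lemma innerNr f g : inner f (- g) = - inner f g.
Proof. by rewrite innerC innerNl innerC. Qed.

Lemma innerBr f g h : inner f (g - h) = inner f g - inner f h.
Proof. by rewrite innerDr innerNr. Qed.

Lemma inner_suml (I : Type) (r : seq I) (P : pred I) (F : I -> L2) g :
  inner (\sum_(i <- r | P i) F i) g = \sum_(i <- r | P i) inner (F i) g.
Proof.
elim/big_rec2: _ => [|i x y _ <-]; first exact: inner0l.
by rewrite innerDl.
Qed.

Lemma inner_sumr (I : Type) (r : seq I) (P : pred I) (F : I -> L2) g :
  inner g (\sum_(i <- r | P i) F i) = \sum_(i <- r | P i) inner g (F i).
Proof. by rewrite innerC inner_suml; apply: eq_bigr => i _; rewrite innerC. Qed.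

Lemma inner_ge0 f : 0 <= inner f f.
Proof. by apply: Rintegral_ge0 => x _; rewrite -expr2 sqr_ge0. Qed.

Definition nrm f : R := Num.sqrt (inner f f).

Lemma nrm_ge0 f : 0 <= nrm f.
Proof. exact: sqrtr_ge0. Qed.

Lemma nrm_sqr f : nrm f ^+ 2 = inner f f.
Proof. by rewrite sqr_sqrtr ?inner_ge0. Qed.

Lemma LnormE f : ('N[mu]_2[EFin \o (f : X -> R)] = (nrm f)%:E)%E.
Proof.
rewrite unlock /=.
have -> : (\int[mu]_x `|(f x)%:E| `^ 2 = (inner f f)%:E)%E.
  rewrite /inner /Rintegral fineK; last first.
    by apply: integrable_fin_num => //; exact: inner_integrable.
  apply: eq_integral => x _; rewrite /= powR_mulrn//.
  by rewrite real_normK ?num_real// expr2.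
by rewrite poweR_EFin powR12_sqrt// inner_ge0.
Qed.

Lemma nrm_eq0 f : nrm f = 0 -> f = 0.
Proof.
move=> f0; apply: Lspace_ext.
have /Lnorm_eq0_eq0 h : ('N[mu]_2[EFin \o (f : X -> R)] = 0)%E by rewrite LnormE f0.
have {}h : EFin \o (f : X -> R) = cst 0%E %[ae mu].
  by apply: h => //; apply/measurable_EFinP; exact: measurable_L2.
have h0 : ((0 : L2) : X -> R) = cst 0 %[ae mu] by exact: Lspace0E.
by apply: filterS2 h h0 => x + + _ => /(_ I)[] -> /(_ I) ->.
Qed.

Lemma inner_inj f g : (forall h, inner f h = inner g h) -> f = g.
Proof.
move=> fg; apply/eqP; rewrite -subr_eq0; apply/eqP/nrm_eq0.
by rewrite /nrm innerBl fg subrr sqrtr0.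
Qed.

Lemma inner_CS f g : `|inner f g| <= nrm f * nrm g.
Proof.
have [g0|g0] := eqVneq (inner g g) 0.
  by rewrite (nrm_eq0 (_ : nrm g = 0)) /nrm ?g0 ?sqrtr0// innerC inner0l normr0 mulr_ge0 ?sqrtr_ge0.
have gp : 0 < inner g g by rewrite lt_neqAle eq_sym g0 inner_ge0.
rewrite -sqrtrM ?inner_ge0// -sqrtr_sqr ler_wsqrtr//.
have := inner_ge0 (f - (inner f g / inner g g) *: g).
rewrite !(innerBl, innerBr, innerZl, innerZr) (innerC g f) => h.
rewrite -ler_pdivrMr//; move: h.
by rewrite divfK// -mulrA mulrC; lra.
Qed.

Lemma nrmZ a f : nrm (a *: f) = `|a| * nrm f.
Proof.
by rewrite /nrm innerZl innerZr mulrA -expr2 sqrtrM ?sqr_ge0// sqrtr_sqr.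
Qed.

Lemma nrm_triangle f g : nrm (f + g) <= nrm f + nrm g.
Proof.
rewrite -(@ler_pXn2r _ 2)// ?nnegrE ?addr_ge0 ?nrm_ge0//.
rewrite nrm_sqr !(innerDl, innerDr) (innerC g) sqrrD !nrm_sqr.
have := le_trans (ler_norm _) (inner_CS f g); lra.
Qed.

Lemma nrm_sum (I : Type) (r : seq I) (P : pred I) (F : I -> L2) :
  nrm (\sum_(i <- r | P i) F i) <= \sum_(i <- r | P i) nrm (F i).
Proof.
elim/big_rec2: _ => [|i x y _ h].
  by rewrite -(scale0r 0) nrmZ normr0 mul0r.
by apply: le_trans (nrm_triangle _ _) _; rewrite lerD2l.
Qed.

Lemma bounded_operatorP (A : L2 -> L2) :
  bounded_operator A <-> linear A /\ exists C, forall f, nrm (A f) <= C * nrm f.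
Proof.
split=> -[lA [C h]]; split => //; exists C => f.
  by have := h f; rewrite !LnormE -EFinM lee_fin.
by rewrite !LnormE -EFinM lee_fin.
Qed.

Section Koopman.
Variables (phi : R -> R).
Hypothesis mphi : measure_preserving mu phi.

Lemma inner_koopman f g : inner (koopman phi f) (koopman phi g) = inner f g.
Proof.
have mcomp h : measurable_fun [set: X] ((h : X -> R) \o phi).
  by apply: measurableT_comp; [exact: measurable_L2|case: mphi].
rewrite (innerE _ _ (koopmanE f mphi) (koopmanE g mphi))//.
case: (mphi) => mp pp; congr fine.
have mfg : measurable_fun setT (fun x : X => (f x * g x)%:E).
  by apply/measurable_EFinP; apply: measurable_funM; exact: measurable_L2.
have ifg : mu.-integrable (phi @^-1` setT) ((fun x : X => (f x * g x)%:E) \o phi).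
  rewrite preimage_setT; apply/(Lfun1_integrable mu ((fun x => f x * g x) \o phi)).
  by apply: (@Lfun2_mul_Lfun1 _ _ _ mu (f \o phi) (g \o phi));
    apply: measure_preserving_Lfun => //; exact: L2_Lfun.
have := integral_pushforward mp mfg ifg measurableT.
rewrite preimage_setT => <-; apply: eq_measure_integral => A mA _.
exact: pp.
Qed.

Lemma koopman_linear : linear (koopman phi : L2 -> L2).
Proof.
move=> a f g; apply: Lspace_ext.
have h1 := koopmanE (a *: f + g) mphi.
have h2 := measure_preserving_ae mphi (LspaceDE (a *: f) g).
have h3 := measure_preserving_ae mphi (LspaceZE a f).
have h4 := koopmanE f mphi; have h5 := koopmanE g mphi.
have h6 := LspaceDE (a *: koopman phi f) (koopman phi g).
have h7 := LspaceZE a (koopman phi f).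
apply: filterS2 (filterI h1 (filterI h2 h3)) (filterI (filterI h4 h5) (filterI h6 h7)).
move=> x [+ [+ +]] [[+ +] [+ +]] _.
by move=> /(_ I) -> /(_ I)/= -> /(_ I)/= -> /(_ I)/= e4 /(_ I)/= e5 /(_ I)/= -> /(_ I)/= ->;
  rewrite e4 e5.
Qed.

End Koopman.

Let mT := @chacon_measure_preserving R.
Let mTi := @chacon_inv_measure_preserving R.

Lemma koopmanZ_succ n f : koopmanZ (n + 1) f = koopman chacon (koopmanZ n f).
Proof.
case: n => [k|[|k]]; first by rewrite -[_ + 1]/(Posz (k + 1)) addn1.
  by rewrite /= koopman_invK.
by rewrite (_ : Negz k.+1 + 1 = Negz k); [rewrite /= koopman_invK|lia].
Qed.

Lemma koopmanZ_pred n f : koopmanZ (n - 1) f = koopman chacon_inv (koopmanZ n f).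
Proof. by rewrite -[in RHS](subrK 1 n) koopmanZ_succ koopmanK. Qed.

Lemma koopmanZD m n f : koopmanZ (m + n) f = koopmanZ m (koopmanZ n f).
Proof.
elim/int_ind: m => [|m IH|m IH]; first by rewrite add0r.
  by rewrite -addn1 PoszD addrAC !koopmanZ_succ IH.
by rewrite -addn1 PoszD opprD addrAC !koopmanZ_pred IH.
Qed.

Lemma koopmanZ_linear n : linear (koopmanZ n : L2 -> L2).
Proof.
have iter_linear (A : L2 -> L2) k : linear A -> linear (iter k A).
  by move=> lA a f g; elim: k => //= k ->; rewrite lA.
by case: n => k; apply: iter_linear; exact: koopman_linear.
Qed.

Lemma inner_koopmanZ n f g : inner (koopmanZ n f) (koopmanZ n g) = inner f g.
Proof.
by case: n => k /=; rewrite ?inner_koopman//; elim: k => //= k IH; rewrite inner_koopman.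
Qed.

Lemma inner_koopmanZ_adj n f g : inner (koopmanZ n f) g = inner f (koopmanZ (- n) g).
Proof. by rewrite -(inner_koopmanZ (- n)) -koopmanZD addNr. Qed.

Lemma nrm_koopmanZ n f : nrm (koopmanZ n f) = nrm f.
Proof. by rewrite /nrm inner_koopmanZ. Qed.

End Hilbert.

Section Indicators.
Context {R : realType}.
Local Notation mu := (@chacon_measure R).
Local Notation L2 := (L2 R).
Local Notation X := (measurableTypeR R).
Local Notation cls := (Lclass mu (lee1n 2)).
Implicit Types (f g : L2) (A B : set X) (u v : X -> R).

Lemma Lfun2P u : measurable_fun setT u -> mu.-integrable setT (EFin \o (fun x => u x ^+ 2)) ->
  u \in Lfun mu 2%:E.
Proof.
move=> mu' iu; apply/andP; split; rewrite inE//= /finite_norm unlock.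
apply: poweR_lty; case/integrableP: iu => _; apply: le_lt_trans.
rewrite le_eqVlt; apply/orP; left; apply/eqP; apply: eq_integral => x _.
by rewrite /= powR_mulrn// normrX.
Qed.

Lemma Lfun2_le u v : u \in Lfun mu 2%:E -> measurable_fun setT v ->
  (forall x, `|v x| <= `|u x|) -> v \in Lfun mu 2%:E.
Proof.
move=> uL mv vu; apply: Lfun2P => //.
apply: le_integrable (Lfun2_integrable_sqr uL) => //.
  by apply/measurable_EFinP; exact: measurable_funX.
by move=> x _; rewrite /= lee_fin !normrX lerXn2r ?nnegrE.
Qed.

Lemma Lclass_Lfun f u : f = u %[ae mu] -> u \in Lfun mu 2%:E -> f = cls u.
Proof. by move=> fu uL; apply: Lspace_ext; apply: ae_eq_trans fu _; exact/ae_eq_sym/LclassE. Qed.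

Lemma Lspace_sumE (J : Type) (r : seq J) (P : pred J) (F : J -> L2) (u : J -> X -> R) :
  (forall i, P i -> F i = u i %[ae mu]) ->
  \sum_(i <- r | P i) F i = (fun x => \sum_(i <- r | P i) u i x) %[ae mu].
Proof.
move=> Fu; elim: r => [|i r IH].
  have h : ((0 : L2) : X -> R) = cst 0 %[ae mu] by exact: Lspace0E.
  by rewrite big_nil; apply: filterS h => x + _ => /(_ I) ->; rewrite big_nil.
rewrite big_cons; case: ifP => Pi; last first.
  by apply: filterS IH => x + _ => /(_ I) ->; rewrite big_cons Pi.
have h := LspaceDE (F i) (\sum_(j <- r | P j) F j).
apply: filterS3 h (Fu i Pi) IH => x + + + _ => /(_ I) -> /(_ I)/= -> /(_ I)/= ->.
by rewrite big_cons Pi.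
Qed.

Definition indL A : L2 := cls (\1_A).

Lemma Lfun_indic A : measurable A -> (\1_A : X -> R) \in Lfun mu 2%:E.
Proof.
move=> mA; apply: Lfun2_le (Lfun_cst mu 1 2) _ _ => [|x].
  exact: measurable_indic.
by rewrite /= indicE normr1 ger0_norm// lern1 leq_b1.
Qed.

Lemma indLE A : measurable A -> indL A = \1_A %[ae mu].
Proof. by move=> mA; apply/LclassE/Lfun_indic. Qed.

Lemma inner_indL A B : measurable A -> measurable B ->
  inner (indL A) (indL B) = fine (mu (A `&` B)).
Proof.
move=> mA mB.
rewrite (innerE _ _ (indLE mA) (indLE mB)); try exact: measurable_indic.
rewrite /Rintegral -[in RHS](setIT (A `&` B)) -integral_indic//; last exact: measurableI.
by congr fine; apply: eq_integral => x _; rewrite indicI.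
Qed.

Lemma indLU A B : measurable A -> measurable B -> A `&` B = set0 ->
  indL (A `|` B) = indL A + indL B.
Proof.
move=> mA mB AB; apply: Lspace_ext.
have h1 := indLE (measurableU _ _ mA mB); have h2 := indLE mA; have h3 := indLE mB.
have h4 := LspaceDE (indL A) (indL B).
apply: filterS2 (filterI h1 h2) (filterI h3 h4) => x [+ +] [+ +] _.
move=> /(_ I) -> /(_ I) e2 /(_ I) e3 /(_ I) /= ->; rewrite e2 e3 !indicE in_setU.
have [xA|xA] := boolP (x \in A); have [xB|xB] := boolP (x \in B); rewrite ?addr0 ?add0r//.
by have : (A `&` B) x by [split; exact: set_mem]; rewrite AB.
Qed.

Lemma indL0 : indL set0 = 0.
Proof.
by apply/nrm_eq0; rewrite /nrm inner_indL// set0I measure0 sqrtr0.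
Qed.

Lemma indL_bigsetU (F : nat -> set X) n (P : pred nat) : (forall i, measurable (F i)) ->
  (forall i j, (i < n)%N -> (j < n)%N -> F i `&` F j !=set0 -> i = j) ->
  indL (\big[setU/set0]_(i < n | P i) F i) = \sum_(i < n | P i) indL (F i).
Proof.
move=> mF; elim: n => [|n IH] tF; first by rewrite !big_ord0 indL0.
rewrite big_mkcond [in RHS]big_mkcond !big_ord_recr/= -big_mkcond -[in RHS]big_mkcond/=.
case: ifP => Pn; last first.
  by rewrite setU0 addr0 IH// => i j ? ?; apply: tF; exact: ltnW.
rewrite indLU ?IH//.
- by move=> i j ? ?; apply: tF; exact: ltnW.
- exact: bigsetU_measurable.
- apply/seteqP; split => x //= -[].
  rewrite big_mkcond -(bigcup_mkord n (fun i => if P i then F i else set0)).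
  move=> [i /= ni]; case: ifP => // Pi Fi Fn.
  have := tF i n _ _ (ex_intro _ x (conj Fi Fn)); move=> /(_ (ltnW ni) (leqnn _)) e.
  by move: ni; rewrite e ltnn.
Qed.

Lemma nrm_indLB A B e : measurable A -> measurable B -> A `<=` B -> 0 <= e ->
  (mu (B `\` A) <= (e ^+ 2)%:E)%E -> nrm (indL B - indL A) <= e.
Proof.
move=> mA mB AB e0 h.
have -> : indL B = indL A + indL (B `\` A).
  by rewrite -indLU ?setDIK ?setDUK//; exact: measurableD.
have mD : measurable (B `\` A) by exact: measurableD.
rewrite addrC addKr -(@ler_pXn2r _ 2)// ?nnegrE ?nrm_ge0// nrm_sqr inner_indL// setIid.
by rewrite -lee_fin fineK// fin_num_measure.
Qed.

Definition lev n i : L2 := indL (level n i).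

Lemma measurable_level n i : measurable (level n i : set X).
Proof. exact: measurable_itv. Qed.

End Indicators.

(** * Density of the levels *)

Section Density.
Context {R : realType}.
Local Notation mu := (@chacon_measure R).
Local Notation L2 := (L2 R).
Local Notation X := (measurableTypeR R).
Local Notation cls := (Lclass mu (lee1n 2)).
Implicit Types (f g : L2) (A B : set X) (u v : X -> R).

Variable Pr : L2 -> Prop.
Hypothesis Pr_lin : forall a f g, Pr f -> Pr g -> Pr (a *: f + g).
Hypothesis Pr_lim : forall f, (forall e, 0 < e -> exists2 g, Pr g & nrm (f - g) <= e) -> Pr f.
Hypothesis Pr_lev : forall n i, (i < height n)%N -> Pr (lev n i).

Let Pr0 : Pr 0.
Proof.
have h := @Pr_lev 0 0 isT.
by have := Pr_lin (-1) h h; rewrite scaleN1r addNr.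
Qed.

Let Pr_sum (J : Type) (r : seq J) (P : pred J) (F : J -> L2) :
  (forall i, P i -> Pr (F i)) -> Pr (\sum_(i <- r | P i) F i).
Proof.
by move=> h; elim/big_rec: _ => // i x Pi hx; rewrite -[F i]scale1r; apply: Pr_lin => //; exact: h.
Qed.

(** An open ray is approximated from inside by the levels of Tower [n] that it
contains: it misses at most one level, and the complement of the tower. *)
Let Pr_ray (r : R) : Pr (indL `]r, +oo[).
Proof.
apply: Pr_lim => e e0.
have [|n we] := @width_small R (e ^+ 2 / 2); first by rewrite divr_gt0 ?exprn_gt0.
pose P i := r < @base R n i.
pose U : set X := \big[setU/set0]_(i < height n | P i) level n i.
have lE : indL U = \sum_(i < height n | P i) lev n i.
  apply: indL_bigsetU => [i|i j ih jh [x [xi xj]]]; first exact: measurable_level.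
  exact: level_inj ih jh xi xj.
have UP x : U x <-> exists i, [/\ (i < height n)%N, P i & level n i x].
  rewrite /U big_mkcond -(bigcup_mkord _ (fun i => if P i then @level R n i else set0)).
  split=> [[i /= ih]|[i [ih Pi xi]]]; last by exists i => //=; rewrite Pi.
  by case: ifP => // Pi xi; exists i.
have mU : measurable U by apply: bigsetU_measurable => i _; exact: measurable_level.
exists (indL U); first by rewrite lE; apply: Pr_sum => i _; exact: Pr_lev.
apply: nrm_indLB => //; [|exact: ltW|].
  by move=> x /UP[i [_ ri]]; rewrite levelE /= in_itv/= andbT => /andP[/(lt_le_trans ri)].
rewrite /chacon_measure/= /mrestr.
pose I1 : set X := `[r, r + width n[%classic.
pose I2 : set X := `[(height n)%:R * width n, 1[%classic.
have mI1 : measurable I1 by exact: measurable_itv.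
have mI2 : measurable I2 by exact: measurable_itv.
apply: (@le_trans _ _ (lebesgue_measure (I1 `|` I2))).
  rewrite le_measure ?inE//.
  - by apply: measurableI => //; exact: measurableD.
  - exact: measurableU.
  move=> x [[/= + Ux]]; rewrite !in_itv/= andbT => rx /andP[x0 x1].
  have [xh|hx] := ltP x ((height n)%:R * width n); last first.
    by right; rewrite /I2/= in_itv/= hx.
  left; rewrite /I1/= in_itv/= (ltW rx)/=.
  have [|i ih xi] := @level_cover R n x; first by rewrite x0.
  have := xi; rewrite levelE => /andP[x2 x3].
  have [ri|ir] := ltP r (@base R n i); first by case: Ux; apply/UP; exists i.
  by apply: lt_le_trans x3 _; rewrite lerD2r.
apply: (@le_trans _ _ (lebesgue_measure I1 + lebesgue_measure I2)%E).
  exact: measureU2.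
have h1 : (height n)%:R * width n < 1 :> R.
  by rewrite height_width ltrBlDr ltrDl invr_gt0 exprn_gt0.
have -> : lebesgue_measure I1 = (width n)%:E :> \bar R.
  by rewrite lebesgue_measure_itv/= lte_fin ltrDl width_gt0 -EFinB addrAC subrr add0r.
have -> : lebesgue_measure I2 = (1 - (height n)%:R * width n)%:E :> \bar R.
  by rewrite lebesgue_measure_itv/= lte_fin h1 -EFinB.
rewrite -EFinD lee_fin.
have : 1 - (height n)%:R * width n <= width n :> R.
  rewrite height_width opprB addrCA subrr addr0.
  by rewrite /width ler_peMl ?invr_ge0 ?exprn_ge0//; lra.
by lra.
Qed.

Let PrT : Pr (indL setT).
Proof.
apply: Pr_lim => e e0; exists (indL `](-1), +oo[%classic) => //.
apply: nrm_indLB => //; first exact: ltW.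
rewrite /chacon_measure/= /mrestr (_ : _ `&` _ = set0).
  by rewrite measure0 lee_fin sqr_ge0.
apply/seteqP; split => x //= [[_]]; rewrite !in_itv/= => h /andP[x0 _].
by apply: h; rewrite andbT (lt_le_trans _ x0)// ltrN10.
Qed.

Let Pr_bigcup (F : (set X)^nat) : (forall n, measurable (F n)) ->
  trivIset setT F -> (forall n, Pr (indL (F n))) -> Pr (indL (\bigcup_k F k)).
Proof.
move=> mF tF PF; apply: Pr_lim => e e0.
pose G n : set X := \big[setU/set0]_(k < n) F k.
have mG n : measurable (G n) by exact: bigsetU_measurable.
have mUF : measurable (\bigcup_k F k) by exact: bigcup_measurable.
have GE n : G n = \bigcup_(k < n) F k by rewrite bigcup_mkord.
pose D n := (\bigcup_k F k) `\` G n.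
have mD n : measurable (D n) by exact: measurableD.
have D0 : \bigcap_n D n = set0.
  apply/seteqP; split => // x h; have [[k _ Fk] _] := h 0%N I.
  by have [_] := h k.+1 I; apply; rewrite GE; exists k => //=.
have /fine_cvg : (mu \o D) @ \oo --> 0%:E.
  have -> : 0%:E = mu (\bigcap_n D n) by rewrite D0 measure0.
  apply: nonincreasing_cvg_mu => //.
  - by rewrite ltey_eq fin_num_measure.
  - exact: bigcapT_measurable.
  - move=> m n mn; rewrite subsetEset; apply: setDS; rewrite !GE => x [k /= km Fk].
    by exists k => //=; exact: leq_trans mn.
have e20 : 0 < e ^+ 2 by rewrite exprn_gt0.
move=> /cvgrPdist_le/(_ _ e20)[n _ /(_ n)/=]; rewrite leqnn => /(_ isT).
rewrite sub0r normrN ger0_norm ?fine_ge0// => h.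
exists (indL (G n)).
  rewrite (indL_bigsetU xpredT mF); last first.
    by move=> i j _ _; exact: tF.
  exact: Pr_sum.
apply: nrm_indLB => //; [by rewrite GE => x [k _ Fk]; exists k|exact: ltW|].
by rewrite -lee_fin fineK ?fin_num_measure// in h.
Qed.

Let Pr_indL A : measurable A -> Pr (indL A).
Proof.
have E : @measurable _ X = <<s RGenOInfty.G (R := R) >>.
  exact: RGenOInfty.measurableE.
rewrite [X in X A]E; apply: (dynkin_induction (P := fun A => Pr (indL A)) E) => //.
- move=> _ _ [x ->] [y ->]; exists (Num.max x y).
  by apply/seteqP; split => z /=; rewrite !in_itv/= !andbT gt_max;
    [move=> [-> ->]|move=> /andP[-> ->]].
- by move=> _ [x ->]; exact: Pr_ray.
- move=> S mS PS; have : indL setT = indL S + indL (~` S).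
    by rewrite -indLU ?setUv ?setICr//; exact: measurableC.
  by move=> /esym/(canRL (addKr _)) ->; rewrite -scaleN1r; exact: Pr_lin.
Qed.

Let Pr_ge0 u : u \in Lfun mu 2%:E -> (forall x, 0 <= u x) -> Pr (cls u).
Proof.
move=> uL u0; have mu' : measurable_fun setT u by have /andP[/set_mem] := uL.
have mEu : measurable_fun setT (EFin \o u) by exact/measurable_EFinP.
have Eu0 x : setT x -> (0 <= (EFin \o u) x)%E by rewrite lee_fin.
pose g n : {nnsfun X >-> R} := nnsfun_approx measurableT mEu n.
have gu n x : g n x <= u x.
  by rewrite -lee_fin /g nnsfun_approxE; exact: (le_approx n Eu0).
have g0 n x : 0 <= g n x by [].
have mg n : measurable_fun setT (g n : X -> R) by [].
have gL n : (g n : X -> R) \in Lfun mu 2%:E.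
  by apply: Lfun2_le uL _ _ => // x; rewrite !ger0_norm.
have Pg n : Pr (cls (g n)).
  suff -> : cls (g n) = \sum_(y <- finmap.enum_fset (fset_set (range (g n))))
      y *: indL (g n @^-1` [set y]).
    apply: Pr_sum => y _; rewrite -[_ *: _]addr0; apply: Pr_lin => //.
    by apply: Pr_indL; exact: measurable_sfunP.
  apply/esym/Lclass_Lfun => //.
  have h y : y *: indL (g n @^-1` [set y]) = (fun x => y * \1_(g n @^-1` [set y]) x) %[ae mu].
    have h1 := LspaceZE y (indL (g n @^-1` [set y])).
    have h2 : indL (g n @^-1` [set y]) = \1_(g n @^-1` [set y]) %[ae mu].
      by apply: indLE; exact: measurable_sfunP.
    by apply: filterS2 h1 h2 => x + + _ => /(_ I) -> /(_ I) ->.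
  have := @Lspace_sumE R _ (finmap.enum_fset (fset_set (range (g n)))) xpredT _ _ (fun y _ => h y).
  apply: filterS => x + _ => /(_ I) ->.
  by rewrite [RHS]fimfunE fsbig_finite.
apply: Pr_lim => e e0.
have e20 : 0 < e ^+ 2 by rewrite exprn_gt0.
have H : (\int[mu]_x ((u x - g n x) ^+ 2)%:E)%E @[n --> \oo] -->
    (\int[mu]_x (cst 0 x))%E.
  apply: (@dominated_cvg _ _ _ mu setT measurableT
     (fun n x => ((u x - g n x) ^+ 2)%:E) (cst 0%E) (fun x => (u x ^+ 2)%:E)) => //.
  - move=> n; apply/measurable_EFinP; apply: measurable_funX.
    exact: measurable_funB.
  - move=> x _; apply: cvg_EFin; first exact: nearW.
    rewrite /=; have /fine_cvg h := cvg_nnsfun_approx measurableT mEu Eu0 (I : setT x).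
    rewrite (_ : 0 = (u x - u x) ^+ 2); last by rewrite subrr expr0n.
    have hs : u x - g n x @[n --> \oo] --> u x - u x.
      by apply: cvgB; [exact: cvg_cst|exact: h].
    exact: (cvg_comp _ _ hs (@exprn_continuous _ 2 _)).
  - exact: Lfun2_integrable_sqr.
  - move=> n x _; rewrite /= ger0_norm ?sqr_ge0// lee_fin.
    have h1 := gu n x; have h2 := g0 n x.
    by rewrite ler_pXn2r ?nnegrE ?subr_ge0// lerBlDr lerDl.
move: H; rewrite integral0 => /fine_cvg/cvgrPdist_le/(_ _ e20)[n _ /(_ n)/=].
rewrite leqnn => /(_ isT); rewrite sub0r normrN => h.
exists (cls (g n)) => //.
rewrite -(@ler_pXn2r _ 2)// ?nnegrE ?nrm_ge0 ?(ltW e0)// nrm_sqr.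
have ue : cls u - cls (g n) = (fun x => u x - g n x) %[ae mu].
  have h1 := LspaceDE (cls u) (- cls (g n)); have h2 := LspaceNE (cls (g n)).
  have h3 : cls u = u %[ae mu] by exact: LclassE.
  have h4 : cls (g n) = g n %[ae mu] by exact: LclassE.
  apply: filterS2 (filterI h1 h2) (filterI h3 h4) => x [+ +] [+ +] _.
  by move=> /(_ I) -> /(_ I)/= e2 /(_ I) e3 /(_ I) e4; rewrite /= e2/= e3 e4.
have mug : measurable_fun setT (fun x : X => u x - g n x) by exact: measurable_funB.
rewrite (innerE mug mug ue ue); apply: (le_trans _ h).
by under eq_Rintegral do rewrite -expr2; exact: ler_norm.
Qed.

(** To prove a property of all elements of L2 that is stable under linear
combinations and norm limits, it suffices to prove it for the levels. *)
Lemma L2_level_ind f : Pr f.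
Proof.
pose p (x : X) := Num.max (f x) 0; pose n (x : X) := Num.max (- f x) 0.
have mf := measurable_L2 f.
have pL : p \in Lfun mu 2%:E.
  apply: Lfun2_le (L2_Lfun f) _ _ => [|x]; first exact: measurable_funrpos.
  by rewrite /p; case: (lerP (f x) 0) => h; rewrite ?normr0.
have nL : n \in Lfun mu 2%:E.
  apply: Lfun2_le (L2_Lfun f) _ _ => [|x]; first exact: measurable_funrneg.
  by rewrite /n; case: (lerP (- f x) 0) => h; rewrite ?normr0 ?normrN.
have -> : f = -1 *: cls n + cls p.
  apply: Lspace_ext.
  have h1 := LspaceDE (-1 *: cls n) (cls p); have h2 := LspaceZE (-1) (cls n).
  have h3 : cls n = n %[ae mu] by exact: LclassE.
  have h4 : cls p = p %[ae mu] by exact: LclassE.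
  apply: filterS2 (filterI h1 h2) (filterI h3 h4) => x [+ +] [+ +] _.
  move=> /(_ I) -> /(_ I)/= e2 /(_ I) e3 /(_ I) e4; rewrite /= e2/= e3 e4 /n /p.
  by case: (lerP (f x) 0); case: (lerP (- f x) 0) => *; lra.
by apply: Pr_lin; apply: Pr_ge0 => // x; rewrite /n /p le_max lexx orbT.
Qed.

End Density.

(** * Correlations of the levels of a tower *)

Section Levels.
Context {R : realType}.
Local Notation mu := (@chacon_measure R).
Local Notation L2 := (L2 R).
Local Notation X := (measurableTypeR R).
Local Notation lev := (@lev R).
Implicit Types (f g : L2).

Definition corr f g (k : int) : R := inner (koopmanZ (- k) f) g.

Lemma corrE f g k : corr f g k = inner f (koopmanZ k g).
Proof. by rewrite /corr inner_koopmanZ_adj opprK. Qed.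

Lemma corrC f g k : corr f g (- k) = corr g f k.
Proof. by rewrite corrE innerC. Qed.

Lemma corr_le f g k : `|corr f g k| <= nrm f * nrm g.
Proof. by rewrite -(nrm_koopmanZ (- k) f); exact: inner_CS. Qed.

Lemma corr_suml (J : Type) (r : seq J) (P : pred J) (F : J -> L2) g k :
  corr (\sum_(i <- r | P i) F i) g k = \sum_(i <- r | P i) corr (F i) g k.
Proof. by rewrite corrE inner_suml; apply: eq_bigr => i _; rewrite corrE. Qed.

Lemma corr_sumr (J : Type) (r : seq J) (P : pred J) (F : J -> L2) g k :
  corr g (\sum_(i <- r | P i) F i) k = \sum_(i <- r | P i) corr g (F i) k.
Proof. exact: inner_sumr. Qed.

Lemma level_measure n i : (i < height n)%N -> mu (level n i) = (width n)%:E.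
Proof.
move=> ih; rewrite /chacon_measure/= /mrestr (setIidl (_ : level n i `<=` _)).
  by rewrite lebesgue_measure_itv/= lte_fin ltrDl width_gt0 -EFinB addrAC subrr add0r.
move=> x /(level_sub ih) /andP[x0 x1]; rewrite /= in_itv/= x0 (lt_le_trans x1)//.
by rewrite height_width gerBl invr_ge0 exprn_ge0.
Qed.

Lemma inner_lev n i j : (i < height n)%N -> (j < height n)%N ->
  inner (lev n i) (lev n j) = (i == j)%:R * width n.
Proof.
move=> ih jh; rewrite inner_indL; try exact: measurable_level.
case: eqP => [->|ij]; first by rewrite setIid mul1r level_measure.
rewrite (_ : _ `&` _ = set0) ?measure0 ?mul0r//.
by apply/seteqP; split => // x [xi xj]; case: ij; exact: level_inj ih jh xi xj.
Qed.

Lemma nrm_lev n i : (i < height n)%N -> nrm (lev n i) = Num.sqrt (width n).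
Proof. by move=> ih; rewrite /nrm inner_lev// eqxx mul1r. Qed.

Lemma lev_split n i : (i < height n)%N ->
  lev n i = \sum_(c < 3) lev n.+1 (c * height n + (c == 2 :> nat) + i)%N.
Proof.
move=> ih.
pose F c : set X := level n.+1 (c * height n + (c == 2) + i)%N.
rewrite -[RHS](@indL_bigsetU R F 3 xpredT); first last.
- move=> a b a3 b3 [x [xa xb]].
  have lt c : (c < 3)%N -> (c * height n + (c == 2) + i < height n.+1)%N.
    by case: c => [|[|[|//]]] _ /=; lia.
  have := level_inj (lt _ a3) (lt _ b3) xa xb; move: a3 b3.
  by case: a {xa} => [|[|[|//]]]; case: b {xb} => [|[|[|//]]] => //= _ _; lia.
- by move=> c; exact: measurable_level.
congr indL; rewrite -bigcup_mkord; apply/seteqP; split => x.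
  by move=> /(level_split ih)[c xc]; exists c => //=; exact: ltn_ord.
move=> [c /= c3]; rewrite /F -[c]/(nat_of_ord (Ordinal c3)) !levelE base_copy//=.
move=> /andP[x1 x2]; have wS := @widthS R n; have w0 := @width_gt0 R n.+1.
have c0 : 0 <= c%:R * width n.+1 :> R by rewrite mulr_ge0// ltW.
have c2 : c%:R * width n.+1 <= 2 * width n.+1 :> R.
  by apply: ler_wpM2r; [exact: ltW|rewrite (ler_nat _ c 2) -ltnS].
by apply/andP; split; lra.
Qed.

(** The copies of Tower [n] in Tower [n + d] are numbered in the order of the levels,
which is what makes their ternary digits count the spacers. *)
Lemma lev_pos n d i : (i < height n)%N ->
  lev n i = \sum_(y < 3 ^ d) lev (n + d) (pos n y + i)%N.
Proof.
elim: d n i => [|d IH] n i ih.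
  by rewrite expn0 big_ord1 addn0 /pos mul0n spacers0.
rewrite lev_split// expnS (sum_base3 _ (fun y => lev (n + d.+1) (pos n y + i)%N)).
rewrite !big_ord_recr/= big_ord0 add0r.
have lt c : (c < 3)%N -> (c * height n + (c == 2) + i < height n.+1)%N.
  by case: c => [|[|[|//]]] _ /=; lia.
rewrite !(IH n.+1) ?(lt 0%N) ?(lt 1%N) ?(lt 2%N)//.
rewrite -!big_split addSnnS; apply: eq_bigr => y _.
have e c : (c < 3)%N -> (pos n.+1 y + (c * height n + (c == 2) + i))%N = (pos n (3 * y + c) + i)%N.
  by move=> c3; rewrite pos3// addnA.
by rewrite (e 0%N)// (e 1%N)// (e 2%N)// addn0 addn1 addn2.
Qed.

Lemma koopman_lev n t : (t.+1 < height n)%N -> koopman chacon (lev n t.+1) = lev n t.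
Proof.
move=> th; apply: Lspace_ext.
have mT := @chacon_measure_preserving R.
have h1 := koopmanE (lev n t.+1) mT.
have h2 := measure_preserving_ae mT (indLE (measurable_level n t.+1)).
have h3 := indLE (@measurable_level R n t).
have h4 := @ae_chacon_measure R (fun x => 0 < x < 1) (fun x => id).
apply: filterS2 (filterI h1 h2) (filterI h3 h4) => x [+ +] [+ x01] _.
move=> /(_ I) -> /(_ I) /= e2 /(_ I) ->; rewrite -[LHS]/(lev n t.+1 (chacon x)) e2.
rewrite !indicE; congr ((_ : bool)%:R); apply/idP/idP; rewrite !inE => h.
  have [|y xy] := @chacon_step_ex R x; first by case/andP: x01 => /ltW-> ->.
  rewrite (chaconE xy) in h.
  have st : chacon_step (y - base n t.+1 + base n t) y.
    exists n, t; split => //; last by ring.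
    by move: h; rewrite !levelE => /andP[y1 y2]; apply/andP; split; lra.
  rewrite (chacon_step_inj xy st).
  by move: h; rewrite !levelE => /andP[y1 y2]; apply/andP; split; lra.
have st : chacon_step x (x - base n t + base n t.+1) by exists n, t.
by rewrite (chaconE st); exact: level_next.
Qed.

Lemma koopmanZ_lev n t k : (t + k < height n)%N ->
  koopmanZ k%:Z (lev n (t + k)%N) = lev n t.
Proof.
elim: k t => [|k IH] t h; first by rewrite addn0.
rewrite addnS in h *; rewrite -[koopmanZ _ _]/(iter k.+1 _ _) iterSr koopman_lev//.
by apply: IH; exact: ltnW.
Qed.

(** Inside Tower [n + d] the map is a shift of the levels; the error is due to the
returns that enter the tower from its base within the last [k] steps. *)
Lemma corr_lev_pos n d i i' (k : nat) : (i < height n)%N -> (i' < height n)%N ->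
  `|corr (lev n i) (lev n i') k - width (n + d) *
    \sum_(y < 3 ^ d) \sum_(y' < 3 ^ d) (pos n y + i + k == pos n y' + i')%N%:R|
  <= k%:R * Num.sqrt (width (n + d)).
Proof.
move=> ih ih'; set w := width _.
have pl y : (y < 3 ^ d)%N -> forall a, (a < height n)%N -> (pos n y + a < height (n + d))%N.
  by move=> yd a ah; exact: pos_lt.
rewrite (lev_pos d ih') corr_sumr exchange_big/= mulr_sumr -sumrB.
apply: le_trans (ler_norm_sum _ _ _) _.
apply: (@le_trans _ _ (\sum_(y' < 3 ^ d) (y' < k)%:R * Num.sqrt w)); last first.
  rewrite -mulr_suml ler_wpM2r ?sqrtr_ge0// -natr_sum ler_nat.
  rewrite (_ : (\sum_(_ < _) _)%N = minn (3 ^ d) k) ?geq_minr//.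
  elim: (3 ^ d)%N => [|m IH]; first by rewrite big_ord0 min0n.
  by rewrite big_ord_recr/= IH; lia.
apply: ler_sum => y' _; have y'd := pl _ (ltn_ord y') _ ih'.
have [kt|tk] := leqP k (pos n y' + i').
  have e : koopmanZ k (lev (n + d) (pos n y' + i')%N) = lev (n + d) (pos n y' + i' - k)%N.
    by rewrite -{1}(subnK kt) koopmanZ_lev ?subnK.
  rewrite corrE e.
  rewrite (lev_pos d ih) inner_suml mulr_sumr -sumrB big1 ?normr0; last first.
    move=> y _; rewrite inner_lev; [|exact: pl|lia].
    rewrite mulrC (_ : (_ == _)%N = (pos n y + i + k == pos n y' + i')%N) ?subrr//.
    by apply/eqP/eqP; lia.
  by rewrite mulr_ge0 ?sqrtr_ge0.
have yk : (y' < k)%N by move: tk; rewrite /pos; have := height_gt0 n; nia.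
rewrite yk mul1r big1 ?mulr0 ?subr0; last by move=> y _; rewrite gtn_eqF//; lia.
apply: le_trans (corr_le _ _ _) _; rewrite [X in _ * X]nrm_lev// ler_piMl ?sqrtr_ge0//.
rewrite nrm_lev// -sqrtr1 ler_wsqrtr// /width ler_pdivrMr ?exprn_gt0// mul1r.
have : 1 <= 3 ^+ n :> R by rewrite exprn_ege1// ler1n.
by rewrite exprS; lra.
Qed.

Lemma count_return n i i' (k M y D : nat) : (i < height n)%N -> (i' < height n)%N ->
  (k < M)%N -> (y + M <= D)%N ->
  \sum_(y' < D) (pos n y + i + k == pos n y' + i')%N%:R =
  \sum_(m < M) (k + i == i' + m * height n + spacers m y)%N%:R :> R.
Proof.
move=> ih ih' kM yM.
pose a y' : R := (pos n y + i + k == pos n y' + i')%N%:R.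
rewrite -(big_mkord xpredT a) (big_cat_nat (n := y)) ?leq0n//=; last lia.
rewrite (big_cat_nat (n := (y + M)%N) (m := y))//=; last lia.
rewrite big1_seq ?add0r; last first.
  move=> z; rewrite mem_index_iota => /= zy; rewrite /a.
  have := @pos_gap n z y; case: eqP => //; lia.
rewrite [X in _ + X]big1_seq ?addr0; last first.
  move=> z; rewrite mem_index_iota /a => /= /andP[yz _].
  have -> : (z = y + (z - y))%N by lia.
  rewrite posD; have : (M * height n <= (z - y) * height n)%N by rewrite leq_mul2r; lia.
  have : (k.+1 * height n <= M * height n)%N by rewrite leq_mul2r kM orbT.
  have : (k <= k * height n)%N by rewrite leq_pmulr ?height_gt0.
  by rewrite mulSn => *; rewrite ltn_eqF//; lia.
rewrite -[X in index_iota X _](add0n y) big_addn addKn big_mkord; apply: eq_bigr => m _.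
by rewrite /a (addnC m y) posD; congr ((_ : bool)%:R); apply/eqP/eqP; lia.
Qed.

Lemma eq_limit_le (a b : R) (u v : nat -> R) : u @ \oo --> b -> v @ \oo --> 0 ->
  (forall n, `|a - u n| <= v n) -> a = b.
Proof.
move=> ub v0 h; suff ua : u @ \oo --> a by exact: cvg_unique ua ub.
apply/cvgrPdist_le => e e0.
move/cvgrPdist_le/(_ _ e0): v0; apply: filterS => n; rewrite sub0r normrN => vn.
by apply: le_trans (h n) (le_trans (ler_norm _) vn).
Qed.

Lemma cvg_sum_ord M (u : nat -> nat -> R) (l : nat -> R) :
  (forall m, u m @ \oo --> l m) ->
  \sum_(m < M) u m d @[d --> \oo] --> \sum_(m < M) l m.
Proof.
move=> h; elim: M => [|M IH].
  by rewrite big_ord0; under eq_fun do rewrite big_ord0; exact: cvg_cst.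
rewrite big_ord_recr/=; under eq_fun do rewrite big_ord_recr/=.
exact: cvgD.
Qed.

Lemma sum_bool_le1 (D : nat) (P : pred nat) :
  (forall y y', (y < D)%N -> (y' < D)%N -> P y -> P y' -> y = y') ->
  \sum_(y < D) (P y)%:R <= 1 :> R.
Proof.
move=> uP; have [/existsP[y Py]|/existsPn nP] := boolP [exists y : 'I_D, P y].
  rewrite (bigD1 y)//= Py big1 ?addr0// => z zy.
  case Pz : (P z) => //.
  by move: zy; rewrite (_ : z = y) ?eqxx//; apply/val_inj; exact: (uP _ _ (ltn_ord z) (ltn_ord y) Pz Py).
by rewrite big1 ?ler01// => y _; rewrite (negbTE (nP y)).
Qed.

(** Only for the last [M] copies can the [k] steps leave the high tower. *)
Lemma count_return_approx n i i' (k M D : nat) :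
  (i < height n)%N -> (i' < height n)%N -> (k < M)%N ->
  `|\sum_(y < D) \sum_(y' < D) (pos n y + i + k == pos n y' + i')%N%:R
    - \sum_(y < D) \sum_(m < M) (k + i == i' + m * height n + spacers m y)%N%:R|
  <= M%:R :> R.
Proof.
move=> ih ih' kM; rewrite -sumrB; apply: le_trans (ler_norm_sum _ _ _) _.
apply: (@le_trans _ _ (\sum_(y < D) (D < y + M)%N%:R)); last first.
  rewrite -natr_sum ler_nat; apply: leq_trans (@count_near_end D M).
  by rewrite [leqRHS]big_mkcond; apply: leq_sum => y _; case: ltnP => // /ltnW ->.
apply: ler_sum => y _; case: ltnP => yM; last first.
  by rewrite (count_return ih ih' kM yM) subrr normr0.
have h1 : 0 <= \sum_(y' < D) (pos n y + i + k == pos n y' + i')%N%:R :> R.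
  by apply: sumr_ge0.
have h2 : 0 <= \sum_(m < M) (k + i == i' + m * height n + spacers m y)%N%:R :> R.
  by apply: sumr_ge0.
have h3 : \sum_(y' < D) (pos n y + i + k == pos n y' + i')%N%:R <= 1 :> R.
  apply: (sum_bool_le1 (P := fun y' => (pos n y + i + k == pos n y' + i')%N)).
  move=> z z' _ _ /eqP e /eqP e'; have := pos_inj ih' ih' (etrans (esym e) e').
  by case.
have h4 : \sum_(m < M) (k + i == i' + m * height n + spacers m y)%N%:R <= 1 :> R.
  apply: (sum_bool_le1 (P := fun m => (k + i == i' + m * height n + spacers m y)%N)).
  move=> m m' _ _ /eqP e /eqP e'.
  have := @pos_inj n (y + m) (y + m') i' i' ih' ih'; rewrite !posD => h.
  have [|e1 _] := h; last exact: (@addnI y).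
  by lia.
by rewrite -[true%:R]/1 ler_norml; apply/andP; split; lra.
Qed.

Section Mean.
Variable lambda : probability Gamma R.
Hypothesis lambda_haar : haar lambda.
Local Notation mean := (mean lambda).

(** Between the levels [i] and [i'] of Tower [n], [k] steps amount to [m] returns
to the base with [k + i - i' - m h_n] spacers crossed on the way, and the number
of spacers crossed in [m] returns is distributed along [P_m]. *)
Lemma corr_lev n i i' (k M : nat) : (i < height n)%N -> (i' < height n)%N ->
  (k < M)%N -> corr (lev n i) (lev n i') k =
  width n * \sum_(m < M) mean m (fun j => (k + i == i' + m * height n + j)%N%:R).
Proof.
move=> ih ih' kM.
pose F m j : R := (k + i == i' + m * height n + j)%N%:R.
have c : width n * \sum_(m < M) (\sum_(y < 3 ^ d) F m (spacers m y)) / 3 ^+ d @[d --> \oo] -->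
    width n * \sum_(m < M) mean m (F m).
  apply: cvgM; first exact: cvg_cst.
  apply: (@cvg_sum_ord M (fun m d => (\sum_(y < 3 ^ d) F m (spacers m y)) / 3 ^+ d)
    (fun m => mean m (F m))) => m.
  exact: mean_cvg.
pose v d : R := k%:R * Num.sqrt (width (n + d)) + width n * M%:R / 3 ^+ d.
apply: (eq_limit_le c (v := v)) => [|d].
  have w0 d : width (n + d) = width n / 3 ^+ d :> R.
    by rewrite /width -addSn exprD invfM mulrA.
  rewrite (_ : 0 = k%:R * Num.sqrt 0 + 0); last by rewrite sqrtr0 mulr0 addr0.
  apply: cvgD; last exact: cvg_div_exp3.
  apply: cvgM; first exact: cvg_cst.
  have hw : (fun d => width (n + d)) @ \oo --> (0 : R).
    by rewrite (funext w0); exact: cvg_div_exp3.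
  exact: (cvg_comp _ _ hw (@sqrt_continuous R 0)).
have h1 := @corr_lev_pos n d i i' k ih ih'.
have h2 := @count_return_approx n i i' k M (3 ^ d) ih ih' kM.
have wE : width (n + d) = width n / 3 ^+ d :> R.
  by rewrite /width -addSn exprD invfM mulrA.
set S := (X in _ * X) in h1.
rewrite -/S in h2.
have -> : width n * \sum_(m < M) (\sum_(y < 3 ^ d) F m (spacers m y)) / 3 ^+ d =
  width (n + d) * \sum_(y < 3 ^ d) \sum_(m < M) F m (spacers m y).
  by rewrite -mulr_suml exchange_big/= wE mulrA mulrAC.
set S' := (X in `|_ - width _ * X|).
rewrite (_ : corr _ _ _ - _ = (corr (lev n i) (lev n i') k - width (n + d) * S)
  + width (n + d) * (S - S')); last by ring.
apply: le_trans (ler_normD _ _) (lerD h1 _).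
rewrite normrM (ger0_norm (ltW (width_gt0 _))) [leRHS]mulrAC -wE.
by apply: ler_wpM2l => //; exact/ltW/width_gt0.
Qed.

End Mean.
End Levels.

(** * Correlations at the scale of a high tower *)

Section Estimates.
Context {R : realType} (lambda : probability Gamma R).
Hypothesis lambda_haar : haar lambda.
Local Notation lev := (@lev R).
Local Notation mean := (mean lambda).

Lemma height3 n : (2 * height n + 1 = 3 ^ n.+1)%N.
Proof. by elim: n => // n IH; rewrite expnS -IH /=; lia. Qed.

Lemma leq_height n : (n < height n)%N.
Proof. by elim: n => // n IH /=; lia. Qed.

Section Tower.
Variables (l a b : nat).
Hypotheses (ah : (a < height l)%N) (bh : (b < height l)%N).

(** The part of the correlation of two levels of Tower [l] at time [delta] that comes
from the points that do not leave Tower [l + d] in the meantime. *)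
Definition ncorr a b d (delta : int) : R := width (l + d) *
  \sum_(z < 3 ^ d) \sum_(z' < 3 ^ d)
     (delta + (pos l z + a)%N%:Z == (pos l z' + b)%N%:Z)%:R.

Lemma ncorrC d delta : ncorr a b d (- delta) = ncorr b a d delta.
Proof.
rewrite /ncorr exchange_big/=; congr (_ * _); apply: eq_bigr => z _.
apply: eq_bigr => z' _; congr ((_ : bool)%:R).
by apply/eqP/eqP; lia.
Qed.

(** The returns to the base of the big tower are the [m]; what remains of the [k]
steps once they and their spacers are removed takes place inside that tower. *)
Lemma corr_split d (k M : nat) : (k < M)%N -> corr (lev l a) (lev l b) k =
  \sum_(m < M) mean m (fun j => ncorr a b d (k%:Z - (m * height (l + d) + j)%N%:Z)).
Proof.
move=> kM; rewrite (lev_pos d ah) (lev_pos d bh) corr_suml.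
pose G z z' m j : R :=
  (k + (pos l z + a) == pos l z' + b + m * height (l + d) + j)%N%:R.
transitivity (\sum_(z < 3 ^ d) \sum_(z' < 3 ^ d)
    width (l + d) * \sum_(m < M) mean m (G z z' m)).
  apply: eq_bigr => z _; rewrite corr_sumr; apply: eq_bigr => z' _.
  by rewrite (corr_lev lambda_haar _ _ kM)//; exact: pos_lt.
transitivity (\sum_(m < M) width (l + d) *
    \sum_(z < 3 ^ d) \sum_(z' < 3 ^ d) mean m (G z z' m)); last first.
  apply: eq_bigr => m _; rewrite /ncorr meanZ mean_sum; congr (_ * _).
  apply: eq_bigr => z _; rewrite mean_sum; apply: eq_bigr => z' _.
  by apply: eq_mean => j _; congr ((_ : bool)%:R); apply/eqP/eqP; lia.
under eq_bigr do rewrite -mulr_sumr.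
rewrite -!mulr_sumr; congr (_ * _).
rewrite [RHS]exchange_big/=; apply: eq_bigr => z _.
by rewrite exchange_big.
Qed.

Lemma ncorr_ge0 d delta : 0 <= ncorr a b d delta.
Proof.
apply: mulr_ge0; first exact/ltW/width_gt0.
by do 2 apply: sumr_ge0 => ? _.
Qed.

Let ncorr_le_pos (a' b' d n H : nat) : (a' < height l)%N -> (b' < height l)%N ->
  (height (l + d) <= H + n)%N -> ncorr a' b' d n <= width (l + d) * H%:R.
Proof.
move=> ah' bh' hH; apply: ler_wpM2l; first exact/ltW/width_gt0.
apply: (@le_trans _ _ (\sum_(z < 3 ^ d) (z < H)%:R)); last first.
  rewrite -natr_sum ler_nat.
  rewrite (_ : (\sum_(_ < _) _)%N = minn (3 ^ d) H) ?geq_minr//.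
  elim: (3 ^ d)%N => [|m IH]; first by rewrite big_ord0 min0n.
  by rewrite big_ord_recr/= IH; lia.
apply: ler_sum => z _; case: ltnP => zH.
  rewrite -[true%:R]/1.
  apply: (@sum_bool_le1 R _ (fun z' => n%:Z + (pos l z + a')%N%:Z == (pos l z' + b')%N%:Z)).
  move=> z1 z2 _ _ /eqP e1 /eqP e2.
  have e : (pos l z1 + b' = pos l z2 + b')%N by lia.
  by have [] := pos_inj bh' bh' e.
rewrite big1// => z' _; rewrite (_ : (_ == _) = false)//; apply/eqP => e.
have := pos_lt (ltn_ord z') bh'.
have : (z <= pos l z)%N by rewrite /pos; have := height_gt0 l; nia.
by lia.
Qed.

Lemma ncorr_le d (H : nat) delta : (height (l + d) <= H + `|delta|)%N ->
  ncorr a b d delta <= width (l + d) * H%:R.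
Proof.
case: (intP delta) => [|n|n] hH.
- exact: ncorr_le_pos.
- exact: ncorr_le_pos.
- by rewrite ncorrC; apply: ncorr_le_pos => //; lia.
Qed.

Lemma ncorr_eq0 d delta : (height (l + d) <= `|delta|)%N -> ncorr a b d delta = 0.
Proof.
move=> h; apply/eqP; rewrite eq_le ncorr_ge0 andbT.
by rewrite (le_trans (@ncorr_le d 0 delta _))// mulr0.
Qed.

Lemma ncorr_norm d delta : `|ncorr a b d delta| <= 1.
Proof.
rewrite ger0_norm ?ncorr_ge0//.
rewrite (le_trans (@ncorr_le d (height (l + d)) delta _)) ?leq_addr//.
by rewrite mulrC height_width gerBl invr_ge0 exprn_ge0.
Qed.

(** Only the values of [m] next to [m0] contribute to the correlation at [k],
because the [k] steps spread over less than three heights of the tower, and for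
these [m] the weights [P_m] are nearly invariant by translation. *)
Lemma corr_diff_le d (k m0 w : nat) e : 0 <= e ->
  (forall m F, (w <= weight m)%N -> (forall y, `|F y| <= 1) -> `|mean m (fwd_diff F)| <= e) ->
  (w < weight m0)%N -> (weight m0 + 6 <= height (l + d))%N ->
  (2 * k <= m0 * 3 ^ (l + d).+1 + height (l + d))%N ->
  (m0 * 3 ^ (l + d).+1 <= 2 * k + height (l + d))%N ->
  `|corr (lev l a) (lev l b) k - corr (lev l a) (lev l b) k.+1| <= 3 * e.
Proof.
move=> e0 He wm0 hw; rewrite -height3; set h := height (l + d) => hk1 hk2.
pose M := (k + m0).+2.
rewrite (@corr_split d k M) ?(@corr_split d k.+1 M) /M; try lia.
rewrite -sumrB; apply: le_trans (ler_norm_sum _ _ _) _.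
pose G m j : R := ncorr a b d (k.+1%:Z - (m * h + j)%N%:Z).
have GE (m : nat) : mean m (fun j => ncorr a b d (k%:Z - (m * h + j)%N%:Z)) -
    mean m (fun j => ncorr a b d (k.+1%:Z - (m * h + j)%N%:Z)) = mean m (fwd_diff (G m)).
  rewrite -meanB; apply: eq_mean => j _; rewrite /fwd_diff /G.
  by congr (ncorr _ _ _ _ - _); lia.
apply: (@le_trans _ _ (\sum_(m < M) ((m0 <= m.+1) && (m <= m0.+1))%N%:R * e)).
  apply: ler_sum => m _; rewrite GE; move: (nat_of_ord m) => {}m; have [hm|hm] := boolP (_ && _).
    rewrite mul1r; apply: He => [|y]; last exact: ncorr_norm.
    have [h1 h2] := weight_lip m0; have [h3 h4] := weight_lip m0.-1.
    have /(_ _ hm) : forall x : nat, (m0 <= x.+1)%N && (x <= m0.+1)%N ->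
        x = m0 \/ x = m0.+1 \/ x = m0.-1 /\ m0 = m0.-1.+1.
      by move=> x /andP[]; lia.
    by move=> [->|[->|[-> e1]]]; [lia|lia|rewrite -e1 in h3 h4; lia].
  rewrite mul0r mean_spread// ?normr0// => j jm1 jm2.
  suff hh : forall x : int, x = k%:Z \/ x = k.+1%:Z ->
      ncorr a b d (x - (m * h + j)%N%:Z) = 0.
    rewrite /fwd_diff /G (_ : k.+1%:Z - (m * h + j.+1)%N%:Z = k%:Z - (m * h + j)%N%:Z); last by lia.
    by rewrite !hh ?subrr//; [right|left].
  move=> x xk; apply: ncorr_eq0; rewrite -/h.
  have [mm0|m0m] := leqP m m0.
    have [t tE] : exists t, m0 = (m + t.+2)%N by exists (m0 - m).-2; lia.
    have [_ wt] := weight_add m t.+2.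
    rewrite tE in hk1 hk2 hw wt.
    have E : ((m + t.+2) * (2 * h + 1) = 2 * (m * h) + 2 * (t * h) + 4 * h + m + t.+2)%N by nia.
    by rewrite E in hk1 hk2; lia.
  have [t tE] : exists t, m = (m0 + t.+2)%N :> nat by exists (m - m0).-2; lia.
  have [wt _] := weight_add m0 t.+2.
  rewrite tE in jm1 jm2 *.
  have E : ((m0 + t.+2) * h = m0 * h + t * h + 2 * h)%N by nia.
  have E' : (m0 * (2 * h + 1) = 2 * (m0 * h) + m0)%N by nia.
  by rewrite E; rewrite E' in hk1 hk2; lia.
rewrite -mulr_suml; apply: ler_wpM2r => //.
have one c : \sum_(m < M) (m == c :> nat)%:R <= 1 :> R.
  by apply: (@sum_bool_le1 R M (pred1 c)) => y y' _ _ /eqP-> /eqP->.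
have := lerD (lerD (one m0.-1) (one m0)) (one m0.+1).
rewrite -!big_split/= (_ : 1 + 1 + 1 = 3 :> R); last by lra.
apply: le_trans; apply: ler_sum => m _.
rewrite -!natrD ler_nat; case: (boolP (_ && _)) => // hm.
have /(_ _ hm) : forall x : nat, (m0 <= x.+1)%N && (x <= m0.+1)%N ->
    x = m0 \/ x = m0.+1 \/ x = m0.-1.
  by move=> x /andP[]; lia.
by move=> [->|[->|->]]; rewrite eqxx; lia.
Qed.

(** In [k] steps the tower is crossed [m] times, except for the points that start or
end within about [rho] of its boundary, which cross it [m - 1] or [m + 1] times. *)
Lemma corr_ncorr d (m k : nat) (rho : int) : k%:Z = (m * height (l + d))%N%:Z + rho ->
  (`|rho| + m + 2 <= height (l + d))%N ->
  `|corr (lev l a) (lev l b) k - mean m (fun j => ncorr a b d (rho - j%:Z))| <=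
  2 * (width (l + d) * (`|rho| + m + 1)%N%:R).
Proof.
set h := height (l + d); set w := width (l + d) => kE hh.
have w0 : 0 <= w by exact/ltW/width_gt0.
have mM : (m < (k + m).+2)%N by lia.
rewrite (@corr_split d k (k + m).+2); last lia.
rewrite (bigD1 (Ordinal mM))//= addrAC.
rewrite [X in X - _](_ : _ = mean m (fun j => ncorr a b d (rho - j%:Z))) ?subrr ?add0r; last first.
  by apply: eq_mean => j _; congr (ncorr _ _ _ _); lia.
apply: le_trans (ler_norm_sum _ _ _) _.
pose B (m' : nat) : R := ((m'.+1 == m)%:R + (m' == m.+1)%:R) * (w * (`|rho| + m + 1)%N%:R).
apply: (@le_trans _ _ (\sum_(m' < (k + m).+2) B m')).
  rewrite [leLHS]big_mkcond/=; apply: ler_sum => m' _.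
  have B0 c : 0 <= B c.
    by rewrite /B; apply: mulr_ge0; [apply: addr_ge0|apply: mulr_ge0].
  case: ifPn => // mm'; have {}mm' : m' != m :> nat by [].
  move: (nat_of_ord m') mm' => {}m' mm'.
  apply: le_trans (mean_norm _ _ _) _; rewrite -(mean_cst lambda_haar m' (B m')).
  apply: mean_le => j jm; rewrite ger0_norm ?ncorr_ge0//.
  have [m'm|m'm|e] := ltngtP m'.+1 m.
  - have [t tE] : exists t, m = (m' + t.+2)%N by exists (m - m').-2; lia.
    rewrite ncorr_eq0 ?B0// -/h.
    have E : (m * h = m' * h + t * h + 2 * h)%N by rewrite tE; nia.
    by rewrite E in kE; lia.
  - have [e|e] := eqVneq m' m.+1.
      rewrite /B e eqxx (_ : (m.+2 == m) = false) ?add0r ?mul1r; last by lia.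
      apply: ncorr_le; rewrite -/h.
      have E : (m.+1 * h = m * h + h)%N by nia.
      by rewrite E; lia.
    have [t tE] : exists t, m' = (m + t.+2)%N by exists (m' - m).-2; lia.
    rewrite ncorr_eq0 ?B0// -/h.
    have E : (m' * h = m * h + t * h + 2 * h)%N by rewrite tE; nia.
    by rewrite E; lia.
  - rewrite /B e eqxx (_ : (m' == m.+1) = false) ?addr0 ?mul1r; last by lia.
    apply: ncorr_le; rewrite -/h.
    have E : (m * h = m' * h + h)%N by rewrite -e; nia.
    by rewrite E in kE; lia.
rewrite -mulr_suml; apply: ler_wpM2r; first exact: mulr_ge0.
rewrite big_split/= (_ : 2 = 1 + 1 :> R); last by lra.
apply: lerD.
  apply: (@sum_bool_le1 R _ (fun x => x.+1 == m)) => y y' _ _ /eqP e /eqP e'.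
  by lia.
by apply: (@sum_bool_le1 R _ (pred1 m.+1)) => y y' _ _ /eqP-> /eqP->.
Qed.

End Tower.

Lemma ncorr_corr l a b d (delta : int) : (a < height l)%N -> (b < height l)%N ->
  (`|delta| + 2 <= height (l + d))%N ->
  `|ncorr l a b d delta - corr (lev l a) (lev l b) delta| <=
  2 * (width (l + d) * (`|delta| + 1)%N%:R).
Proof.
move=> ah bh hd.
have pos a' b' (n : nat) : (a' < height l)%N -> (b' < height l)%N ->
    (n + 2 <= height (l + d))%N ->
    `|ncorr l a' b' d n - corr (lev l a') (lev l b') n| <= 2 * (width (l + d) * (n + 1)%N%:R).
  move=> ah' bh' hn; rewrite distrC.
  have := @corr_ncorr l a' b' ah' bh' d 0 n n%:Z; rewrite mul0n add0r mean0//.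
  by rewrite subr0 absz_nat !addn0; apply.
case: (intP delta) hd => [|n|n] hd.
- exact: pos.
- exact: pos.
- by rewrite ncorrC// corrC abszN; apply: pos => //; lia.
Qed.

(** In [m h_N + rho] steps, with [rho] small with respect to [h_N], a point of
Tower [N] returns [m] times to the base and then moves by [rho] minus the number
of spacers met, which is distributed along [P_m]. *)
Lemma corr_peel l a b d (m : nat) (rho : int) : (a < height l)%N -> (b < height l)%N ->
  (0 < m)%N -> (`|rho| + m + 2 <= height (l + d))%N ->
  `|corr (lev l a) (lev l b) ((m * height (l + d))%N%:Z + rho) -
    mean m (fun j => corr (lev l a) (lev l b) (rho - j%:Z))| <=
  4 * (width (l + d) * (`|rho| + m + 1)%N%:R).
Proof.
move=> ah bh m0 hh.
have mh : (height (l + d) <= m * height (l + d))%N by rewrite leq_pmull.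
have [k kE] : exists k : nat, k%:Z = (m * height (l + d))%N%:Z + rho.
  by exists (absz ((m * height (l + d))%N%:Z + rho)); lia.
have := corr_ncorr ah bh kE hh; rewrite -kE => h1.
set x := corr _ _ _ in h1 *; set y := mean _ _ in h1; set z := mean _ _.
have h2 : `|y - z| <= 2 * (width (l + d) * (`|rho| + m + 1)%N%:R).
  rewrite /y /z -meanB; apply: le_trans (mean_norm _ _ _) _.
  rewrite -[leRHS](mean_cst lambda_haar m); apply: mean_le => j jm.
  apply: le_trans (ncorr_corr ah bh _) _; first lia.
  apply: ler_wpM2l => //; apply: ler_wpM2l; first exact/ltW/width_gt0.
  by rewrite ler_nat; lia.
by have := ler_distD y x z; lra.
Qed.

End Estimates.

(** * Convergence to the projection onto the constants *)

Section Rounding.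
Local Open Scope nat_scope.

(** The iterated rounding is the rounding of [n / 3 ^ N], because 3 is odd. *)
Lemma round_dist n N : let m := iter N (fun p => p.+1 %/ 3) n in
  2 * n <= 2 * (m * 3 ^ N) + 3 ^ N /\ 2 * (m * 3 ^ N) + 1 <= 2 * n + 3 ^ N.
Proof.
elim: N => [|N [IH1 IH2]] /=; first by rewrite expn0; lia.
set p := iter N _ n in IH1 IH2 *.
have [h1 h2] : p <= 3 * (p.+1 %/ 3) + 1 /\ 3 * (p.+1 %/ 3) <= p.+1 by lia.
rewrite expnS; set q := p.+1 %/ 3 in h1 h2 *; set t := 3 ^ N in IH1 IH2 *.
have : p * t <= (3 * q + 1) * t by rewrite leq_mul2r h1 orbT.
have : 3 * q * t <= p.+1 * t by rewrite leq_mul2r h2 orbT.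
have e : q * (3 * t) = 3 * q * t by rewrite mulnCA mulnA.
by rewrite e mulnDl mulSn mul1n; lia.
Qed.

(** Removing the lowest digits lowers the weight by at most one at each step. *)
Lemma weight_truncate n r : r <= weight n -> exists N,
  weight (iter N (fun p => p.+1 %/ 3) n) = r /\ weight n <= r + N.
Proof.
elim/ltn_ind: n => n IH rn.
have [e|ne] := eqVneq (weight n) r; first by exists 0; rewrite addn0 e.
have n0 : 0 < n by case: n ne rn {IH} => // /eqP; rewrite /weight/=; lia.
have := weightE n => wE.
have [||N [h1 h2]] := IH (n.+1 %/ 3); [lia| |].
  by move/eqP: ne; case: (_ != 0) wE => /=; lia.
exists N.+1; rewrite iterSr; split => //.
by case: (_ != 0) wE => /=; lia.
Qed.

End Rounding.

Section Theta.
Context {R : realType} (lambda : probability Gamma R).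
Hypothesis lambda_haar : haar lambda.
Local Notation lev := (@lev R).

(** The top digits of [2 k] that carry a weight just sufficient for smoothness form
the number [m0] of returns to a tower, which is high because many digits remain. *)
Lemma corr_diff_small l (e : R) : 0 < e -> exists W, forall a b k,
  (a < height l)%N -> (b < height l)%N -> (W <= weight (2 * k))%N ->
  `|corr (lev l a) (lev l b) k%:Z - corr (lev l a) (lev l b) k.+1%:Z| <= e.
Proof.
move=> e0; have e30 : 0 < e / 3 by rewrite divr_gt0.
have [w Hw] := mean_diff_small lambda_haar e30.
exists (w.+1 + l + w + 7)%N => a b k ah bh hk.
have [|N [wN hN]] := @weight_truncate (2 * k) w.+1; first lia.
have [r1 r2] := round_dist (2 * k) N.
set m0 := iter N _ _ in wN r1 r2.
have NE : N = (l + (N.-1 - l)).+1 by lia.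
rewrite NE -height3 in r1 r2.
have hh := leq_height (l + (N.-1 - l)).
have := @corr_diff_le _ _ lambda_haar l a b ah bh (N.-1 - l) k m0 w (e / 3) (ltW e30) Hw.
rewrite -height3 wN mulrCA divff ?mulr1//.
move: (m0 * _)%N r1 r2 => x r1 r2.
by apply; lia.
Qed.

Lemma corr_close l (e : R) p : 0 < e -> exists W, forall a b k i,
  (a < height l)%N -> (b < height l)%N -> (W <= weight (2 * k))%N -> (i <= p)%N ->
  `|corr (lev l a) (lev l b) k%:Z - corr (lev l a) (lev l b) (k + i)%N%:Z| <= e.
Proof.
move=> e0; have ep : 0 < e / p.+1%:R by rewrite divr_gt0.
have [W HW] := corr_diff_small l ep; exists (W + 2 * p)%N => a b k i ah bh hk ip.
apply: (@le_trans _ _ (i%:R * (e / p.+1%:R))); last first.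
  rewrite mulrCA; apply: ler_piMr; first exact: ltW.
  by rewrite ler_pdivrMr// mul1r ler_nat ltnW.
elim: i ip => [|i IH] ip; first by rewrite addn0 subrr normr0 mul0r.
apply: le_trans (ler_distD (corr (lev l a) (lev l b) (k + i)%N%:Z) _ _) _.
rewrite -natr1 mulrDl mul1r; apply: lerD; first by apply: IH; lia.
rewrite addnS; apply: HW => //; have [_] := weight_add (2 * k) (2 * i).
by rewrite -mulnDr; lia.
Qed.

Lemma corr_lev_shift n i g (k : int) : (i < height n)%N ->
  corr (lev n i) g k = corr (lev n 0) g (k + i%:Z).
Proof.
move=> ih; rewrite !corrE -[lev n 0](@koopmanZ_lev R n 0 i)// add0n addrC koopmanZD.
by rewrite inner_koopmanZ.
Qed.

Let one : L2 R := indL setT.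

Lemma koopmanZ_one k : koopmanZ k one = one.
Proof.
have K phi : measure_preserving (@chacon_measure R) phi -> koopman phi one = one.
  move=> mphi; apply: Lspace_ext.
  have h1 := koopmanE one mphi.
  have h2 := measure_preserving_ae mphi (indLE (@measurableT _ (measurableTypeR R))).
  have h3 := indLE (@measurableT _ (measurableTypeR R)).
  apply: filterS3 h1 h2 h3 => x + + + _ => /(_ I) -> /(_ I)/= e2 /(_ I) e3.
  by rewrite -[LHS]/(one (phi x)) e2 -[RHS]/(one x) e3 !indicT.
have I phi j : measure_preserving (@chacon_measure R) phi -> iter j (koopman phi) one = one.
  by move=> mphi; elim: j => //= j ->; exact: K.
by case: k => j; apply: I; [exact: chacon_measure_preserving|exact: chacon_inv_measure_preserving].
Qed.

Lemma inner_lev_one n i : (i < height n)%N -> inner (lev n i) one = width n.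
Proof.
by move=> ih; rewrite inner_indL ?setIT ?level_measure//; exact: measurable_level.
Qed.

Lemma nrm_one : nrm one = 1.
Proof. by rewrite /nrm inner_indL// setIT probability_setT sqrtr1. Qed.

(** Tower [n] fills the space up to a set of measure [3 ^- n.+1]. *)
Lemma nrm_one_tower n :
  nrm (one - \sum_(i < height n) lev n i) = Num.sqrt (3 ^+ n.+1)^-1.
Proof.
rewrite /nrm; congr Num.sqrt; set S := \sum_(i < _) _.
have SS : inner S S = (height n)%:R * width n.
  rewrite inner_suml (eq_bigr (fun=> width n)); last first.
    move=> i _; rewrite inner_sumr (bigD1 i)//= inner_lev// eqxx mul1r big1 ?addr0// => j ji.
    by rewrite inner_lev// (_ : (_ == _) = false) ?mul0r//; apply/negbTE; rewrite eq_sym.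
  by rewrite sumr_const card_ord mulr_natl.
have S1 : inner S one = (height n)%:R * width n.
  rewrite inner_suml (eq_bigr (fun=> width n)); last by move=> i _; exact: inner_lev_one.
  by rewrite sumr_const card_ord mulr_natl.
rewrite innerBl !innerBr (innerC one S) S1 SS.
rewrite (_ : inner one one = 1); last by rewrite -nrm_sqr nrm_one expr1n.
by rewrite height_width; ring.
Qed.

(** Over the levels of Tower [n], the correlations with [lev l b] become equal;
as these levels almost fill the space, their sum is almost the measure of
[lev l b]. *)
Lemma corr_theta_approx l d a b (k : nat) (e : R) :
  (a < height l)%N -> (b < height l)%N -> 0 <= e ->
  (forall t t' i, (t < height (l + d))%N -> (t' < height (l + d))%N ->
    (i <= height (l + d))%N ->
    `|corr (lev (l + d) t) (lev (l + d) t') k%:Z -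
      corr (lev (l + d) t) (lev (l + d) t') (k + i)%N%:Z| <= e) ->
  `|corr (lev l a) (lev l b) k%:Z - width l ^+ 2| <=
    (3 ^+ (2 * d) *+ 2) * e + Num.sqrt (3 ^+ (l + d).+1)^-1 *+ 2.
Proof.
set n := (l + d)%N; set h := height n; move=> ah bh e0 close.
pose g := lev l b; pose c0 := corr (lev n 0) g k.
pose s := Num.sqrt (3 ^+ n.+1)^-1 : R.
have h0 : 0 < h%:R :> R by rewrite ltr0n height_gt0.
have D0 : 0 <= 3 ^+ d :> R by rewrite exprn_ge0.
have gE : g = \sum_(z < 3 ^ d) lev n (pos l z + b)%N by exact: lev_pos.
(* All levels of Tower n have nearly the same correlation with g *)
have c1 i : (i < h)%N -> `|corr (lev n i) g k - c0| <= 3 ^+ d * e.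
  move=> ih; rewrite corr_lev_shift// distrC /c0 gE !corr_sumr -sumrB.
  apply: le_trans (ler_norm_sum _ _ _) _.
  rewrite -natrX -[leRHS](_ : \sum_(z < 3 ^ d) e = _); last first.
    by rewrite sumr_const card_ord mulr_natl.
  apply: ler_sum => z _; apply: close; [exact: height_gt0|exact: pos_lt|exact: ltnW].
have nrm_g : nrm g <= 1.
  rewrite nrm_lev// -sqrtr1 ler_wsqrtr// /width ler_pdivrMr ?exprn_gt0// mul1r.
  have : 1 <= 3 ^+ l :> R by rewrite exprn_ege1// ler1n.
  by rewrite exprS; lra.
have c2 : `|h%:R * c0 - width l| <= h%:R * (3 ^+ d * e) + s.
  have -> : width l = corr one g k by rewrite /corr koopmanZ_one innerC inner_lev_one.
  pose S := \sum_(i < h) lev n i.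
  have -> : corr one g k = corr S g k + corr (one - S) g k.
    by rewrite !corrE -innerDl addrC subrK.
  apply: (@le_trans _ _ (`|h%:R * c0 - corr S g k| + `|corr (one - S) g k|)).
    by rewrite opprD addrA; exact: ler_normB.
  apply: lerD; last first.
    apply: le_trans (corr_le _ _ _) _; rewrite nrm_one_tower.
    by rewrite ler_piMr ?sqrtr_ge0.
  rewrite distrC corr_suml -[h%:R * c0](_ : \sum_(i < h) c0 = _); last first.
    by rewrite sumr_const card_ord mulr_natl.
  rewrite -sumrB; apply: le_trans (ler_norm_sum _ _ _) _.
  rewrite -[leRHS](_ : \sum_(i < h) (3 ^+ d * e) = _); last first.
    by rewrite sumr_const card_ord mulr_natl.
  by apply: ler_sum => i _; exact: c1.
have c3 : `|corr (lev l a) g k - 3 ^+ d * c0| <= 3 ^+ d * (3 ^+ d * e).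
  rewrite (lev_pos d ah) corr_suml -{1}natrX -[_%:R * c0](_ : \sum_(z < 3 ^ d) c0 = _); last first.
    by rewrite sumr_const card_ord mulr_natl.
  rewrite -sumrB; apply: le_trans (ler_norm_sum _ _ _) _.
  rewrite -{1}natrX -[leRHS](_ : \sum_(z < 3 ^ d) (3 ^+ d * e) = _); last first.
    by rewrite sumr_const card_ord mulr_natl.
  by apply: ler_sum => z _; apply: c1; exact: pos_lt.
pose D : R := 3 ^+ d; pose r := D / h%:R; pose q : R := h%:R * width n.
have qE : q = 1 - s ^+ 2 by rewrite /q height_width sqr_sqrtr// invr_ge0 exprn_ge0.
have s0 : 0 <= s by exact: sqrtr_ge0.
have s2 : s ^+ 2 <= 1 / 3.
  rewrite sqr_sqrtr ?invr_ge0 ?exprn_ge0// div1r lef_pV2 ?posrE ?exprn_gt0//.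
  by rewrite exprS ler_peMr// exprn_ege1// ler1n.
have rh : r * h%:R = D by rewrite /r divfK// gt_eqF.
have wE : width l = r * q.
  have -> : q = h%:R * (width l / D) by congr (_ * _); rewrite /n /width -addSn exprD invfM mulrA.
  by rewrite mulrA rh mulrC divfK// expf_neq0.
have w1 : width l <= 2 / 3 :> R.
  rewrite /width ler_pM2l// lef_pV2 ?posrE ?exprn_gt0//.
  by rewrite exprS ler_peMr// exprn_ege1// ler1n.
have wl0 := @width_gt0 R l.
have r0 : 0 <= r by rewrite divr_ge0// ltW.
have r1 : r <= 1 by rewrite wE qE in w1; nra.
have s1 : s <= 1 by nra.
have c4 : `|D * c0 - r * width l| <= D * (D * e) + s.
  rewrite -{1}rh -mulrA -mulrBr normrM (ger0_norm r0).
  apply: le_trans (ler_wpM2l r0 c2) _.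
  rewrite mulrDr [r * (_ * _)]mulrA rh -/D; apply: lerD => //.
  by rewrite ler_piMl.
have c5 : `|r * width l - width l ^+ 2| <= s.
  rewrite expr2 {2}wE -mulrA -mulrBr normrM (ger0_norm r0).
  rewrite (_ : width l - q * width l = s ^+ 2 * width l); last by rewrite qE; ring.
  have x0 : 0 <= s ^+ 2 * width l by rewrite mulr_ge0 ?sqr_ge0// ltW.
  rewrite (ger0_norm x0); apply: le_trans (ler_piMl x0 r1) _.
  have w2 : 0 <= 1 - width l :> R by lra.
  have s3 : 0 <= 1 - s by rewrite subr_ge0.
  have := mulr_ge0 (sqr_ge0 s) w2; have := mulr_ge0 s0 s3.
  by rewrite expr2; lra.
have := ler_distD (D * c0) (corr (lev l a) g k) (width l ^+ 2).
have := ler_distD (r * width l) (D * c0) (width l ^+ 2).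
have -> : (3 ^+ (2 * d) *+ 2) * e = D * (D * e) + D * (D * e).
  by rewrite mulnC exprM -/D; ring.
rewrite mulr2n -/g -/s; move: c3 c4 c5; rewrite -/D.
by move: (D * (D * e)) => P; lra.
Qed.

(** The correlations of levels tend to the product of the measures along the times
with more and more nonzero digits. *)
Lemma corr_theta l (e : R) : 0 < e -> exists W, forall a b k,
  (a < height l)%N -> (b < height l)%N -> (W <= weight (2 * k))%N ->
  `|corr (lev l a) (lev l b) k%:Z - width l ^+ 2| <= e.
Proof.
move=> e0; have [d He] : exists d, Num.sqrt (3 ^+ (l + d).+1)^-1 *+ 2 <= e / 2.
  have [|n hn] := @width_small R ((e / 4) ^+ 2); first by rewrite exprn_gt0// divr_gt0.
  exists n; rewrite (_ : e / 2 = (e / 4) *+ 2); last by rewrite mulr2n; field.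
  rewrite lerMn2r; apply/orP; right.
  rewrite -[leRHS]ger0_norm ?divr_ge0 ?(ltW e0)// -sqrtr_sqr ler_wsqrtr//.
  apply: le_trans (ltW hn); rewrite /width.
  apply: (@le_trans _ _ (3 ^+ n.+1)^-1).
    by rewrite lef_pV2 ?posrE ?exprn_gt0// ler_weXn2l ?ler1n// ltnS leq_addl.
  by rewrite ler_peMl ?invr_ge0 ?exprn_ge0// ler1n.
pose c : R := 3 ^+ (2 * d) *+ 2.
have c0 : 0 < c by rewrite pmulrn_lgt0// exprn_gt0.
have ec : 0 < e / 2 / c by rewrite !divr_gt0.
have [W HW] := corr_close (l + d) (height (l + d)) ec.
exists W => a b k ah bh hk.
have := @corr_theta_approx l d a b k (e / 2 / c) ah bh (ltW ec).
rewrite -/c (mulrC c) divfK ?gt_eqF// => h.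
apply: le_trans (h _) _; last by lra.
by move=> t t' i th th' ih; apply: HW.
Qed.

End Theta.

(** * Weak limits *)

Section Weak.
Context {R : realType}.
Local Notation lev := (@lev R).
Local Notation L2 := (L2 R).
Local Notation one := (indL setT : L2).
Implicit Types (f g : L2) (A B Q : L2 -> L2).

Definition linear_contraction A := linear A /\ forall f, nrm (A f) <= nrm f.

Lemma contraction_bounded A : linear_contraction A -> bounded_operator A.
Proof. by case=> lA nA; apply/bounded_operatorP; split => //; exists 1 => f; rewrite mul1r. Qed.

Lemma linD A f g : linear A -> A (f + g) = A f + A g.
Proof. by move=> lA; have := lA 1 f g; rewrite !scale1r. Qed.

Lemma lin0 A : linear A -> A 0 = 0.
Proof. by move=> lA; have := lA (-1) 0 0; rewrite scaler0 addr0 scaleN1r addNr. Qed.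

Lemma linZ A a f : linear A -> A (a *: f) = a *: A f.
Proof. by move=> lA; rewrite -[a *: f]addr0 lA lin0// addr0. Qed.

Lemma lin_sum A (J : Type) (r : seq J) (P : pred J) (F : J -> L2) : linear A ->
  A (\sum_(i <- r | P i) F i) = \sum_(i <- r | P i) A (F i).
Proof.
by move=> lA; apply: (big_morph A) => [f g|]; [exact: linD|exact: lin0].
Qed.

Lemma contraction_comp A B : linear_contraction A -> linear_contraction B -> linear_contraction (A \o B).
Proof.
move=> [lA nA] [lB nB]; split => [a f g|f] /=; first by rewrite lB lA.
exact: le_trans (nA _) (nB _).
Qed.

Lemma contraction_id : linear_contraction id.
Proof. by []. Qed.

Lemma contraction_koopmanZ n : linear_contraction (koopmanZ n).
Proof. by split => [|f]; [exact: koopmanZ_linear|rewrite nrm_koopmanZ]. Qed.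

(** Limits pass to uniform approximations. *)
Lemma cvg_approx (u : nat -> R) (l : R) :
  (forall e, 0 < e -> exists (v : nat -> R) (m : R),
    [/\ v @ \oo --> m, forall n, `|u n - v n| <= e & `|l - m| <= e]) ->
  u @ \oo --> l.
Proof.
move=> h; apply/cvgrPdist_le => e e0; have e3 : 0 < e / 3 by rewrite divr_gt0.
have [v [m [vm uv lm]]] := h _ e3.
move/cvgrPdist_le/(_ _ e3): vm; apply: filterS => n hn.
have := ler_distD m l (u n); have := ler_distD (v n) m (u n).
have := uv n; rewrite (distrC (u n)); lra.
Qed.

Lemma cvg_lin (u v : nat -> R) (a l m : R) : u @ \oo --> l -> v @ \oo --> m ->
  a * u n + v n @[n --> \oo] --> a * l + m.
Proof. by move=> ul vm; apply: cvgD => //; apply: cvgM => //; exact: cvg_cst. Qed.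

Lemma cvg_bigsum (J : finType) (u : J -> nat -> R) (l : J -> R) :
  (forall i, u i @ \oo --> l i) -> \sum_i u i n @[n --> \oo] --> \sum_i l i.
Proof.
move=> h; rewrite /index_enum; case: index_enum_key => /=.
elim: (Finite.enum J) => [|i r IH].
  by rewrite big_nil; under eq_fun do rewrite big_nil; exact: cvg_cst.
by rewrite big_cons; under eq_fun do rewrite big_cons; exact: cvgD.
Qed.

(** By density, and since the powers of the Koopman operator are contractions, it
suffices to test weak convergence on the levels of a same tower. *)
Lemma weak_cvg_levels (k : nat -> int) A : linear_contraction A ->
  (forall l a b, (a < height l)%N -> (b < height l)%N ->
    corr (lev l a) (lev l b) (k j) @[j --> \oo] --> inner (A (lev l a)) (lev l b)) ->
  weak_cvg (fun j => koopmanZ (- k j)) A.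
Proof.
move=> [lA nA] h f g.
have approx (x y x' : R) : 0 <= x -> 0 < y -> `|x'| <= x * (y / (x + 1)) -> `|x'| <= y.
  move=> x0 y0 /le_trans; apply; rewrite mulrCA ler_piMr ?(ltW y0)//.
  by rewrite ler_pdivrMr ?mul1r ?lerDl// ltr_wpDl.
move: f; apply: L2_level_ind.
- move=> a f f' hf hf'; rewrite /= lA innerDl innerZl.
  under eq_fun do rewrite koopmanZ_linear innerDl innerZl.
  exact: cvg_lin.
- move=> f hf; apply: cvg_approx => e e0.
  have e1 : 0 < e / (nrm g + 1) by rewrite divr_gt0// ltr_wpDl ?nrm_ge0.
  have [f' hf' ff'] := hf _ e1.
  exists (fun j => inner (koopmanZ (- k j) f') g), (inner (A f') g).
  have bnd B : linear_contraction B -> `|inner (B f) g - inner (B f') g| <= e.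
    move=> [lB nB]; rewrite -innerBl -scaleN1r -linZ// -linD// scaleN1r.
    apply: (approx (nrm g)) => //; first exact: nrm_ge0.
    apply: le_trans (inner_CS _ _) _; rewrite mulrC ler_wpM2l ?nrm_ge0//.
    exact: le_trans (nB _) ff'.
  split => // [j|]; apply: bnd => //; exact: contraction_koopmanZ.
move=> n i ih; move: g; apply: L2_level_ind.
- move=> a f f' hf hf'; rewrite /= innerDr innerZr.
  under eq_fun do rewrite innerDr innerZr.
  exact: cvg_lin.
- move=> g hg; apply: cvg_approx => e e0.
  have e1 : 0 < e / (nrm (lev n i) + 1) by rewrite divr_gt0// ltr_wpDl ?nrm_ge0.
  have [g' hg' gg'] := hg _ e1.
  exists (fun j => inner (koopmanZ (- k j) (lev n i)) g'), (inner (A (lev n i)) g').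
  have bnd B : linear_contraction B -> `|inner (B (lev n i)) g - inner (B (lev n i)) g'| <= e.
    move=> [lB nB]; rewrite -innerBr.
    apply: (approx (nrm (lev n i))) => //; first exact: nrm_ge0.
    apply: le_trans (inner_CS _ _) _.
    by apply: ler_pM => //; exact: nrm_ge0.
  split => // [j|]; apply: bnd => //; exact: contraction_koopmanZ.
move=> n' i' ih'.
have e1 := lev_pos n' ih; have e2 := lev_pos n ih'; rewrite (addnC n' n) in e2.
have bil B : linear B -> inner (B (lev n i)) (lev n' i') =
    \sum_(y < 3 ^ n') \sum_(z < 3 ^ n)
      inner (B (lev (n + n') (pos n y + i)%N)) (lev (n + n') (pos n' z + i')%N).
  move=> lB; rewrite e1 e2 lin_sum// inner_suml.
  by apply: eq_bigr => y _; rewrite inner_sumr.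
rewrite (bil A lA); under eq_fun do rewrite (bil _ (@koopmanZ_linear R _)).
apply: cvg_bigsum => y; apply: cvg_bigsum => z.
by apply: h; [exact: pos_lt|rewrite (addnC n); exact: pos_lt].
Qed.

Lemma inner_theta f g : inner (theta f) g = inner f one * inner g one.
Proof.
have oneE := indLE (@measurableT _ (measurableTypeR R)).
have m1 : measurable_fun setT (cst 1 : measurableTypeR R -> R) by exact: measurable_cst.
have fE : inner f one = \int[@chacon_measure R]_x f x.
  rewrite (innerE (measurable_L2 f) m1 (ae_eq_refl _ _ _)).
    by under eq_Rintegral do rewrite mulr1.
  by apply: filterS oneE => y + _ => /(_ I) ->; rewrite indicT.
have -> : theta f = inner f one *: one.
  apply/esym/Lclass_Lfun; last exact: Lfun_cst.
  have h := LspaceZE (inner f one) one.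
  by apply: filterS2 h oneE => x + + _ => /(_ I) -> /(_ I)/= ->; rewrite indicT mulr1 fE.
by rewrite innerZl (innerC one).
Qed.

Lemma contraction_theta : linear_contraction theta.
Proof.
split=> [a f g|f].
  apply: inner_inj => h; rewrite innerDl innerZl !inner_theta innerDl innerZl.
  by rewrite mulrDl mulrA.
rewrite {1}/nrm inner_theta.
have -> : inner (theta f) one = inner f one.
  by rewrite inner_theta -[inner one one]nrm_sqr nrm_one expr1n mulr1.
rewrite -expr2 sqrtr_sqr; apply: le_trans (inner_CS _ _) _.
by rewrite nrm_one mulr1.
Qed.

Lemma weak_cvg_unique (k : nat -> int) A B : weak_cvg (fun j => koopmanZ (- k j)) A ->
  weak_cvg (fun j => koopmanZ (- k j)) B -> A = B.
Proof.
move=> hA hB; apply/funext => f; apply: inner_inj => g.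
exact: cvg_unique (hA f g) (hB f g).
Qed.

Lemma weak_cvg_sub (k : nat -> int) (s : nat -> nat) A : (forall j, (j <= s j)%N) ->
  weak_cvg (fun j => koopmanZ (- k j)) A -> weak_cvg (fun j => koopmanZ (- k (s j))) A.
Proof.
move=> sj h f g; apply/cvgrPdist_le => e e0.
have /cvgrPdist_le/(_ _ e0)[N _ HN] := h f g.
by exists N => // j /= Nj; apply: HN; exact: leq_trans (sj j).
Qed.

Section Polynomials.
Variable lambda : probability Gamma R.
Hypothesis lambda_haar : haar lambda.
Local Notation mean := (mean lambda).

Definition Pop m : L2 -> L2 := poly_op (chacon_poly lambda m) (koopman chacon).

Lemma PopE m f : Pop m f = \sum_(j < m.+1) pi_coef lambda m j *: koopmanZ j%:Z f.
Proof.
rewrite /Pop /poly_op (big_ord_widen m.+1 (fun j => (chacon_poly lambda m)`_j *: iter j (koopman chacon) f)).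
  rewrite big_mkcond; apply: eq_bigr => j _; case: ltnP => [_|/(nth_default 0)];
    rewrite coef_poly ltn_ord// => ->.
  by rewrite scale0r.
exact: size_poly.
Qed.

Lemma inner_Pop m f g : inner (Pop m f) g = mean m (fun j => inner (koopmanZ j%:Z f) g).
Proof. by rewrite PopE inner_suml; apply: eq_bigr => j _; rewrite innerZl. Qed.

Lemma contraction_Pop m : linear_contraction (Pop m).
Proof.
split=> [a f g|f].
  rewrite !PopE scaler_sumr -big_split; apply: eq_bigr => j _.
  by rewrite koopmanZ_linear scalerDr !scalerA mulrC.
rewrite PopE; apply: le_trans (nrm_sum _ _ _) _.
rewrite -[leRHS](mean_cst lambda_haar m); apply: ler_sum => j _.
by rewrite nrmZ nrm_koopmanZ ger0_norm// pi_coef_ge0.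
Qed.

Lemma Pop_commute m A : linear A -> (forall n f, A (koopmanZ n f) = koopmanZ n (A f)) ->
  forall f, A (Pop m f) = Pop m (A f).
Proof.
move=> lA cA f; rewrite !PopE lin_sum//; apply: eq_bigr => j _.
by rewrite linZ// cA.
Qed.

Lemma koopmanZC n p f : koopmanZ n (koopmanZ p f) = koopmanZ p (koopmanZ n f).
Proof. by rewrite -!koopmanZD addrC. Qed.

Lemma koopmanZ_Pop n m f : koopmanZ n (Pop m f) = Pop m (koopmanZ n f).
Proof. by apply: Pop_commute => [|p g]; [exact: koopmanZ_linear|exact: koopmanZC]. Qed.

Local Notation prd := (chacon_poly_prod lambda).

Lemma contraction_prod ms : linear_contraction (prd ms).
Proof.
elim: ms => [|m ms IH]; first exact: contraction_id.
exact: (contraction_comp (contraction_Pop m) IH).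
Qed.

Lemma prod_cons m ms f : prd (m :: ms) f = Pop m (prd ms f).
Proof. by []. Qed.

Lemma koopmanZ_prod n ms f : koopmanZ n (prd ms f) = prd ms (koopmanZ n f).
Proof. by elim: ms => // m ms IH; rewrite !prod_cons koopmanZ_Pop IH. Qed.

Lemma prod_Pop ms m f : prd ms (Pop m f) = Pop m (prd ms f).
Proof.
apply: Pop_commute => [|n g]; first by case: (contraction_prod ms).
by rewrite koopmanZ_prod.
Qed.

Lemma prod_cat ms ms' f : prd (ms ++ ms') f = prd ms (prd ms' f).
Proof. by elim: ms => // m ms IH; rewrite cat_cons !prod_cons IH. Qed.

Lemma prod_commute ms ms' f : prd ms (prd ms' f) = prd ms' (prd ms f).
Proof. by elim: ms => // m ms IH; rewrite !prod_cons IH prod_Pop. Qed.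

Lemma prod_perm ms ms' : perm_eq ms ms' -> prd ms = prd ms'.
Proof.
move=> pms; apply/esym.
apply: (@catCA_perm_ind _ (fun s => prd s = prd ms)) pms _ => // s1 s2 s3 <-.
apply/funext => f; rewrite !prod_cat prod_commute.
by [].
Qed.

End Polynomials.
End Weak.

(** * Powers along sequences of times *)

Section Limits.
Context {R : realType} (lambda : probability Gamma R).
Hypothesis lambda_haar : haar lambda.
Local Notation lev := (@lev R).
Local Notation L2 := (L2 R).
Local Notation mean := (mean lambda).
Local Notation Pop := (Pop lambda).
Implicit Types (f g : L2) (Q : L2 -> L2).

Lemma weak_cvg_theta (k : nat -> int) :
  (forall W, exists J, forall j, (J <= j)%N -> (W <= weight (2 * `|k j|))%N) ->
  weak_cvg (fun j => koopmanZ (- k j)) (@theta R).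
Proof.
move=> hk; apply: weak_cvg_levels => [|l a b ah bh]; first exact: contraction_theta.
rewrite inner_theta !inner_lev_one// -expr2; apply/cvgrPdist_le => e e0.
have [W HW] := corr_theta lambda_haar l e0; have [J HJ] := hk W.
exists J => // j /= Jj; have := HJ j Jj; rewrite distrC.
case: (intP (k j)) => [|n|n] hw.
- exact: HW.
- exact: HW.
- by rewrite corrC; apply: HW => //; rewrite abszN in hw.
Qed.

(** The heights in the times [m h_N + rho] are read up to terms that are
negligible when [rho] is small with respect to the height of Tower [N]. *)
Lemma corr_peel_cvg (rho : nat -> int) (N : nat -> nat) m l a b :
  (0 < m)%N -> width (N j) * (`|rho j| + 1)%N%:R @[j --> \oo] --> (0 : R) ->
  (a < height l)%N -> (b < height l)%N ->
  corr (lev l a) (lev l b) ((m * height (N j))%N%:Z + rho j) -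
    mean m (fun i => corr (lev l a) (lev l b) (rho j - i%:Z)) @[j --> \oo] --> (0 : R).
Proof.
move=> m0 hN ah bh; apply/cvgrPdist_le => e e0.
pose e1 : R := Num.min (e / (4 * m.+1%:R)) (Num.min (width l / 2) ((2 * m.+2%:R)^-1)).
have e10 : 0 < e1.
  by rewrite !lt_min !divr_gt0 ?width_gt0 ?mulr_gt0//= invr_gt0 mulr_gt0.
move/cvgrPdist_le/(_ _ e10): hN; apply: filterS => j.
have w0 := @width_gt0 R (N j).
rewrite sub0r normrN ger0_norm; last by rewrite mulr_ge0// ltW.
rewrite !le_min => /and3P[h1 h2 h3]; rewrite sub0r normrN.
have lN : (l <= N j)%N.
  rewrite leqNgt; apply/negP => Nl.
  have : width l <= width (N j) :> R.
    by rewrite /width ler_pM2l// lef_pV2 ?posrE ?exprn_gt0// ler_weXn2l ?ler1n// ltnS ltnW.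
  have : width (N j) <= width (N j) * (`|rho j| + 1)%N%:R :> R by apply: ler_peMr; [exact: ltW|rewrite ler1n addn1].
  by have := @width_gt0 R l; lra.
have [d NE] : exists d, (l + d = N j)%N by exists (N j - l)%N; rewrite subnKC.
have big : (`|rho j| + m + 2 <= height (N j))%N.
  rewrite -(ler_nat R) -(ler_pM2l w0) (mulrC _ (height _)%:R) height_width.
  apply: (@le_trans _ _ (1 / 2)); last first.
    suff : (3 ^+ (N j).+1)^-1 <= 1 / 2 :> R by lra.
    rewrite div1r lef_pV2 ?posrE ?exprn_gt0// exprS.
    have : 1 <= 3 ^+ N j :> R by rewrite exprn_ege1// ler1n.
    by lra.
  apply: (@le_trans _ _ (width (N j) * ((`|rho j| + 1)%N%:R * m.+2%:R))).
    by rewrite ler_pM2l// -natrM ler_nat; nia.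
  by rewrite mulrA -ler_pdivlMr// mul1r -invfM.
rewrite -NE in h1 w0 big *.
apply: le_trans (corr_peel lambda_haar ah bh m0 big) _.
apply: (@le_trans _ _ (4 * m.+1%:R * (width (l + d) * (`|rho j| + 1)%N%:R))).
  rewrite -mulrA ler_pM2l// mulrCA ler_pM2l// -natrM ler_nat; nia.
by rewrite mulrC -ler_pdivlMr ?mulr_gt0.
Qed.

Let cvg_sub_add (u v : nat -> R) (l : R) :
  u j - v j @[j --> \oo] --> (0 : R) -> v @ \oo --> l -> u @ \oo --> l.
Proof.
move=> h hv; have -> : u = (fun j => (u j - v j) + v j) by apply/funext => j; rewrite subrK.
by rewrite -[l]add0r; exact: cvgD.
Qed.

(** The hypothesis on the widths says that [rho j] is negligible with respect to the
height of Tower [N j]. *)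
Lemma weak_cvg_peel (rho : nat -> int) (N : nat -> nat) m Q :
  (0 < m)%N -> width (N j) * (`|rho j| + 1)%N%:R @[j --> \oo] --> (0 : R) ->
  linear_contraction Q -> weak_cvg (fun j => koopmanZ (- rho j)) Q ->
  weak_cvg (fun j => koopmanZ (- ((m * height (N j))%N%:Z + rho j))) (Q \o Pop m).
Proof.
move=> m0 hN cQ hQ; apply: weak_cvg_levels => [|l a b ah bh].
  exact: contraction_comp cQ (contraction_Pop lambda_haar m).
have h := corr_peel_cvg m0 hN ah bh.
have h' : mean m (fun i => corr (lev l a) (lev l b) (rho j - i%:Z)) @[j --> \oo] -->
    inner ((Q \o Pop m) (lev l a)) (lev l b).
  rewrite /= PopE lin_sum; last by case: cQ.
  rewrite inner_suml; apply: cvg_bigsum => i.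
  rewrite linZ; last by case: cQ.
  rewrite innerZl; apply: cvgM; first exact: cvg_cst.
  have := hQ (koopmanZ i%:Z (lev l a)) (lev l b).
  by under eq_fun do rewrite -koopmanZD addrC -opprB.
exact: cvg_sub_add h h'.
Qed.

(** The correlation at a time is that of the exchanged levels at the opposite time,
so the case of [m] applies; reversing [P_m] there restores the positive powers, up to
the power [- m]. *)
Lemma weak_cvg_peelN (rho : nat -> int) (N : nat -> nat) m Q :
  (0 < m)%N -> width (N j) * (`|rho j| + 1)%N%:R @[j --> \oo] --> (0 : R) ->
  linear_contraction Q -> weak_cvg (fun j => koopmanZ (- rho j)) Q ->
  weak_cvg (fun j => koopmanZ (- (- (m * height (N j))%N%:Z + rho j)))
    (Q \o Pop m \o koopmanZ (- m%:Z)).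
Proof.
move=> m0 hN cQ hQ; apply: weak_cvg_levels => [|l a b ah bh].
  apply: contraction_comp (contraction_koopmanZ _).
  exact: contraction_comp cQ (contraction_Pop lambda_haar m).
have hN' : width (N j) * (`|- rho j| + 1)%N%:R @[j --> \oo] --> (0 : R).
  by under eq_fun do rewrite abszN.
have h := corr_peel_cvg m0 hN' bh ah.
have h' : mean m (fun i => corr (lev l b) (lev l a) (- rho j - i%:Z)) @[j --> \oo] -->
    inner ((Q \o Pop m \o koopmanZ (- m%:Z)) (lev l a)) (lev l b).
  rewrite /= PopE lin_sum; last by case: cQ.
  under eq_fun do rewrite (mean_rev lambda_haar).
  rewrite inner_suml; apply: cvg_bigsum => i.
  rewrite linZ; last by case: cQ.
  rewrite innerZl; apply: cvgM; first exact: cvg_cst.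
  have im : (i <= m)%N by rewrite -ltnS.
  suff -> : (fun j => corr (lev l b) (lev l a) (- rho j - (m - i)%N%:Z)) =
      (fun j => inner (koopmanZ (- rho j) (koopmanZ i%:Z (koopmanZ (- m%:Z) (lev l a)))) (lev l b)).
    exact: hQ.
  apply/funext => j.
  rewrite (_ : - rho j - (m - i)%N%:Z = - (rho j + (m - i)%N%:Z)); last by lia.
  by rewrite corrC /corr -!koopmanZD; congr (inner (koopmanZ _ _) _); lia.
have := cvg_sub_add h h'.
by under eq_fun do rewrite -corrC opprD opprK.
Qed.

End Limits.

(** * Times with boundedly many nonzero digits *)

(** [K] has at most [r] nonzero balanced ternary digits. The bound on [K'] makes its
digits lower than [n]. *)
Fixpoint sparse (r : nat) (K : int) : Prop :=
  K = 0 \/ if r is r'.+1 then exists (e : int) n K',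
    [/\ e = 1 \/ e = -1, K = e * (3 ^ n)%N%:Z + K',
        (2 * `|K'| < 3 ^ n)%N & sparse r' K'] else False.

Lemma sparse0 r : sparse r 0.
Proof. by case: r => [|r]; left. Qed.

Lemma sparseN r K : sparse r K -> sparse r (- K).
Proof.
elim: r K => [|r IH] K [->|//]; try by rewrite oppr0; left.
move=> [e [n [K' [he KE hK' sK']]]]; right; exists (- e), n, (- K').
split; [by case: he => ->; [right|left]|by rewrite KE; lia|by rewrite abszN|exact: IH].
Qed.

Lemma sparse3 r K : sparse r K -> sparse r (3 * K).
Proof.
elim: r K => [|r IH] K [->|//]; try by rewrite mulr0; left.
move=> [e [n [K' [he KE hK' sK']]]]; right; exists e, n.+1, (3 * K').
split => //; last exact: IH.
  by rewrite KE expnS; lia.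
by rewrite expnS; lia.
Qed.

Lemma sparse3_digit r K (d : int) : d = 1 \/ d = -1 -> sparse r K -> sparse r.+1 (3 * K + d).
Proof.
move=> hd; elim: r K => [|r IH] K [->|//].
- by right; exists d, 0%N, 0; split => //; [lia|left].
- by right; exists d, 0%N, 0; split => //; [lia|left].
move=> [e [n [K' [he KE hK' sK']]]]; right; exists e, n.+1, (3 * K' + d).
split => //; last exact: IH.
  by rewrite KE expnS; lia.
by rewrite expnS; lia.
Qed.

Lemma sparse_weight n : sparse (weight n) n%:Z.
Proof.
elim/ternary_ind: n => [|q _ IH|q IH _|q _ IH].
- exact: sparse0.
- by rewrite weight3 PoszM; exact: sparse3.
- rewrite weight3_1 (_ : (3 * q).+1%:Z = 3 * q%:Z + 1); last by lia.
  by apply: sparse3_digit; [left|exact: IH].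
- rewrite weight3_2 (_ : (3 * q).+2%:Z = 3 * q.+1%:Z + -1); last by lia.
  by apply: sparse3_digit; [right|exact: IH].
Qed.

Section Subsequences.
Implicit Types (P : nat -> Prop) (f : nat -> nat).

Lemma often_or P : (forall J, exists2 j, (J <= j)%N & P j) \/
  (forall J, exists2 j, (J <= j)%N & ~ P j).
Proof.
have [|/existsNP[J0 hJ0]] := pselect (forall J, exists2 j, (J <= j)%N & P j); [by left|right=> J].
exists (maxn J J0); first exact: leq_maxl.
by move=> Pj; apply: hJ0; exists (maxn J J0) => //; exact: leq_maxr.
Qed.

Lemma often_cst_or_dvg f : (exists v, forall J, exists2 j, (J <= j)%N & f j = v) \/
  (forall B, exists J, forall j, (J <= j)%N -> (B <= f j)%N).
Proof.
have [|h] := pselect (exists v, forall J, exists2 j, (J <= j)%N & f j = v); [by left|right].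
elim=> [|B [J IH]]; first by exists 0%N.
have [J' hJ'] : exists J', forall j, (J' <= j)%N -> f j <> B.
  apply: contrapT => /forallNP h'; apply: h; exists B => J'.
  apply: contrapT => h''; apply: (h' J') => j J'j fj; apply: h''.
  by exists j.
exists (maxn J J') => j; rewrite geq_max => /andP[/IH Bf /hJ' fB].
by rewrite ltn_neqAle Bf andbT eq_sym; apply/eqP.
Qed.

Lemma often_subseq (P : nat -> nat -> Prop) :
  (forall i, exists2 j, (i <= j)%N & P i j) ->
  exists s : nat -> nat, forall i, (i <= s i)%N /\ P i (s i).
Proof.
move=> h; have /choice[s hs] : forall i, exists j, (i <= j)%N /\ P i j.
  by move=> i; have [j ij Pj] := h i; exists j.
by exists s.
Qed.

End Subsequences.

Section Sparse.
Context {R : realType} (lambda : probability Gamma R).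
Hypothesis lambda_haar : haar lambda.
Local Notation L2 := (L2 R).
Local Notation Pop := (Pop lambda).
Local Notation prd := (chacon_poly_prod lambda).
Implicit Types (k K : nat -> int).

(** The last clause keeps track of the limits without polynomial factor, which come
only from constant subsequences; [nontriv] excludes them. *)
Definition sublimit k (nontriv : bool) := exists (s : nat -> nat) ms n,
  [/\ forall j, (j <= s j)%N, all (leq 1) ms,
      weak_cvg (fun j => koopmanZ (- k (s j))) (prd ms \o koopmanZ n) &
      ms = [::] -> ~~ nontriv /\ exists c, forall j, k (s j) = c].

Lemma sublimit_sub k (s : nat -> nat) b : (forall j, (j <= s j)%N) ->
  sublimit (k \o s) b -> sublimit k b.
Proof.
move=> hs [t [ms [n [ht hms hw hc]]]]; exists (s \o t), ms, n; split => //.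
by move=> j; apply: leq_trans (ht j) (hs _).
Qed.

Lemma sublimitW k b : sublimit k b -> sublimit k false.
Proof.
move=> [s [ms [n [hs hms hw hc]]]]; exists s, ms, n; split => // h.
by have [_ hc'] := hc h.
Qed.

Lemma sublimit_cst k c : (forall j, k j = c) -> sublimit k false.
Proof.
move=> kc; exists id, [::], (- c); split => //; last by move=> _; split => //; exists c.
move=> f g; under eq_fun do rewrite kc; exact: cvg_cst.
Qed.

(** When the lower digits [K] are negligible with respect to [3 ^ N], the term
[m 3 ^ N] is peeled off as [m] returns to the base of Tower [N - 1]. The bounded
correction is carried by [s], since [3 ^ N] is one more than twice a height. *)
Let sublimit_gap (r : nat) (m s : int) k K (N : nat -> nat) :
  (forall (s : int) k K, (forall j, 2 * k j = K j + s) -> (forall j, sparse r (K j)) ->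
    sublimit k false) ->
  m != 0 -> (forall j, 2 * k j = m * (3 ^ N j)%N%:Z + K j + s) ->
  (forall j, j < N j)%N -> (forall j, `|K j| * 3 ^ j <= 2 * 3 ^ N j)%N ->
  (forall j, sparse r (K j)) -> sublimit k true.
Proof.
move=> Sr m0 kE jN hK sK.
pose N' j := (N j).-1; pose rho j := k j - m * (height (N' j))%:Z.
have NE j : N j = (N' j).+1 by rewrite /N' prednK//; exact: leq_ltn_trans (jN j).
have rhoE j : 2 * rho j = K j + (m + s).
  rewrite /rho mulrBr kE NE -height3 PoszD PoszM.
  by ring.
have [t [ms [n [ht hms hw _]]]] := Sr _ _ _ rhoE sK.
have hw0 : width (N' (t j)) * (`|rho (t j)| + 1)%N%:R @[j --> \oo] --> (0 : R).
  pose c : R := 2 * (`|m| + `|s| + 1)%N%:R + 4.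
  apply: (@squeeze_cvgr _ _ _ _ (fun=> 0) (fun j => c / 3 ^+ j)); last first.
  - exact: cvg_div_exp3.
  - exact: cvg_cst.
  apply: nearW => j; apply/andP; split.
    by apply: mulr_ge0 => //; exact/ltW/width_gt0.
  rewrite /width -NE.
  have h1 : (`|rho (t j)| + 1 <= `|m| + `|s| + 1 + `|K (t j)|)%N.
    by have := rhoE (t j); lia.
  have h2 := hK (t j); have h3 := jN (t j); have h4 := ht j.
  have n3 i : 0 < 3 ^+ i :> R by rewrite exprn_gt0.
  have h5 : (3 ^+ N (t j))^-1 <= (3 ^+ j)^-1 :> R.
    by rewrite lef_pV2 ?posrE// ler_weXn2l ?ler1n//; lia.
  have h6 : (`|K (t j)|%N)%:R / 3 ^+ N (t j) <= 2 / 3 ^+ j :> R.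
    apply: (@le_trans _ _ (2 / 3 ^+ t j)); last first.
      by rewrite ler_pM2l// lef_pV2 ?posrE// ler_weXn2l ?ler1n.
    rewrite ler_pdivrMr// mulrAC ler_pdivlMr//.
    by rewrite -!natrX -!natrM ler_nat.
  apply: (@le_trans _ _ (2 / 3 ^+ N (t j) * (`|m| + `|s| + 1 + `|K (t j)|)%N%:R)).
    by rewrite ler_pM2l ?divr_gt0// ler_nat.
  rewrite natrD mulrDr /c [leRHS]mulrDl; apply: lerD.
    by rewrite mulrAC ler_wpM2l// mulr_ge0.
  by rewrite mulrAC -mulrA (_ : 4 / 3 ^+ j = 2 * (2 / 3 ^+ j)); [rewrite ler_pM2l|field].
have cQ : linear_contraction (prd ms \o koopmanZ n).
  apply: contraction_comp; [exact: contraction_prod|exact: contraction_koopmanZ].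
have hm : exists2 p : nat, (0 < p)%N & m = p%:Z \/ m = - p%:Z.
  by exists (absz m); lia.
have [p p0 hp] := hm; exists t, (p :: ms).
case: hp => mE; [exists n|exists (n - p%:Z)]; split => //=; try by rewrite p0.
- have := weak_cvg_peel lambda_haar p0 hw0 cQ hw.
  have -> : prd (p :: ms) \o koopmanZ n = (prd ms \o koopmanZ n) \o Pop p.
    by apply/funext => f; rewrite /= koopmanZ_Pop prod_Pop.
  have -> : (fun j => koopmanZ (- ((p * height (N' (t j)))%N%:Z + rho (t j)))) =
      (fun j => @koopmanZ R (- k (t j))).
    by apply/funext => j; congr koopmanZ; rewrite /rho mE; lia.
  exact.
- have := weak_cvg_peelN lambda_haar p0 hw0 cQ hw.
  have -> : prd (p :: ms) \o koopmanZ (n - p%:Z) =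
      (prd ms \o koopmanZ n) \o Pop p \o koopmanZ (- p%:Z).
    by apply/funext => f; rewrite /= koopmanZD koopmanZ_Pop prod_Pop.
  have -> : (fun j => koopmanZ (- (- (p * height (N' (t j)))%N%:Z + rho (t j)))) =
      (fun j => @koopmanZ R (- k (t j))).
    by apply/funext => j; congr koopmanZ; rewrite /rho mE; lia.
  exact.
Qed.

Let top_digit r (K : int) : sparse r K -> K != 0 -> exists r' e n (K' : int),
  [/\ r = r'.+1, e = 1 \/ e = -1, K = e * (3 ^ n)%N%:Z + K',
      (2 * `|K'| < 3 ^ n)%N & sparse r' K'].
Proof.
case: r => [|r] [->|//]; try by rewrite eqxx.
by move=> [e [n [K' [he KE hK' sK']]]] _; exists r, e, n, K'.
Qed.

Let digits r K : (forall j, sparse r (K j)) -> (forall j, K j != 0) ->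
  exists r' (e : nat -> int) (n : nat -> nat) (K' : nat -> int), r = r'.+1 /\ forall j, [/\ e j = 1 \/ e j = -1,
    K j = e j * (3 ^ n j)%N%:Z + K' j, (2 * `|K' j| < 3 ^ n j)%N & sparse r' (K' j)].
Proof.
move=> sK K0; case: r sK => [|r] sK.
  by have [r' [e [n [K' []]]]] := top_digit (sK 0%N) (K0 0%N).
have h j : exists d : int * nat * int, [/\ d.1.1 = 1 \/ d.1.1 = -1,
    K j = d.1.1 * (3 ^ d.1.2)%N%:Z + d.2, (2 * `|d.2| < 3 ^ d.1.2)%N & sparse r d.2].
  have [r' [e [n [K' [[<-] he KE hK' sK']]]]] := top_digit (sK j) (K0 j).
  by exists (e, n, K').
have [d hd] := choice h.
by exists r, (fun j => (d j).1.1), (fun j => (d j).1.2), (fun j => (d j).2).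
Qed.

(* A sign is constant along a subsequence *)
Let sign_subseq (e : nat -> int) : (forall j, e j = 1 \/ e j = -1) ->
  exists s c, (c = 1 \/ c = -1) /\ forall j, (j <= s j)%N /\ e (s j) = c.
Proof.
move=> he; have [h|h] := often_or (fun j => e j = 1).
  have [s hs] := often_subseq (P := fun _ j => e j = 1) h.
  by exists s, 1; split; [left|].
have [s hs] := often_subseq (P := fun _ j => e j <> 1) h.
exists s, (-1); split; [by right|move=> j].
by have [sj ej] := hs j; split => //; case: (he (s j)).
Qed.

(* The two statements of the induction on the number of digits; in the second one a
block [m] of higher digits, at bounded distance from each other, is set apart. *)
Let S r := forall (s : int) k K,
  (forall j, 2 * k j = K j + s) -> (forall j, sparse r (K j)) -> sublimit k false.

Let S' r := forall (m s : int) k K (N : nat -> nat), m != 0 ->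
  (forall j, 2 * k j = m * (3 ^ N j)%N%:Z + K j + s) ->
  (forall j, j < N j)%N -> (forall j, 2 * `|K j| < 3 ^ N j)%N ->
  (forall j, sparse r (K j)) -> sublimit k true.

(** Either [K] is bounded along a subsequence, and then constant along another one, or
its top digit, which goes to infinity, starts a block. *)
Let S_step r : (forall r', r = r'.+1 -> S' r') -> S r.
Proof.
move=> hS' s k K kE sK; have [[v hv]|dvg] := often_cst_or_dvg (fun j => `|K j|%N).
  have [t ht] := often_subseq (P := fun _ j => `|K j|%N = v) hv.
  apply: (@sublimit_sub _ t) => [j|]; first by case: (ht j).
  have cst (u : nat -> nat) (c : int) : (forall j, (j <= u j)%N /\ K (t (u j)) = c) ->
      sublimit (k \o t) false.
    move=> hu; apply: (@sublimit_sub _ u) => [j|]; first by case: (hu j).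
    apply: (@sublimit_cst _ (k (t (u 0%N)))) => j /=.
    have [_ h1] := hu j; have [_ h2] := hu 0%N.
    by have := kE (t (u j)); have := kE (t (u 0%N)); rewrite h1 h2; lia.
  have [h|h] := often_or (fun j => K (t j) = v%:Z).
    by have [u hu] := often_subseq (P := fun _ j => K (t j) = v%:Z) h; exact: cst hu.
  have [u hu] := often_subseq (P := fun _ j => K (t j) <> v%:Z) h.
  apply: (cst u (- v%:Z)) => j; have [uj Kj] := hu j; split => //.
  by have [_] := ht (u j); lia.
have [i|t ht] := @often_subseq (fun i j => (2 * 3 ^ i <= `|K j|)%N).
  have [J HJ] := dvg (2 * 3 ^ i)%N; exists (maxn i J); first exact: leq_maxl.
  by apply: HJ; exact: leq_maxr.
apply: (@sublimit_sub _ t) => [j|]; first by case: (ht j).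
have K0 j : K (t j) != 0.
  by have [_] := ht j; have : (0 < 3 ^ j)%N by [rewrite expn_gt0]; lia.
have [r' [e [n [K' [rE hd]]]]] := digits (fun j => sK (t j)) K0.
have jn j : (j < n j)%N.
  rewrite -(ltn_exp2l _ _ (isT : 1 < 3)%N).
  have [_ h1] := ht j; have [he h2 h3 _] := hd j.
  by move: (3 ^ n j)%N (3 ^ j)%N h1 h2 h3 => x y; case: he => ->; lia.
have [u [c [hc hu]]] := sign_subseq (e := e) (fun j => ltac:(by case: (hd j))).
apply: (@sublimit_sub _ u) => [j|]; first by case: (hu j).
apply/sublimitW/(hS' r' rE c s _ (K' \o u) (n \o u)) => [|j|j|j|j] /=.
- by case: hc => ->.
- have [_ <-] := hu j; have [_ h2 _ _] := hd (u j).
  by rewrite kE h2.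
- by have [uj _] := hu j; exact: leq_ltn_trans (jn _).
- by case: (hd (u j)).
- by case: (hd (u j)).
Qed.

(** Either the next digit is at bounded distance from the block and joins it, or the
gap tends to infinity and the block is peeled off. *)
Let S'_step r : S r -> (forall r', r = r'.+1 -> S' r') -> S' r.
Proof.
move=> hS hS' m s k K N m0 kE jN hK sK.
have [h|h] := often_or (fun j => K j = 0).
  have [t ht] := often_subseq (P := fun _ j => K j = 0) h.
  apply: (@sublimit_sub _ t) => [j|]; first by case: (ht j).
  apply: (sublimit_gap hS m0 (s := s) (K := K \o t) (N := N \o t)) => j //=.
  - by case: (ht j) => tj _; exact: leq_ltn_trans (jN _).
  - by case: (ht j) => _ ->.
have [t ht] := often_subseq (P := fun _ j => K j <> 0) h.
have tj j : (j <= t j)%N by case: (ht j).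
apply: (@sublimit_sub _ t) => //.
have K0 j : K (t j) != 0 by apply/eqP; case: (ht j).
have [r' [e [n [K' [rE hd]]]]] := digits (fun j => sK (t j)) K0.
have he j : e j = 1 \/ e j = -1 by case: (hd j).
have nN j : (n j < N (t j))%N.
  rewrite -(ltn_exp2l _ _ (isT : 1 < 3)%N).
  have h1 := hK (t j); have [_ h2 h3 _] := hd j.
  by move: (3 ^ n j)%N (3 ^ N (t j))%N h1 h2 h3 => x y; case: (he j) => ->; lia.
have [[v hv]|dvg] := often_cst_or_dvg (fun j => N (t j) - n j)%N.
  have [i|u hu] := @often_subseq (fun i j => (N (t j) - n j = v)%N /\ (i + v <= j)%N).
    by have [j ij Dj] := hv (i + v)%N; exists j => //; lia.
  apply: (@sublimit_sub _ u) => [j|]; first by case: (hu j).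
  have [w [c [hc hw]]] := sign_subseq (e := e \o u) (fun j => he (u j)).
  apply: (@sublimit_sub _ w) => [j|]; first by case: (hw j).
  have v0 : (0 < v)%N by have [_ [h1 _]] := hu 0%N; have := nN (u 0%N); lia.
  apply: (hS' r' rE (m * (3 ^ v)%N%:Z + c) s _ (K' \o u \o w) (n \o u \o w)) => [|j|j|j|j] /=.
  - apply/eqP; rewrite -(prednK v0) expnS PoszM mulrCA.
    by case: hc => ->; lia.
  - have [_ [h1 _]] := hu (w j); have [_ h2 _ _] := hd (u (w j)).
    have [_ <-] := hw j; rewrite kE h2.
    rewrite (_ : N (t (u (w j))) = (v + n (u (w j)))%N); last by have := nN (u (w j)); lia.
    by rewrite expnD PoszM; ring.
  - have [wj _] := hw j; have [uj [h1 h2]] := hu (w j).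
    by have := jN (t (u (w j))); have := tj (u (w j)); lia.
  - by case: (hd (u (w j))).
  - by case: (hd (u (w j))).
have [i|u hu] := @often_subseq (fun i j => (i <= N (t j) - n j)%N).
  have [J HJ] := dvg i; exists (maxn i J); first exact: leq_maxl.
  by apply: HJ; exact: leq_maxr.
apply: (@sublimit_sub _ u) => [j|]; first by case: (hu j).
apply: (sublimit_gap hS m0 (s := s) (K := K \o t \o u) (N := N \o t \o u)) => j //=.
- by have [uj _] := hu j; have := jN (t (u j)); have := tj (u j); lia.
- have [uj h1] := hu j; have [_ h2 h3 _] := hd (u j).
  have : (3 ^ n (u j) * 3 ^ j <= 3 ^ N (t (u j)))%N.
    by rewrite -expnD leq_exp2l//; have := nN (u j); lia.
  have : (2 * `|K (t (u j))| <= 3 * 3 ^ n (u j))%N.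
    by rewrite h2; move: (3 ^ n (u j))%N h3 => x; case: (he (u j)) => ->; lia.
  rewrite -(leq_pmul2r (_ : 0 < 3 ^ j)%N) ?expn_gt0// -mulnA => h4 h5.
  by rewrite -(leq_pmul2l (isT : 0 < 2)%N); lia.
Qed.

Lemma sublimit_sparse r k : (forall j, sparse r (2 * k j)) -> sublimit k false.
Proof.
suff h q : S q /\ S' q by move=> hk; apply: (h r).1 hk => j; exact/esym/addr0.
elim: q => [|q [_ IH]].
  have S0 : S 0 by exact: S_step.
  by split => //; exact: S'_step.
have Sq : S q.+1 by apply: S_step => _ [<-].
by split => //; apply: S'_step => // _ [<-].
Qed.

End Sparse.

(** * Description of the limits *)

Section Final.
Context {R : realType} (lambda : probability Gamma R).
Hypothesis lambda_haar : haar lambda.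
Local Notation lev := (@lev R).
Local Notation L2 := (L2 R).
Local Notation mean := (mean lambda).
Local Notation Pop := (Pop lambda).
Local Notation prd := (chacon_poly_prod lambda).
Local Notation sublimit := (sublimit lambda).

(** The number of nonzero digits either tends to infinity or is constant along a
subsequence. *)
Lemma theta_or_sublimit (k : nat -> int) :
  weak_cvg (fun j => koopmanZ (- k j)) (@theta R) \/ sublimit k false.
Proof.
have [[W hW]|dvg] := often_cst_or_dvg (fun j => weight (2 * `|k j|)); last first.
  by left; exact: (weak_cvg_theta lambda_haar).
right; have [t ht] := often_subseq (P := fun _ j => weight (2 * `|k j|) = W) hW.
apply: (@sublimit_sub _ _ _ t) => [j|]; first by case: (ht j).
apply: (sublimit_sparse lambda_haar (r := W)) => j /=.
have [_ <-] := ht j; have := sparse_weight (2 * `|k (t j)|).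
have [kE|kE] : `|k (t j)|%N%:Z = k (t j) \/ `|k (t j)|%N%:Z = - k (t j) by lia.
  by rewrite PoszM kE.
by rewrite PoszM kE mulrN => /sparseN; rewrite opprK.
Qed.

Lemma theta_limit : exists k : nat -> int, weak_cvg (fun j => koopmanZ (- k j)) (@theta R).
Proof.
(* twice these times have the ternary digits 11, 1111, 111111, and so on *)
pose v : nat -> nat := fix v j := if j is j'.+1 then (9 * v j' + 2)%N else 0%N.
have hv j : (j <= weight (2 * v j))%N.
  elim: j => // j IH /=.
  rewrite (_ : 2 * (9 * v j + 2) = (3 * (3 * (2 * v j)).+1).+1)%N; last by lia.
  by rewrite !weight3_1; lia.
exists (fun j => (v j)%:Z); apply: (weak_cvg_theta lambda_haar) => W; exists W => j Wj.
exact: leq_trans Wj (hv j).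
Qed.

Lemma product_limit ms n : all (leq 1) ms ->
  exists k : nat -> int, weak_cvg (fun j => koopmanZ (- k j)) (prd ms \o koopmanZ n).
Proof.
elim: ms => [_|m ms IH /= /andP[m0 /IH[rho hrho]]].
  by exists (fun=> - n) => f g; rewrite opprK; exact: cvg_cst.
have [N hN] : exists N : nat -> nat, forall j, width (N j) * (`|rho j| + 1)%N%:R <= 1 / 3 ^+ j :> R.
  suff h j : exists p, width p * (`|rho j| + 1)%N%:R <= 1 / 3 ^+ j :> R by have [N hN] := choice h; exists N.
  have c0 : 0 < (`|rho j| + 1)%N%:R :> R by rewrite ltr0n addn1.
  have e0 : 0 < 1 / 3 ^+ j / (`|rho j| + 1)%N%:R :> R by rewrite !divr_gt0// exprn_gt0.
  by have [p hp] := width_small e0; exists p; rewrite -ler_pdivlMr// ltW.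
have hN0 : width (N j) * (`|rho j| + 1)%N%:R @[j --> \oo] --> (0 : R).
  apply: (@squeeze_cvgr _ _ _ _ (fun=> 0) (fun j => 1 / 3 ^+ j)); last first.
  - exact: cvg_div_exp3.
  - exact: cvg_cst.
  apply: nearW => j; rewrite hN andbT; apply: mulr_ge0 => //; exact/ltW/width_gt0.
exists (fun j => (m * height (N j))%N%:Z + rho j).
have -> : prd (m :: ms) \o koopmanZ n = (prd ms \o koopmanZ n) \o Pop m.
  by apply/funext => f; rewrite /= koopmanZ_Pop prod_Pop.
apply: weak_cvg_peel => //.
by apply: contraction_comp; [exact: contraction_prod|exact: contraction_koopmanZ].
Qed.

(** [P_m] has no large coefficient, hence is not a monomial. *)
Lemma mean_point_le m a c : (0 < m)%N -> mean m (fun j => (a + j == c)%N%:R) <= 2 / 3.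
Proof.
have le1 p b : mean p (fun j => (b + j == c)%N%:R) <= 1.
  by rewrite -[leRHS](mean_cst lambda_haar p); apply: mean_le => j _; rewrite lern1 leq_b1.
have le2 p b : mean p (fun j => (b + j == c)%N%:R) + mean p (fun j => (b.+1 + j == c)%N%:R) <= 1.
  rewrite -meanD -[leRHS](mean_cst lambda_haar p); apply: mean_le => j _.
  by rewrite -natrD lern1; lia.
elim/ternary_ind: m a => [//|q q0 IH a _|q _ _ a _|q _ _ a _].
- by rewrite mean3//; under eq_mean do rewrite addnA; exact: IH.
- rewrite mean3_1//; under eq_mean do rewrite addnA.
  under [X in _ + X + _]eq_mean do rewrite addnA addnS.
  under [X in _ + _ + X]eq_mean do rewrite addnA.
  by have := le2 q (a + q)%N; have := le1 q.+1 (a + q)%N; lra.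
- rewrite mean3_2//; under eq_mean do rewrite addnA.
  under [X in _ + X + _]eq_mean do rewrite addnA.
  under [X in _ + _ + X]eq_mean do rewrite addnA addnS.
  by have := le2 q.+1 (a + q)%N; have := le1 q (a + q.+1)%N; lra.
Qed.

(** [P_m] maps the indicator of a level of a tower higher than [m] to a combination
of indicators of distinct levels: it is not isometric. *)
Lemma Pop_not_isometric m : (0 < m)%N -> exists f : L2, nrm (Pop m f) < nrm f.
Proof.
move=> m0; have mh := leq_height m; exists (lev m m).
rewrite -(@ltr_pXn2r _ 2)// ?nnegrE ?nrm_ge0// !nrm_sqr inner_lev// eqxx mul1r.
have levE j : (j <= m)%N -> koopmanZ j%:Z (lev m m) = lev m (m - j)%N.
  by move=> jm; have := @koopmanZ_lev R m (m - j) j; rewrite subnK// => ->.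
rewrite (inner_Pop lambda); apply: (@le_lt_trans _ _ (width m * (2 / 3))); last first.
  by have := @width_gt0 R m; lra.
rewrite -[leRHS](mean_cst lambda_haar m); apply: mean_le => i im.
rewrite innerC (inner_Pop lambda).
rewrite (@eq_mean _ lambda _ _ (fun j => width m * (0 + j == i)%N%:R)) => [|j jm].
  by rewrite meanZ ler_pM2l ?width_gt0//; exact: mean_point_le.
rewrite !levE// inner_lev ?(leq_ltn_trans (leq_subr _ _) mh)// mulrC.
by congr (_ * _%:R); lia.
Qed.

Lemma theta_not_isometric n : @theta R <> koopmanZ n.
Proof.
move=> thetaE; have h : nrm (theta (lev 0 0)) = nrm (lev 0 0) by rewrite thetaE nrm_koopmanZ.
have h2 : inner (theta (lev 0 0)) (indL setT) = width 0.
  by rewrite inner_theta inner_lev_one// -[inner (indL _) _]nrm_sqr nrm_one expr1n mulr1.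
have : inner (theta (lev 0 0)) (theta (lev 0 0)) = inner (lev 0 0) (lev 0 0).
  by rewrite -!nrm_sqr h.
rewrite inner_theta inner_lev_one// h2 inner_lev// eqxx mul1r.
by rewrite /width expr1 {thetaE h h2} => e; lra.
Qed.

Lemma unbounded_subseq (k : nat -> int) : ~ (exists M : int, forall j, `|k j| <= M) ->
  exists s : nat -> nat, forall j, (j <= s j)%N /\ (j <= `|k (s j)|)%N.
Proof.
move=> h; apply: (@often_subseq (fun i j => (i <= `|k j|)%N)) => i.
apply: contrapT => h'; apply: h; exists (i + \max_(j < i) `|k j|)%N%:Z => j.
rewrite -abszE lez_nat; have [ji|ij] := ltnP j i.
  by apply: leq_trans (leq_addl _ _); exact: (leq_bigmax (Ordinal ji)).
apply: leq_trans (leq_addr _ _); rewrite leqNgt; apply/negP => kj.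
by apply: h'; exists j => //; exact: ltnW.
Qed.

(** Along a sequence of times that tends to infinity in absolute value, the limits are
not isometric. *)
Lemma isometric_limit_bounded (k : nat -> int) n :
  weak_cvg (fun j => @koopmanZ R (- k j)) (koopmanZ n) ->
  exists M : int, forall j, `|k j| <= M.
Proof.
move=> hk; apply: contrapT => /unbounded_subseq[t ht].
have tj j : (j <= t j)%N by case: (ht j).
have hkt := weak_cvg_sub tj hk.
have [hth|[s [ms [p [hs hms hw hc]]]]] := theta_or_sublimit (k \o t).
  by apply: (@theta_not_isometric n); exact: weak_cvg_unique hth hkt.
have E : koopmanZ n = prd ms \o koopmanZ p.
  exact: weak_cvg_unique (weak_cvg_sub (k := k \o t) hs hkt) hw.
case: ms hms E hc {hw} => [_ _ /(_ erefl)[_ [c hc]]|m ms /= /andP[m0 _] E _].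
  have [_ ] := ht (s `|c|.+1); have := hs `|c|.+1; have := hc `|c|.+1 => /= ->.
  by lia.
have [f] := Pop_not_isometric m0; rewrite ltNge => /negP; apply.
rewrite -(nrm_koopmanZ n) E /= -/(Pop m _).
rewrite -[X in nrm X](prod_Pop lambda_haar) -koopmanZ_Pop.
have [_ le1] := contraction_prod lambda_haar ms.
by apply: le_trans (le1 _) _; rewrite nrm_koopmanZ.
Qed.

End Final.

Theorem theorem5p1 (R : realType) (lambda : probability Gamma R)
    (lambda_haar : haar lambda) :
  @weak_limits R =
    [set theta] `|`
    [set A | exists (ms : seq nat) (n : int),
      [/\ all (leq 1) ms, sorted leq ms
        & A = chacon_poly_prod lambda ms \o koopmanZ n]] /\
  (forall (k : nat -> int) (n : int),
    weak_cvg (fun j => @koopmanZ R (- k j)) (koopmanZ n) ->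
    exists M : int, forall j, `|k j| <= M).
Proof.
split; last exact: isometric_limit_bounded lambda_haar.
apply/seteqP; split => [A [_ [k hk]]|A [->|[ms [n [hms _ ->]]]]].
- have [hth|[s [ms [n [hs hms hw _]]]]] := theta_or_sublimit lambda_haar k.
    by left; exact: weak_cvg_unique hk hth.
  right; exists (sort leq ms), n; split.
  + by rewrite all_sort.
  + exact: sort_sorted leq_total _.
  + rewrite (weak_cvg_unique (weak_cvg_sub hs hk) hw); congr (_ \o _).
    by apply: (prod_perm lambda_haar); rewrite perm_sym perm_sort.
- split; first exact: contraction_bounded contraction_theta.
  exact: theta_limit lambda_haar.
- split; last exact: product_limit.
  apply: contraction_bounded; apply: contraction_comp (contraction_koopmanZ _).
  exact: contraction_prod.
Qed.
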